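(* Let $X=\{X_n\}_{n\ge 0}$ be a time-homogeneous Markov chain with state space a Borel set $S\subseteq\mathbb{R}$, with arbitrary initial distribution, such that $\limsup_{n\to\infty}X_n=\infty$ almost surely. Suppose there exist an integer $m\ge 1$, $\gamma>0$, $b>0$ and an increasing function $s(x)>0$ with $s(x)=o(x)$ such that, as $x\to\infty$, $$\frac{2m_1^{[s(x)]}(x)}{m_2^{[s(x)]}(x)}=\frac1x+\frac{1}{x\log x}+\ldots+\frac{1}{x\log x\cdots\log_{(m-1)}x}+\frac{\gamma+1+o(1)}{x\log x\cdots\log_{(m)}x}$$ and $m_2^{[s(x)]}(x)\to b$. Assume that, for some $\varepsilon>0$, as $x\to\infty$, $$\mathbb{P}\{|\xi(x)|>s(x)\}=o\Bigl(\frac{1}{x^2\log^{2+\varepsilon}x}\Bigr),\qquad \mathbb{E}\{|\xi(x)|^3;\ |\xi(x)|\le s(x)\}=o\Bigl(\frac{x}{\log^{1+\varepsilon}x}\Bigr),$$ and that there is a random variable $\widehat\xi$ with $\mathbb{E}\widehat\xi^{\,2}<\infty$ such that $$|\xi(y)|\,\mathbb{I}\{|\xi(y)|\le s(y)\}\le_{\rm st}\widehat\xi\qquad\text{for all }y\ge 0.$$ Then, for every function $h(x)\uparrow\infty$ with $h(x)=o(x)$ as $x\to\infty$, $$H(x,x+h(x)]\sim\frac{2h(x)}{b\gamma}\,x\log x\cdots\log_{(m)}x\qquad\text{as }x\to\infty.$$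
   Context: For a time-homogeneous Markov chain $X_n$ with state space a Borel set $S\subseteq\mathbb{R}$, $\xi(x)$ denotes a random variable with the distribution of the jump of the chain from state $x\in S$, i.e. $\mathbb{P}\{\xi(x)\in B\}=\mathbb{P}\{X_{n+1}-X_n\in B\mid X_n=x\}$ for Borel $B\subseteq\mathbb{R}$. All conditions involving $\xi(x)$ are understood for $x\in S$. For $s>0$, the $s$-truncated $k$th moment of the jump is $m_k^{[s]}(x):=\mathbb{E}\{\xi^k(x);\ |\xi(x)|\le s\}$, where $\mathbb{E}\{Y;A\}$ means $\mathbb{E}[Y\mathbb{I}_A]$. For random variables, $\xi\le_{\rm st}\eta$ means $\mathbb{P}\{\xi>t\}\le\mathbb{P}\{\eta>t\}$ for all $t\in\mathbb{R}$. The renewal measure (Green function) of the chain is $H(B):=\sum_{n=0}^\infty\mathbb{P}\{X_n\in B\}$ for Borel $B\subseteq\mathbb{R}$. $\log_{(k)}$ is the $k$-fold iterated logarithm ($\log_{(1)}=\log$, $\log_{(k+1)}=\log\circ\log_{(k)}$), and $x\log x\cdots\log_{(k)}x$ is the product $x\prod_{j=1}^{k}\log_{(j)}x$ (equal to $x$ for $k=0$); so for $m=1$ the expansion reads $\frac1x+\frac{\gamma+1+o(1)}{x\log x}$. The notation $h(x)\uparrow\infty$ means that $h$ increases to infinity as $x\to\infty$, and $f\sim g$ means $f/g\to1$. *)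

(* Defs.v *)
From HB Require Import structures.
From mathcomp Require Import all_boot all_order all_algebra.
From mathcomp Require Import all_classical all_reals all_analysis.
From mathcomp Require Import measurable_realfun.

Set Implicit Arguments.
Unset Strict Implicit.
Unset Printing Implicit Defensive.

Import Order.TTheory GRing.Theory Num.Theory.
Import numFieldNormedType.Exports.

Local Open Scope classical_set_scope.
Local Open Scope ring_scope.

(* Allows the Landau notations to be used as x -> oo, and as x -> oo in S with
   [within S (pinfty_nbhs R)]. *)
Canonical pinfty_filter_on (R : realType) :=
  FilterType (pinfty_nbhs R) (@proper_pinfty_nbhs R).

Section iterated_logarithm.
Context {R : realType}.

Definition iterlog (k : nat) (x : R) : R := iter k (@ln R) x.

(* The product x log x ... log_(k) x, equal to x for k = 0. As [ln] is
   extended by 0 to nonpositive reals, it is only meaningful for large x. *)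
Definition logprod (k : nat) (x : R) : R :=
  x * \prod_(1 <= j < k.+1) iterlog j x.

End iterated_logarithm.

(* Monotonicity is weak and only required for large arguments, so that h may
   be, for instance, an iterated logarithm. *)
Definition increases_to_infty {R : realType} (h : R -> R) : Prop :=
  (exists x0 : R, {in `[x0, +oo[ &, {homo h : x y / x <= y}}) /\
  h x @[x --> +oo] --> +oo.

Definition st_le {R : realType} d1 d2 (T1 : measurableType d1)
    (T2 : measurableType d2) (P : probability T1 R) (Q : probability T2 R)
    (X : T1 -> R) (Y : T2 -> R) : Prop :=
  forall t : R, (P [set w | (t < X w)%R] <= Q [set w | (t < Y w)%R])%E.

Section markov_chain.
Context {R : realType} d {T : measurableType d} (P : probability T R).

(* X is a time-homogeneous Markov chain with state space S, transition kernel K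
   and arbitrary initial distribution. The last field says that K (X n) B is a
   version of P(X_{n+1} in B | X_0, ..., X_n). The values of K outside S are
   irrelevant: a kernel on S can be extended by a constant one. *)
Record markov_chain (S : set R) (K : R.-pker R ~> R)
    (X : nat -> {RV P >-> R}) : Prop := MarkovChain {
  markov_state : forall n w, S (X n w) ;
  markov_kernel : forall x, S x -> K x S = 1%E ;
  markov_property : forall n (A : set T) (B : set R),
    <<s \bigcup_(i in [set i | (i <= n)%N])
          preimage_set_system setT (X i) measurable >> A ->
    measurable B ->
    P (A `&` X n.+1 @^-1` B) = (\int[P]_(w in A) K (X n w) B)%E }.

Definition renewal_measure (X : nat -> {RV P >-> R}) (B : set R) : \bar R :=
  (\sum_(0 <= n <oo) P (X n @^-1` B))%E.

End markov_chain.

Section jumps.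
Context {R : realType}.

Definition displacement (x y : R) : R := y - x.

Lemma measurable_displacement (x : R) :
  measurable_fun [set: R] (displacement x).
Proof. by apply: measurable_funB. Qed.

Implicit Type K : R.-pker R ~> R.

(* The distribution of the jump xi(x) of the chain from state x. *)
Definition jump_law K (x : R) : set R -> \bar R :=
  pushforward (K x) (displacement x).

Section jump_law_is_probability.
Variables (K : R.-pker R ~> R) (x : R).

Let jump_law0 : jump_law K x set0 = 0%E.
Proof. by rewrite /jump_law /pushforward preimage_set0 measure0. Qed.

Let jump_law_ge0 A : (0 <= jump_law K x A)%E.
Proof. by rewrite /jump_law /pushforward measure_ge0. Qed.

Let jump_law_sigma_additive : semi_sigma_additive (jump_law K x).
Proof.
move=> F mF tF _; have mX := measurable_displacement x.
rewrite /jump_law /pushforward preimage_bigcup.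
apply: measure_semi_sigma_additive.
- by move=> n; rewrite -[X in measurable X]setTI; exact: mX.
- by move=> i j _ _ [y [Fiy Fjy]]; apply: tF => //; exists (displacement x y).
- apply: bigcup_measurable => n _.
  by rewrite -[X in measurable X]setTI; exact: mX.
Qed.

HB.instance Definition _ := isMeasure.Build _ _ _ (jump_law K x)
  jump_law0 jump_law_ge0 jump_law_sigma_additive.

Let jump_law_setT : jump_law K x [set: R] = 1%E.
Proof. by rewrite /jump_law /pushforward preimage_setT prob_kernel. Qed.

HB.instance Definition _ :=
  Measure_isProbability.Build _ _ _ (jump_law K x) jump_law_setT.

End jump_law_is_probability.

Definition trunc_moment K (k : nat) (s x : R) : R :=
  \int[jump_law K x]_(u in [set u | `|u| <= s]) (u ^+ k).

Definition trunc_abs_moment K (k : nat) (s x : R) : R :=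
  \int[jump_law K x]_(u in [set u | `|u| <= s]) (`|u| ^+ k).

Definition jump_tail K (s x : R) : R := fine (jump_law K x [set u | s < `|u|]).

End jumps.

(* Main.v *)
(** Write l_j for the iterated logarithm, L_j for the product x l_1 ... l_j and
    U_g for the power of l_m with exponent -g. A Taylor expansion turns the
    assumption on the drift into
      E [U_g (y + xi) - U_g y; |xi| <= s] = (b g (g - gamma) / 2 + o(1)) U_g / L_m^2.
    Hence U_gamma is almost harmonic, while for g < gamma the function U_g,
    frozen below a high level, is a strict Lyapunov function, so that the Green
    functional of U_g / L_m^2 is finite; it absorbs all error terms.

    Fix a band [alpha, beta] and let p = U_gamma beta, q = U_gamma alpha. The
    test function is phi (U_gamma), where phi is the C^1 function which is
    linear on [0, p], has second derivative -1 on [p, q] and is constant beyond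
    q. Since limsup X_n = oo, summing its mean increments along the chain
    yields G [gap] ~ q (q - p), where gap is the mean of the concavity defect
      phi u + phi' u (w - u) - phi w   (u = U_gamma y, w = U_gamma (y + xi)).
    Inside the band the gap is close to (b / 2) (U_gamma')^2, which gives the
    renewal measure of the band. Jumps across the ends of the band are
    controlled by the dominating variable: widening the band by a constant
    gives the upper bound; for the lower bound the band is shrunk, the outside
    is split into cells of the length of the band, and the upper bound is
    applied to each cell, the tails of the dominating variable being summable. *)

Require Import Defs.
From HB Require Import structures.
From mathcomp Require Import all_boot all_order all_algebra.
From mathcomp Require Import all_classical all_reals all_analysis.
From mathcomp Require Import measurable_realfun ring lra.

Set Implicit Arguments.
Unset Strict Implicit.
Unset Printing Implicit Defensive.

Import Order.TTheory GRing.Theory Num.Theory.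
Import numFieldNormedType.Exports.

Local Open Scope classical_set_scope.
Local Open Scope ring_scope.

(** The obstacle is that h may grow arbitrarily slowly: every error must be small against q (q - p),
    which is much smaller than q ^ 2. This dictates the test function. Its derivative is at most q -
    p, so the defect of harmonicity of U_gamma enters with that factor; its maximum (q ^ 2 - p ^ 2)
    / 2 <= q (q - p) weighs the jumps longer than s. The Green functionals of the two error rates
    beyond alpha are bounded by multiples of q and of 1.

    Nothing controls the chain at low states. The test function is maximal and constant below alpha,
    so a step from there can only lower it. This is harmless for the upper bound; for the lower
    bound the loss is the chance of jumping over alpha from below a fixed level, which the Lyapunov
    function makes summable and which vanishes as alpha grows.

    The constant comes from q - p ~ h |U_gamma'| and U_gamma / |U_gamma'| = L_m / gamma: dividing q
    (q - p) by (b / 2) (U_gamma') ^ 2 gives 2 h L_m / (b gamma).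

    Jumps comparable with the band length h are measured by min (v ^ 2, h |v|), so that second
    moments suffice. *)

Section iterated_logarithm_facts.
Context {R : realType}.
Implicit Types (x y z c : R) (m j : nat).

(** The working domain: there every factor of L_m is at least 1 and l_{m+1} is nonnegative. It is
    closed upwards, so it is enough to check one point to its left. *)
Definition logs_ge1 m x := forall j, (j <= m)%N -> 1 <= iterlog j x.

Lemma iterlogS j x : iterlog j.+1 x = ln (iterlog j x).
Proof. by rewrite /iterlog iterS. Qed.

Lemma logs_ge1_ge1 m x : logs_ge1 m x -> 1 <= x.
Proof. by move=> /(_ 0%N isT). Qed.

Lemma le_iterlogS m x y j : logs_ge1 m x -> x <= y -> (j <= m.+1)%N ->
  iterlog j x <= iterlog j y.
Proof.
move=> hx xy; elim: j => // j IH jm.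
have h1 := hx j jm; have h2 := IH (ltnW jm).
by rewrite !iterlogS ler_ln ?posrE//; lra.
Qed.

Lemma logs_ge1_le m x y : logs_ge1 m x -> x <= y -> logs_ge1 m y.
Proof.
move=> hx xy j jm; apply: (le_trans (hx j jm)).
by apply: (le_iterlogS hx) => //; exact: leqW.
Qed.

Lemma iterlogS_ge0 m x : logs_ge1 m x -> 0 <= iterlog m.+1 x.
Proof. by move=> hx; rewrite iterlogS; apply: ln_ge0; exact: hx. Qed.

(** The additive term ln c <= c - 1 is absorbed into the factor c because l_j >= 1. *)
Lemma iterlogS_scale m x c j : logs_ge1 m x -> 1 <= c -> (j <= m)%N ->
  iterlog j (c * x) <= c * iterlog j x.
Proof.
move=> hx c1; elim: j => // j IH jm.
have h1 := hx j (ltnW jm); have h2 := IH (ltnW jm); have h3 := hx j.+1 jm.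
have cx : x <= c * x by rewrite ler_peMl//; have := logs_ge1_ge1 hx; lra.
have h4 := le_iterlogS hx cx (leqW (ltnW jm)).
have : ln (iterlog j (c * x)) <= ln c + ln (iterlog j x).
  by rewrite -lnM ?posrE; [rewrite ler_ln ?posrE//; nra | lra | lra].
rewrite -!iterlogS => h5.
have := @le_ln1Dx _ (c - 1); rewrite subrKC => h6.
have h7 : ln c <= c - 1 by apply: h6; lra.
by nra.
Qed.

(** At level m + 1 the logarithm is only known to be nonnegative, so the bound stays additive;
    exponentiated, it yields the factor c ^ g of [decays_scale]. *)
Lemma iterlog_scale_ln m x c : logs_ge1 m x -> 1 <= c ->
  iterlog m.+1 (c * x) <= ln c + iterlog m.+1 x.
Proof.
move=> hx c1; have h1 := hx m (leqnn _).
have h2 := iterlogS_scale hx c1 (leqnn m).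
have cx : x <= c * x by rewrite ler_peMl//; have := logs_ge1_ge1 hx; lra.
have h4 := le_iterlogS hx cx (leqnSn m).
rewrite !iterlogS -lnM ?posrE; [|lra|lra].
by rewrite ler_ln ?posrE//; nra.
Qed.

Lemma cvgry_ln : ln x @[x --> (+oo : set_system R)] --> +oo.
Proof.
apply/cvgryPge => A; near=> x.
have x0 : 0 < x by near: x; exact: nbhs_pinfty_gt.
rewrite -ler_expR lnK ?posrE//; near: x; exact: nbhs_pinfty_ge.
Unshelve. all: by end_near. Qed.

Lemma cvgry_iterlog j : iterlog j x @[x --> (+oo : set_system R)] --> +oo.
Proof.
elim: j => [|j IH]; first exact: cvg_id.
rewrite (_ : iterlog j.+1 = @ln R \o iterlog j); last first.
  by apply/funext => x; rewrite iterlogS.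
exact: cvg_comp IH cvgry_ln.
Qed.

Lemma logs_ge1_near m : \forall x \near +oo, logs_ge1 m x.
Proof.
elim: m => [|m IH].
  near=> x => j; rewrite leqn0 => /eqP ->.
  by near: x; exact: nbhs_pinfty_ge.
near=> x => j; rewrite leq_eqVlt => /predU1P[->|jm].
  by near: x; have /cvgryPge := @cvgry_iterlog m.+1; exact.
by have : logs_ge1 m x; [near: x|apply].
Unshelve. all: by end_near. Qed.

Lemma logprod0 x : logprod 0 x = x.
Proof. by rewrite /logprod big_geq// mulr1. Qed.

Lemma logprodS j x : logprod j.+1 x = logprod j x * iterlog j.+1 x.
Proof. by rewrite /logprod big_nat_recr//= mulrA. Qed.

Lemma le_id_logprod m x j : logs_ge1 m x -> (j <= m)%N -> x <= logprod j x.
Proof.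
move=> hx; elim: j => [|j IH] jm; first by rewrite logprod0.
have h := hx _ jm; have h2 := IH (ltnW jm); have := logs_ge1_ge1 hx.
by rewrite logprodS; nra.
Qed.

Lemma logprod_gt0 m x j : logs_ge1 m x -> (j <= m)%N -> 0 < logprod j x.
Proof.
by move=> hx jm; have := le_id_logprod hx jm; have := logs_ge1_ge1 hx; lra.
Qed.

Lemma le_logprod m x y j : logs_ge1 m x -> x <= y -> (j <= m)%N ->
  logprod j x <= logprod j y.
Proof.
move=> hx xy; elim: j => [|j IH] jm; first by rewrite !logprod0.
rewrite !logprodS; apply: ler_pM.
- exact: ltW (logprod_gt0 hx (ltnW jm)).
- by have := hx _ jm; lra.
- exact: IH (ltnW jm).
- exact: (le_iterlogS hx) (leqW jm).
Qed.

Lemma logprod_scale m x c j : logs_ge1 m x -> 1 <= c -> (j <= m)%N ->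
  logprod j (c * x) <= c ^+ j.+1 * logprod j x.
Proof.
move=> hx c1; have cx : x <= c * x.
  by rewrite ler_peMl//; have := logs_ge1_ge1 hx; lra.
elim: j => [|j IH] jm; first by rewrite !logprod0 expr1.
rewrite !logprodS [c ^+ _]exprSr mulrACA; apply: ler_pM.
- exact: ltW (logprod_gt0 (logs_ge1_le hx cx) (ltnW jm)).
- by have := logs_ge1_le hx cx jm; lra.
- exact: IH (ltnW jm).
- exact: iterlogS_scale hx c1 jm.
Qed.

Lemma is_derive_iterlog m x j : logs_ge1 m x -> (j <= m)%N ->
  is_derive x 1 (iterlog j.+1) (logprod j x)^-1.
Proof.
move=> hx; elim: j => [|j IH] jm.
  rewrite logprod0; have -> : iterlog 1 = @ln R by [].
  by apply: is_derive1_ln; have := logs_ge1_ge1 hx; lra.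
have h1 := hx _ jm; have h2 := IH (ltnW jm).
have -> : iterlog j.+2 = @ln R \o iterlog j.+1.
  by apply/funext => z; rewrite iterlogS.
have l0 : 0 < iterlog j.+1 x by lra.
have := @is_derive1_comp _ (@ln R) (iterlog j.+1) x _ _ (is_derive1_ln l0) h2.
by move=> h; rewrite logprodS invfM mulrC.
Qed.

(** Logarithmic derivative: the factor l_i of the product contributes l_i' / l_i = 1 / L_i, which is
    how the sum in the drift assumption arises. *)
Lemma is_derive_logprod m x j : logs_ge1 m x -> (j <= m)%N ->
  is_derive x 1 (logprod j)
    (logprod j x * \sum_(0 <= i < j.+1) (logprod i x)^-1).
Proof.
move=> hx; elim: j => [|j IH] jm.
  rewrite (_ : logprod 0 = id); last by apply/funext => z; rewrite logprod0.
  rewrite big_nat1 logprod0 mulfV; first exact: is_derive_id.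
  by have := logs_ge1_ge1 hx; apply: contraTneq => ->; rewrite ler10.
have -> : logprod j.+1 = logprod j * iterlog j.+1 :> (R -> R).
  by apply/funext => z; rewrite logprodS.
have h1 := IH (ltnW jm); have h2 := is_derive_iterlog hx (ltnW jm).
apply: is_derive_eq; rewrite /GRing.scale/=.
rewrite [X in _ = _ * X]big_nat_recr//= mulrDr.
have := logprod_gt0 hx (ltnW jm); have := hx _ jm => l1 l2.
rewrite logprodS; set t := (\sum_(_ <= _ < _) _).
rewrite -iterlogS -[(_ * _) x]/(logprod j x * iterlog j.+1 x).
by field; rewrite !gt_eqF//; lra.
Qed.

End iterated_logarithm_facts.

(** * Regular variation with explicit exponents *)

Section decay.
Context {R : realType}.
Variable m : nat.
Implicit Types (x y z c : R) (f g : R -> R).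

(* One-sided regular variation with an explicit exponent; for products of
   powers of iterated logarithms it replaces differentiation in the estimates
   of increments. *)
Definition decays (N : nat) f := forall x c, logs_ge1 m x -> 1 <= c ->
  [/\ 0 <= f (c * x), f (c * x) <= f x & f x <= c ^+ N * f (c * x)].

Lemma decays_ge0 N f x : decays N f -> logs_ge1 m x -> 0 <= f x.
Proof. by move=> df hx; have [] := df x 1 hx (lexx _); rewrite mul1r. Qed.

Lemma decays_weaken N N' f : (N <= N')%N -> decays N f -> decays N' f.
Proof.
move=> NN df x c hx c1; have [h1 h2 h3] := df x c hx c1; split => //.
by apply: (le_trans h3); rewrite ler_wpM2r// ler_weXn2l.
Qed.

Lemma decaysM N N' f g : decays N f -> decays N' g ->
  decays (N + N') (fun x => f x * g x).
Proof.
move=> df dg x c hx c1; have [h1 h2 h3] := df x c hx c1.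
have [k1 k2 k3] := dg x c hx c1; split; first exact: mulr_ge0.
  exact: ler_pM.
rewrite exprD mulrACA; apply: ler_pM => //; first exact: decays_ge0 df hx.
exact: decays_ge0 dg hx.
Qed.

Lemma decaysD N f g : decays N f -> decays N g ->
  decays N (fun x => f x + g x).
Proof.
move=> df dg x c hx c1; have [h1 h2 h3] := df x c hx c1.
have [k1 k2 k3] := dg x c hx c1; split; [lra|lra|].
by rewrite mulrDr; lra.
Qed.

Lemma decays_cst a : 0 <= a -> decays 0 (fun=> a).
Proof. by move=> a0 x c hx c1; split; rewrite ?expr0 ?mul1r. Qed.

Lemma decays_sum N n (F : nat -> R -> R) : (forall i, (i < n)%N -> decays N (F i)) ->
  decays N (fun x => \sum_(0 <= i < n) F i x).
Proof.
elim: n => [|n IH] h.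
  under eq_fun do rewrite big_geq//.
  by apply: (@decays_weaken 0) => //; exact: decays_cst.
under eq_fun do rewrite big_nat_recr//=.
by apply: decaysD; [apply: IH => i im; apply: h; exact: ltnW|exact: h].
Qed.

Lemma decays_logprodV j : (j <= m)%N -> decays j.+1 (fun x => (logprod j x)^-1).
Proof.
move=> jm x c hx c1; have cx : x <= c * x.
  by rewrite ler_peMl//; have := logs_ge1_ge1 hx; lra.
have hcx := logs_ge1_le hx cx.
have h0 := logprod_gt0 hx jm; have h1 := logprod_gt0 hcx jm.
have h2 := le_logprod hx cx jm; have h3 := logprod_scale hx c1 jm.
split; [by rewrite invr_ge0 ltW|by rewrite lef_pV2 ?posrE|].
by rewrite ler_pdivlMr// mulrC ler_pdivrMr.
Qed.

Lemma bernoulli_lower (t : R) n : 0 <= t <= 1 -> 1 - n%:R * t <= (1 - t) ^+ n.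
Proof.
move=> /andP[t0 t1]; elim: n => [|n IH]; first by rewrite expr0; lra.
rewrite exprS -natr1; have h : (0 : R) <= n%:R by [].
have h2 : 0 <= (1 - t) * ((1 - t) ^+ n - (1 - n%:R * t)).
  by apply: mulr_ge0; lra.
have h3 : 0 <= n%:R * t * t by rewrite !mulr_ge0.
by lra.
Qed.

(** For p <= q one has f q >= (1 - (q - p) / q) ^ N f p, and Bernoulli makes the loss linear in q -
    p. The factor 2 ^ N serves the case z < y, where f z is compared with f y using y <= 2 z. *)
Lemma decays_lip N f y z : decays N f -> logs_ge1 m y -> logs_ge1 m z ->
  `|z - y| <= y / 2 -> `|f z - f y| <= N%:R * 2 ^+ N * (f y * (`|z - y| / y)).
Proof.
move=> df hy hz dzy.
have [y1 z1] := (logs_ge1_ge1 hy, logs_ge1_ge1 hz).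
have fy0 := decays_ge0 df hy; have fz0 := decays_ge0 df hz.
have N0 : (0 : R) <= N%:R by [].
have p1 : (1 : R) <= 2 ^+ N by rewrite exprn_ege1// ler1n.
have key p q : logs_ge1 m p -> p <= q ->
    0 <= f p - f q <= N%:R * (f p * ((q - p) / q)).
  move=> hp pq; have p1' := logs_ge1_ge1 hp.
  have c1 : 1 <= q / p by rewrite ler_pdivlMr; lra.
  have [_] := df p (q / p) hp c1; rewrite divfK; [|by rewrite gt_eqF//; lra] => h1 h2.
  apply/andP; split; first by rewrite subr_ge0.
  have t0 : 0 <= (q - p) / q by apply: divr_ge0; lra.
  have t1 : (q - p) / q <= 1 by rewrite ler_pdivrMr; lra.
  have := @bernoulli_lower ((q - p) / q) N; rewrite t0 t1 => /(_ isT) hb.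
  have e : 1 - (q - p) / q = (q / p)^-1 by field; rewrite !gt_eqF//; lra.
  rewrite e exprVn in hb.
  have hp0 : 0 < (q / p) ^+ N by apply: exprn_gt0; lra.
  have h3 : ((q / p) ^+ N)^-1 * f p <= f q by rewrite mulrC ler_pdivrMr// mulrC.
  have fp0 := decays_ge0 df hp.
  have h4 : (1 - N%:R * ((q - p) / q)) * f p <= ((q / p) ^+ N)^-1 * f p.
    by rewrite ler_wpM2r.
  by lra.
have [yz|/ltW zy] := leP y z.
  have /andP[k1 k2] := key _ _ hy yz.
  rewrite distrC ger0_norm// ger0_norm; [|by rewrite subr_ge0].
  apply: (le_trans k2); apply: ler_pM => //.
  - by rewrite mulr_ge0// divr_ge0//; lra.
  - by rewrite ler_peMr.
  - by rewrite ler_wpM2l// ler_wpM2l ?subr_ge0// lef_pV2 ?posrE//; lra.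
have /andP[k1 k2] := key _ _ hz zy.
rewrite ger0_norm// distrC ger0_norm; [|by rewrite subr_ge0].
apply: (le_trans k2); rewrite -!mulrA ler_wpM2l// [leRHS]mulrA.
rewrite ler_wpM2r//; first by apply: divr_ge0; lra.
have c1 : 1 <= y / z by rewrite ler_pdivlMr; lra.
have [_] := df z (y / z) hz c1; rewrite divfK; [|by rewrite gt_eqF//; lra] => h1 h2.
apply: (le_trans h2); rewrite ler_wpM2r// lerXn2r ?nnegrE//; [lra|].
rewrite ler_pdivrMr; [|lra].
by rewrite distrC ger0_norm in dzy; lra.
Qed.

End decay.

Lemma mvt_bound (R : realType) (f df : R -> R) (y z M : R) :
  (forall t, Num.min y z <= t <= Num.max y z -> is_derive t 1 f (df t)) ->
  (forall t, Num.min y z <= t <= Num.max y z -> `|df t| <= M) ->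
  `|f z - f y| <= M * `|z - y|.
Proof.
wlog yz : y z / y <= z => [hw|].
  have /orP[|zy] := le_total y z; first exact: hw.
  by move=> h1 h2; rewrite distrC [`|z - y|]distrC; apply: hw => // t;
    rewrite minC maxC; [exact: h1|exact: h2].
rewrite (min_idPl yz) (max_idPr yz) => h1 h2.
have [c cyz ->] : exists2 c, c \in `[y, z]%R & f z - f y = df c * (z - y).
  apply: MVT_segment => //.
    by move=> t /[!in_itv]/= /andP[ty tz]; apply: h1; rewrite !ltW.
  apply: continuous_in_subspaceT => t; rewrite inE/= in_itv/= => tyz.
  apply: differentiable_continuous; apply/derivable1_diffP.
  exact: (@ex_derive _ _ _ _ _ _ _ (h1 _ tyz)).
by rewrite normrM ler_wpM2r//; apply: h2; rewrite in_itv/= in cyz.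
Qed.

(** * The functions U_g, their derivatives and their Taylor expansion *)

Section scale_functions.
Context {R : realType}.
Variables (m : nat) (g : R).
Hypothesis g_gt0 : 0 < g.
Implicit Types (x y z v : R).

(** This is l_m ^ (-g); the exponential form keeps it positive for every argument. *)
Definition scale x : R := expR (- (g * iterlog m.+1 x)).

Definition slope x : R := g * scale x / logprod m x.

(** The second derivative of [scale]. Its bracket is the assumed drift with g in place of gamma, so
    in - slope * m_1 + curvature * m_2 / 2 the sums cancel and only (g - gamma) / L_m survives. *)
Definition curvature x : R :=
  slope x * (\sum_(0 <= j < m) (logprod j x)^-1 + (g + 1) / logprod m x).

Lemma scale_gt0 x : 0 < scale x. Proof. exact: expR_gt0. Qed.

Lemma scale_le1 x : logs_ge1 m x -> scale x <= 1.
Proof.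
by move=> hx; rewrite /scale expR_le1 oppr_le0 mulr_ge0 ?(ltW g_gt0)// iterlogS_ge0.
Qed.

Lemma slope_gt0 x : logs_ge1 m x -> 0 < slope x.
Proof.
move=> hx; apply: divr_gt0; first by rewrite mulr_gt0// scale_gt0.
exact: logprod_gt0 hx (leqnn m).
Qed.

Lemma is_derive_scale x : logs_ge1 m x -> is_derive x 1 scale (- slope x).
Proof.
move=> hx; have h := is_derive_iterlog hx (leqnn m).
rewrite /scale; apply: is_derive_eq.
by rewrite /slope /scale /GRing.scale/= -iterlogS; ring.
Qed.

Lemma is_derive_slope x : logs_ge1 m x -> is_derive x 1 slope (- curvature x).
Proof.
move=> hx; have h := is_derive_scale hx.
have h2 := is_derive_logprod hx (leqnn m); have h0 := logprod_gt0 hx (leqnn m).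
have h3 := is_deriveV (lt0r_neq0 h0) h2.
have -> : slope = (fun x => g * scale x * (logprod m x)^-1) by [].
apply: is_derive_eq; rewrite /curvature /slope /GRing.scale/=.
rewrite [X in _ * (_ * (_ * X))]big_nat_recr//=.
set t := \sum_(_ <= _ < _) _; field.
by rewrite gt_eqF.
Qed.

Lemma decays_scale N : g <= N%:R -> decays m N scale.
Proof.
move=> gN x c hx c1; have cx : x <= c * x.
  by rewrite ler_peMl//; have := logs_ge1_ge1 hx; lra.
have g0 := ltW g_gt0; have h1 := iterlog_scale_ln hx c1.
split; first exact: ltW (scale_gt0 _).
  by rewrite /scale ler_expR lerN2 ler_wpM2l// (le_iterlogS hx cx).
have c0 : 0 < c by lra.
rewrite /scale -[c in c ^+ N](@lnK R c) ?posrE// -expRM_natr -expRD ler_expR.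
have h2 : g * iterlog m.+1 (c * x) <= g * (ln c + iterlog m.+1 x).
  by rewrite ler_wpM2l.
have h3 : ln c * g <= ln c * N%:R by rewrite ler_wpM2l// ln_ge0.
by lra.
Qed.

(** One exponent for all three: g rounded up for [scale], and m + 1 more for each factor 1 / L_m. *)
Lemma scale_functions_decay :
  exists N, [/\ decays m N scale, decays m N slope & decays m N curvature].
Proof.
pose N := (Num.trunc g).+1; have gN : g <= N%:R by exact: ltW (truncnS_gt _).
have g0 := ltW g_gt0.
have h1 := decays_scale gN.
have h2 : decays m (N + m.+1) slope.
  apply: decaysM; last exact: decays_logprodV.
  by rewrite -[N]add0n; apply: decaysM => //; exact: decays_cst.
have h3 : decays m (N + m.+1 + m.+1) curvature.
  apply: decaysM => //; apply: decaysD.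
    apply: decays_sum => i im; apply: (@decays_weaken _ _ i.+1); first exact: ltnW.
    exact/decays_logprodV/ltnW.
  rewrite -[m.+1]add0n; apply: decaysM; last exact: decays_logprodV.
  by apply: decays_cst; rewrite addr_ge0.
exists (N + m.+1 + m.+1)%N; split => //.
  by apply: (decays_weaken _ h1); rewrite -addnA leq_addr.
by apply: (decays_weaken _ h2); rewrite leq_addr.
Qed.

Lemma curvature_le x : logs_ge1 m x ->
  curvature x <= (m%:R + g + 1) * (slope x / x).
Proof.
move=> hx; have x1 := logs_ge1_ge1 hx; have s0 := ltW (slope_gt0 hx).
have hV j : (j <= m)%N -> (logprod j x)^-1 <= x^-1.
  move=> jm; rewrite lef_pV2 ?posrE; [exact: le_id_logprod hx jm| |lra].
  exact: logprod_gt0 hx jm.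
have h1 : \sum_(0 <= j < m) (logprod j x)^-1 <= m%:R * x^-1.
  rewrite mulr_natl -[m in x^-1 *+ m]subn0 -sumr_const_nat.
  by rewrite !big_nat; apply: ler_sum => i /andP[_ im]; exact: hV (ltnW im).
have h2 : (g + 1) / logprod m x <= (g + 1) * x^-1.
  by rewrite ler_wpM2l ?hV// addr_ge0// ltW.
rewrite /curvature [leRHS](_ : _ = slope x * (m%:R * x^-1 + (g + 1) * x^-1)).
  by rewrite ler_wpM2l// lerD.
by field; lra.
Qed.

(** The Lipschitz bound [decays_lip] for [curvature] takes the place of a third derivative, and
    [curvature_le] converts curvature / y into slope / y ^ 2. *)
Lemma taylor_scale : exists2 C : R, 0 <= C & forall y v, logs_ge1 m y ->
  logs_ge1 m (y + v) -> `|v| <= y / 2 ->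
  `|scale (y + v) - scale y + slope y * v - curvature y * v ^+ 2 / 2|
    <= C * (slope y / y ^+ 2) * `|v| ^+ 3.
Proof.
have [N [_ _ dc]] := scale_functions_decay.
exists (N%:R * 2 ^+ N * (m%:R + g + 1)).
  by rewrite !mulr_ge0// ?exprn_ge0// !addr_ge0// ltW.
move=> y v hy hz vy; set z := y + v in hz *.
have y1 := logs_ge1_ge1 hy; have zv : z - y = v by rewrite addrC addKr.
have between t : Num.min y z <= t <= Num.max y z -> logs_ge1 m t /\ `|t - y| <= `|v|.
  move=> /andP[t1 t2]; split.
    by apply: logs_ge1_le t1; case: (leP y z).
  rewrite -zv; move: t1 t2; case: (leP y z) => h.
    by move=> h1 h2; rewrite !ger0_norm; lra.
  by move=> h1 h2; rewrite distrC [leRHS]distrC !ger0_norm; lra.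
set M := N%:R * 2 ^+ N * (curvature y / y).
have cy0 := decays_ge0 dc hy.
have M0 : 0 <= M by rewrite /M; apply: mulr_ge0; [rewrite mulr_ge0// exprn_ge0|apply: divr_ge0; lra].
have nv := normr_ge0 v.
have lip t : logs_ge1 m t -> `|t - y| <= `|v| ->
    `|curvature t - curvature y| <= M * `|v|.
  move=> ht tv; apply: (le_trans (decays_lip dc hy ht (le_trans tv vy))).
  have -> : M * `|v| = N%:R * 2 ^+ N * (curvature y * (`|v| / y)).
    by rewrite /M; ring.
  apply: ler_wpM2l; first by rewrite mulr_ge0// exprn_ge0.
  by apply: ler_wpM2l => //; rewrite ler_wpM2r// invr_ge0; lra.
(* a bound on the derivative of the Taylor remainder, to which the mean value
   theorem is then applied *)
have d1 t : logs_ge1 m t -> `|t - y| <= `|v| ->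
    `|slope t - slope y + curvature y * (t - y)| <= M * `|v| * `|t - y|.
  move=> ht tv.
  pose f u := slope u + curvature y * (u - y).
  have -> : slope t - slope y + curvature y * (t - y) = f t - f y.
    by rewrite /f; ring.
  have sub u : Num.min y t <= u <= Num.max y t -> logs_ge1 m u /\ `|u - y| <= `|v|.
    move=> /andP[u1 u2]; split; first by apply: logs_ge1_le u1; case: (leP y t).
    apply: le_trans tv; move: u1 u2; case: (leP y t) => h.
      by move=> h1 h2; rewrite !ger0_norm; lra.
    by move=> h1 h2; rewrite distrC [leRHS]distrC !ger0_norm; lra.
  apply: (@mvt_bound _ f (fun u => - curvature u + curvature y)) => u /sub[hu uv].
    have hs := is_derive_slope hu; rewrite /f.
    by apply: is_derive_eq; rewrite /GRing.scale/=; ring.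
  by rewrite -normrN opprD opprK; exact: lip.
pose f u := scale u + slope y * (u - y) - curvature y * (u - y) ^+ 2 / 2.
have -> : scale z - scale y + slope y * v - curvature y * v ^+ 2 / 2 = f z - f y.
  by rewrite /f zv; field.
have h : `|f z - f y| <= M * `|v| ^+ 2 * `|z - y|.
  apply: (@mvt_bound _ f (fun u => - slope u + slope y - curvature y * (u - y))).
    move=> u /between[hu uv]; have hs := is_derive_scale hu; rewrite /f.
    by apply: is_derive_eq; rewrite /GRing.scale/=; field.
  move=> u /between[hu uv]; rewrite -normrN.
  rewrite [X in `|X|](_ : _ = slope u - slope y + curvature y * (u - y)); [|ring].
  apply: (le_trans (d1 _ hu uv)).
  by rewrite expr2 mulrA ler_wpM2l// mulr_ge0.
rewrite zv in h; apply: (le_trans h); rewrite -mulrA -exprSr.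
apply: ler_wpM2r; first exact: exprn_ge0.
have hc := curvature_le hy.
rewrite [leRHS](_ : _ = N%:R * 2 ^+ N * ((m%:R + g + 1) * (slope y / y) / y));
  last by field; lra.
apply: ler_wpM2l; first by rewrite mulr_ge0// exprn_ge0.
by rewrite ler_wpM2r// invr_ge0; lra.
Qed.

End scale_functions.

(** * Comparison of L_m with powers of the logarithm *)

Section growth.
Context {R : realType}.
Implicit Types (x y g : R).

Lemma cvg_scale0 m g : 0 < g -> scale m g x @[x --> +oo] --> (0 : R).
Proof.
move=> g0; have h : g * iterlog m.+1 x @[x --> (+oo : set_system R)] --> +oo.
  apply/cvgryPge => A; have /cvgryPge/(_ (A / g)) := @cvgry_iterlog R m.+1.
  by apply: filterS => x; rewrite ler_pdivrMr// mulrC.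
exact: (cvg_comp _ (fun x : R => expR (- x)) h (@cvgr_expR R)).
Qed.

(** The inequality 1 + r <= exp r at r = d t / n, raised to the power n. *)
Lemma exprn_le_expR (d t : R) n : 0 < d -> 0 <= t ->
  t ^+ n <= (n%:R / d) ^+ n * expR (d * t).
Proof.
move=> d0 t0; case: n => [|n].
  by rewrite !expr0 mul1r -expR0 ler_expR mulr_ge0// ltW.
have n0 : 0 < n.+1%:R :> R by [].
have e : expR (d * t) = expR (d * t / n.+1%:R) ^+ n.+1.
  by rewrite -expRM_natr divfK// gt_eqF.
rewrite e -exprMn lerXn2r ?nnegrE//.
  by rewrite mulr_ge0// ?expR_ge0// divr_ge0// ltW.
have h := expR_ge1Dx (d * t / n.+1%:R).
have c0 : 0 < n.+1%:R / d by rewrite divr_gt0.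
have h2 : n.+1%:R / d * (1 + d * t / n.+1%:R) <= n.+1%:R / d * expR (d * t / n.+1%:R).
  by rewrite ler_pM2l.
have h3 : n.+1%:R / d * (1 + d * t / n.+1%:R) = n.+1%:R / d + t.
  by field; rewrite !gt_eqF.
by rewrite h3 in h2; apply: le_trans h2; rewrite lerDr ltW.
Qed.

(** The factors beyond l_1 are all at most l_2, and a power of l_2 is dominated by exp (d l_2) = l_1
    ^ d. *)
Lemma logprod_le_ln m d : (0 < m)%N -> 0 < d -> exists2 C : R, 0 < C &
  forall x, logs_ge1 m x -> logprod m x <= C * (x * expR ((1 + d) * iterlog 2 x)).
Proof.
move=> m0 d0; case: m m0 => // m _; set C := (m%:R / d) ^+ m.
have C0 : 0 <= C by rewrite exprn_ge0// divr_ge0// ltW.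
exists (C + 1) => [|x hx]; first by lra.
have x1 := logs_ge1_ge1 hx; have l1 := hx 1%N isT.
have l20 : 0 <= iterlog 2 x by rewrite iterlogS; apply: ln_ge0; exact: hx.
have dec j : (j <= m)%N -> iterlog j.+2 x <= iterlog j.+1 x.
  move=> jm; rewrite [leLHS]iterlogS ltW// ln_sublinear//.
  by have := hx j.+1 jm; lra.
have le2 j : (j <= m)%N -> iterlog j.+2 x <= iterlog 2 x.
  by elim: j => // j IH jm; apply: le_trans (dec _ jm) (IH (ltnW jm)).
have main j : (j <= m)%N -> 0 <= logprod j.+1 x <= x * iterlog 1 x * iterlog 2 x ^+ j.
  elim: j => [|j IH] jm.
    by rewrite logprodS logprod0 expr0 mulr1 lexx andbT mulr_ge0//; lra.
  have /andP[h1 h2] := IH (ltnW jm); have h3 := le2 _ (ltnW jm).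
  have h4 : 1 <= iterlog j.+2 x by exact: hx.
  rewrite logprodS exprSr mulrA mulr_ge0//; last by lra.
  by rewrite andTb; apply: ler_pM => //; lra.
have /andP[_ h] := main _ (leqnn m); apply: (le_trans h).
have e : iterlog 1 x = expR (iterlog 2 x).
  by rewrite (iterlogS 1) lnK// posrE; lra.
rewrite e [(1 + d) * _]mulrDl mul1r expRD mulrDl mul1r -[leLHS]mulrA.
have h5 := exprn_le_expR m d0 l20.
have p1 := expR_gt0 (iterlog 2 x); have p2 := expR_gt0 (d * iterlog 2 x).
apply: (@le_trans _ _ (C * (x * (expR (iterlog 2 x) * expR (d * iterlog 2 x))))).
  rewrite [leRHS](_ : _ = x * (expR (iterlog 2 x) * (C * expR (d * iterlog 2 x)))); last by ring.
  by rewrite ler_wpM2l ?ler_wpM2l ?expR_ge0//; lra.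
by rewrite lerDl mulr_ge0 ?mulr_ge0 ?expR_ge0//; lra.
Qed.

Lemma ln_powR_iterlog x (a : R) : 1 <= iterlog 1 x -> ln x `^ a = expR (a * iterlog 2 x).
Proof.
move=> h; rewrite /powR gt_eqF//; first by rewrite /iterlog/= in h *; lra.
Qed.

Lemma logprod_le m eps : (0 < m)%N -> 0 < eps -> exists2 C : R, 0 < C &
  forall x, logs_ge1 m x -> logprod m x <= C * (x * ln x `^ (1 + eps)).
Proof.
move=> m0 e0; have [C C0 h] := logprod_le_ln m0 e0; exists C => // x hx.
by rewrite ln_powR_iterlog ?h//; exact: hx.
Qed.

(** This makes 1 / (x ^ 2 ln ^ (2 + eps) x) a bounded multiple of U_g / L_m ^ 2, the rate at which
    U_g drifts. Besides l_1 ^ (2 + 2 d) for L_m ^ 2, a factor l_1 ^ g is left to dominate l_m ^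
    g. *)
Lemma sqr_logprod_le m eps g : (0 < m)%N -> 0 < g < eps -> exists2 C : R, 0 < C &
  forall x, logs_ge1 m x ->
    logprod m x ^+ 2 <= C * (x ^+ 2 * ln x `^ (2 + eps)) * scale m g x.
Proof.
(* Chosen so that 2 (1 + d) + g = 2 + eps. *)
move=> m0 /andP[g0 ge]; pose d := (eps - g) / 2.
have d0 : 0 < d by rewrite /d; lra.
have [C C0 h] := logprod_le_ln m0 d0; exists (C ^+ 2) => [|x hx].
  exact: exprn_gt0.
have x1 := logs_ge1_ge1 hx.
have l20 : 0 <= iterlog 2 x by rewrite iterlogS; apply: ln_ge0; exact: hx.
have dec j : (j < m)%N -> iterlog j.+2 x <= iterlog 2 x.
  elim: j => // j IH jm; apply: le_trans (IH (ltnW jm)).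
  by rewrite [leLHS]iterlogS ltW// ln_sublinear//; have := hx j.+2 jm; lra.
have hm : iterlog m.+1 x <= iterlog 2 x.
  by case: m m0 dec {h hx} => // k _ h; exact: h.
have h1 := h x hx; have L0 := logprod_gt0 hx (leqnn m).
apply: (@le_trans _ _ ((C * (x * expR ((1 + d) * iterlog 2 x))) ^+ 2)).
  by rewrite lerXn2r ?nnegrE//; lra.
rewrite !exprMn -!mulrA ler_wpM2l ?exprn_ge0//; first by lra.
rewrite ler_wpM2l ?exprn_ge0//; first by lra.
rewrite ln_powR_iterlog; last exact: hx.
rewrite /scale -expRD -expRM_natr.
do 2! (apply: ler_wpM2l; first lra).
rewrite ler_expR /d.
have : g * iterlog m.+1 x <= g * iterlog 2 x by rewrite ler_wpM2l// ltW.
by lra.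
Qed.

End growth.

(** * The concave test function of a band and its concavity defect *)

Section band_function.
Context {R : realType}.
Variables p q : R.
Hypotheses (p_ge0 : 0 <= p) (p_le_q : p <= q).
Implicit Types u w : R.

(** The function phi of the overview, normalised by phi 0 = 0. Written with squared positive parts
    it is one measurable formula on the whole line, and [bandP] recovers the three pieces. *)
Definition band u : R :=
  (q ^+ 2 - p ^+ 2 - Num.max (q - u) 0 ^+ 2 + Num.max (p - u) 0 ^+ 2) / 2.

Definition dband u : R := Num.max (q - u) 0 - Num.max (p - u) 0.

Definition band_gap u w : R := band u + dband u * (w - u) - band w.

Variant band_spec u : R -> R -> Prop :=
| BandLow of u <= p : band_spec u ((q - p) * u) (q - p)
| BandMid of p <= u <= q :
    band_spec u ((q ^+ 2 - p ^+ 2 - (q - u) ^+ 2) / 2) (q - u)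
| BandHigh of q <= u : band_spec u ((q ^+ 2 - p ^+ 2) / 2) 0.

Lemma bandP u : band_spec u (band u) (dband u).
Proof.
have pq := p_le_q; rewrite /band /dband; case: (leP u p) => [up|/ltW pu].
  rewrite (max_idPl _) ?subr_ge0//; last by lra.
  rewrite (max_idPl _) ?subr_ge0//.
  have -> : (q ^+ 2 - p ^+ 2 - (q - u) ^+ 2 + (p - u) ^+ 2) / 2 = (q - p) * u.
    by field.
  by rewrite (_ : q - u - (p - u) = q - p); [exact: BandLow|ring].
rewrite [Num.max (p - u) 0](max_idPr _) ?subr_le0//; case: (leP u q) => [uq|/ltW qu].
  rewrite (max_idPl _) ?subr_ge0// subr0 (expr0n _ 2) addr0.
  by apply: BandMid; rewrite pu.
rewrite (max_idPr _) ?subr_le0// subr0 expr0n/= subr0 addr0; exact: BandHigh.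
Qed.

Lemma band_ge u : q <= u -> band u = (q ^+ 2 - p ^+ 2) / 2.
Proof. by have pq := p_le_q; case: bandP => h1 h2 //; nra. Qed.

Lemma band_le_max u : band u <= (q ^+ 2 - p ^+ 2) / 2.
Proof. by have pq := p_le_q; have p0 := p_ge0; case: bandP => h1 //; nra. Qed.

Lemma band_ge0 u : 0 <= u -> 0 <= band u.
Proof.
move=> u0; have pq := p_le_q; have p0 := p_ge0.
by case: bandP => [h|/andP[h1 h2]|h]; nra.
Qed.

Lemma band_le u : 0 <= u -> band u <= (q - p) * u.
Proof.
move=> u0; have pq := p_le_q; have p0 := p_ge0.
by case: bandP => [h|/andP[h1 h2]|h]; nra.
Qed.

Lemma dband_ge0 u : 0 <= dband u.
Proof.
have pq := p_le_q; have p0 := p_ge0.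
by case: bandP => [h|/andP[h1 h2]|h]; nra.
Qed.

Lemma dband_le u : dband u <= q - p.
Proof.
have pq := p_le_q; have p0 := p_ge0.
by case: bandP => [h|/andP[h1 h2]|h]; nra.
Qed.

Lemma dband_ge u : q <= u -> dband u = 0.
Proof.
move=> qu; have pq := p_le_q.
by case: bandP => [h|/andP[h1 h2]|h]; nra.
Qed.

(** Concavity: the tangent lies above the graph. *)
Lemma band_gap_ge0 u w : 0 <= band_gap u w.
Proof.
have pq := p_le_q; rewrite /band_gap.
have s1 := sqr_ge0 (w - u); have s2 := sqr_ge0 (w - p).
have s3 := sqr_ge0 (w - q); have s4 := sqr_ge0 (u - p).
have s5 := sqr_ge0 (u - q).
by case: (bandP u) => [h|/andP[h1 h2]|h]; case: (bandP w) => [k|/andP[k1 k2]|k]; nra.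
Qed.

(** The derivative [dband] is 1-Lipschitz. *)
Lemma band_gap_le_sqr u w : band_gap u w <= (w - u) ^+ 2 / 2.
Proof.
have pq := p_le_q; rewrite /band_gap.
have s1 := sqr_ge0 (w - u); have s2 := sqr_ge0 (w - p).
have s3 := sqr_ge0 (w - q); have s4 := sqr_ge0 (u - p).
have s5 := sqr_ge0 (u - q).
by case: (bandP u) => [h|/andP[h1 h2]|h]; case: (bandP w) => [k|/andP[k1 k2]|k]; nra.
Qed.

(** Tangent and graph have slopes in [0, q - p]. For jumps that are long compared with the band this
    beats the quadratic bound. *)
Lemma band_gap_le_norm u w : band_gap u w <= (q - p) * `|w - u|.
Proof.
have pq := p_le_q; have h1 : w - u <= `|w - u| := ler_norm _.
have h2 : u - w <= `|w - u| by rewrite distrC ler_norm.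
rewrite /band_gap; set a := `|w - u| in h1 h2 *.
by case: (bandP u) => [h|/andP[h h']|h]; case: (bandP w) => [k|/andP[k k']|k]; nra.
Qed.

Lemma band_gap_mid u w : p <= u <= q -> p <= w <= q ->
  band_gap u w = (w - u) ^+ 2 / 2.
Proof.
move=> /andP[u1 u2] /andP[w1 w2]; have pq := p_le_q; rewrite /band_gap.
by case: (bandP u) => [h|/andP[h h']|h]; case: (bandP w) => [k|/andP[k k']|k]; nra.
Qed.

Lemma band_gap_high u w : q <= u -> q <= w -> band_gap u w = 0.
Proof. by move=> qu qw; rewrite /band_gap dband_ge// !band_ge// mul0r addr0 subrr. Qed.

Lemma band_gap_low u w : u <= p -> w <= p -> band_gap u w = 0.
Proof.
move=> up wp; have pq := p_le_q; rewrite /band_gap.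
by case: (bandP u) => [h|/andP[h h']|h]; case: (bandP w) => [k|/andP[k k']|k]; nra.
Qed.

Lemma measurable_band : measurable_fun [set: R] band.
Proof.
apply: measurable_funM => //; apply: measurable_funD.
  apply: measurable_funB => //; apply: measurable_funX.
  by apply: measurable_maxr => //; apply: measurable_funB.
by apply: measurable_funX; apply: measurable_maxr => //; apply: measurable_funB.
Qed.

End band_function.

(** * Integration against conditional laws *)

Section bounded_integral.
Context {R : realType} d {T : measurableType d}.
Variable mu : probability T R.

Lemma bounded_integrable (A : set T) (f : T -> R) (M : R) : measurable A ->
  measurable_fun [set: T] f -> (forall x, A x -> `|f x| <= M) ->
  mu.-integrable A (EFin \o f).
Proof.
move=> mA mf fM; apply: measurable_bounded_integrable => //.
- by rewrite (le_lt_trans (probability_le1 mu mA))// ltry.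
- exact: measurable_funTS.
- exists M; split; first exact: num_real.
  by move=> x Mx y Ay /=; rewrite (le_trans (fM y Ay))// ltW.
Qed.

End bounded_integral.

Section restricted_kernel.
Context {R : realType} d {T : measurableType d}.
Variables (P : probability T R) (A : set T).
Variable k : T -> {measure set R -> \bar R}.
Hypothesis mA : measurable A.
Hypothesis mk : forall U, measurable U -> measurable_fun [set: T] (k ^~ U).
Hypothesis k1 : forall w, k w [set: R] = 1%E.

Let ind_ge0 (w : T) : 0 <= \1_A w :> R. Proof. by []. Qed.

(** The dummy [unit] and the weight \1_A turn the mixture of the measures k w over w in A into a
    composition of kernels, so that the integration theorem for [kcomp] applies. *)
Definition restricted_kernel (p : unit * T) : {measure set R -> \bar R} :=
  mscale (NngNum (ind_ge0 p.2)) (k p.2).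

Let measurable_restricted_kernel U : measurable U ->
  measurable_fun [set: unit * T] (restricted_kernel ^~ U).
Proof.
move=> mU; rewrite /restricted_kernel/= /mscale/=; apply: emeasurable_funM.
  by apply/measurable_EFinP; apply: measurableT_comp.
exact: (measurableT_comp (mk mU)).
Qed.

HB.instance Definition _ :=
  isKernel.Build _ _ _ _ _ restricted_kernel measurable_restricted_kernel.

Let restricted_kernel_uub : measure_fam_uub restricted_kernel.
Proof.
exists 2 => -[u w] /=; rewrite /mscale/= k1 mule1 lte_fin.
by rewrite indicE; case: (w \in A) => /=; lra.
Qed.

HB.instance Definition _ :=
  Kernel_isFinite.Build _ _ _ _ _ restricted_kernel restricted_kernel_uub.

Let cstP (u : unit) : pprobability T R := P.
Let mcstP : measurable_fun [set: unit] cstP. Proof. by []. Qed.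

Let indic_integral (g : T -> \bar R) :
  (\int[P]_w ((\1_A w)%:E * g w) = \int[P]_(w in A) g w)%E.
Proof.
rewrite [RHS]integral_mkcond; apply: eq_integral => w _.
by rewrite patchE indicE; case: (w \in A); rewrite ?mul1e ?mul0e.
Qed.

Definition mixture := kcomp (kprobability mcstP) restricted_kernel tt.

HB.instance Definition _ := Measure.on mixture.

Definition mixture_measure : {measure set R -> \bar R} := mixture.

Lemma mixtureE B : mixture B = (\int[P]_(w in A) k w B)%E.
Proof. by rewrite /mixture /kcomp/= /mscale/= indic_integral. Qed.

Lemma integral_mixture (f : R -> \bar R) :
  measurable_fun [set: R] f -> (forall x, 0 <= f x)%E ->
  (\int[mixture]_x f x = \int[P]_(w in A) \int[k w]_z f z)%E.
Proof.
move=> mf f0; rewrite integral_kcomp//= -indic_integral.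
by apply: eq_integral => w _; rewrite ge0_integral_mscale.
Qed.

End restricted_kernel.

(** Both sides are integrals of f against mixtures over A, of the Dirac masses at Z w and of the
    laws K (Y w); the hypothesis says that these two measures coincide. *)
Lemma integral_conditional_law (R : realType) d (T : measurableType d)
    (P : probability T R) (K : R.-pker R ~> R) (A : set T) (Y Z : T -> R) :
  measurable A -> measurable_fun [set: T] Y -> measurable_fun [set: T] Z ->
  (forall B, measurable B ->
    P (A `&` Z @^-1` B) = (\int[P]_(w in A) K (Y w) B)%E) ->
  forall f : R -> \bar R, measurable_fun [set: R] f -> (forall x, 0 <= f x)%E ->
  (\int[P]_(w in A) f (Z w) = \int[P]_(w in A) \int[K (Y w)]_z f z)%E.
Proof.
move=> mA mY mZ hZ f mf f0.
have mk U : measurable U -> measurable_fun [set: T] (fun w => K (Y w) U).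
  by move=> mU; exact: (measurableT_comp (measurable_kernel K U mU)).
have md U : measurable U ->
    measurable_fun [set: T] (fun w => \d_(Z w) U : \bar R).
  move=> mU; rewrite /dirac; apply/measurable_EFinP.
  by apply: measurableT_comp => //; exact: measurable_indic.
have d1 w : \d_(Z w) [set: R] = 1%E :> \bar R by rewrite diracT.
rewrite -(@integral_mixture _ _ _ P A (fun w => K (Y w)) mA mk)//; last first.
  by move=> w; exact: prob_kernel.
transitivity (\int[P]_(w in A) \int[\d_(Z w)]_z f z)%E.
  by apply: eq_integral => w _; rewrite integral_dirac// diracT mul1e.
rewrite -(@integral_mixture _ _ _ P A (fun w => \d_(Z w)) mA md)//.
apply: eq_measure_integral => B mB _.
transitivity (\int[P]_(w in A) (\d_(Z w) B : \bar R))%E; first exact: mixtureE.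
transitivity (\int[P]_(w in A) K (Y w) B)%E; last exact/esym/mixtureE.
have mZB : measurable (Z @^-1` B) by rewrite -[_ @^-1` _]setTI; exact: mZ.
by rewrite -hZ// setIC -integral_indic.
Qed.

(** * Drift inequalities and Green functionals of the chain *)

Section markov_drift.
Context {R : realType} d {T : measurableType d} {P : probability T R}.
Context {S : set R} {K : R.-pker R ~> R} {X : nat -> {RV P >-> R}}.
Hypothesis HX : markov_chain S K X.
Implicit Types (f e : R -> R) (M : R).

Definition mean_step (k : R.-pker R ~> R) f (y : R) : R := \int[k y]_z f z.

Definition bounded_test f M :=
  measurable_fun [set: R] f /\ (forall x, 0 <= f x <= M).

Definition law_mean f n : \bar R := (\int[P]_w (f (X n w))%:E)%E.

Definition green e : \bar R := (\sum_(0 <= n <oo) law_mean e n)%E.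

Lemma kernel_integrable f M y : bounded_test f M ->
  (K y).-integrable setT (EFin \o f).
Proof.
move=> [mf fM]; apply: measurable_bounded_integrable => //.
  by rewrite prob_kernel ltry.
exists M; split; first exact: num_real.
move=> x Mx z _ /=; have /andP[f0 f1] := fM z.
by rewrite ger0_norm// (le_trans f1)// ltW.
Qed.

Lemma mean_stepE f M y : bounded_test f M ->
  (mean_step K f y)%:E = (\int[K y]_z (f z)%:E)%E.
Proof.
by move=> bf; rewrite fineK//; exact: integrable_fin_num (kernel_integrable y bf).
Qed.

Lemma mean_step_bounded f M : bounded_test f M -> bounded_test (mean_step K f) M.
Proof.
move=> bf; have [mf fM] := bf; split.
  apply/measurable_EFinP; rewrite (_ : EFin \o _ = fun y => (\int[K y]_z (f z)%:E)%E).
    apply: measurable_fun_integral_kernel.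
    - by move=> U mU; exact: (measurable_kernel K U mU).
    - by move=> z; rewrite lee_fin; have /andP[] := fM z.
    - exact/measurable_EFinP.
  by apply/funext => y /=; exact: mean_stepE bf.
move=> y; rewrite -!lee_fin (mean_stepE _ bf); apply/andP; split.
  by apply: integral_ge0 => z _; rewrite lee_fin; have /andP[] := fM z.
apply: (@le_trans _ _ (\int[K y]_z (cst M%:E) z)%E).
  apply: ge0_le_integral => //.
  - by move=> z _; rewrite lee_fin; have /andP[] := fM z.
  - exact/measurable_EFinP.
  - by move=> z _; rewrite lee_fin; have /andP[] := fM z.
by rewrite integral_cst// prob_kernel mule1.
Qed.

Lemma mean_stepD f e M N y : bounded_test f M -> bounded_test e N ->
  mean_step K (fun z => f z + e z) y = mean_step K f y + mean_step K e y.
Proof.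
move=> bf be; rewrite /mean_step RintegralD//.
- exact: kernel_integrable bf.
- exact: kernel_integrable be.
Qed.

Lemma mean_step_indic c B y : measurable B ->
  mean_step K (fun z => c * \1_B z) y = c * fine (K y B).
Proof.
move=> mB; rewrite /mean_step RintegralZl//.
  by rewrite /Rintegral integral_indic// setIT.
apply: (@kernel_integrable \1_B 1); split; first exact: measurable_indic.
by move=> z; rewrite indicE; case: (z \in B) => /=; rewrite ?lexx ?ler01.
Qed.

Let mX n : measurable_fun [set: T] (X n). Proof. by []. Qed.

Let past n := <<s \bigcup_(i in [set i | (i <= n)%N])
  preimage_set_system setT (X i) measurable >>.

Lemma past_measurable n A : past n A -> measurable A.
Proof.
apply; split; first exact: sigma_algebra_measurable.
by move=> B [i _] [C mC <-]; exact: mX.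
Qed.

Lemma integral_next n A f M : past n A -> bounded_test f M ->
  (\int[P]_(w in A) (f (X n.+1 w))%:E =
   \int[P]_(w in A) (mean_step K f (X n w))%:E)%E.
Proof.
move=> pA bf; have [mf fM] := bf; have mA := past_measurable pA.
under [RHS]eq_integral do rewrite (mean_stepE _ bf).
apply: (@integral_conditional_law _ _ _ P K A (X n) (X n.+1) mA _ _ _ (EFin \o f)) => //.
- by move=> B mB; exact: (markov_property HX).
- exact/measurable_EFinP.
- by move=> x; rewrite lee_fin; have /andP[] := fM x.
Qed.

Lemma past_setT n : past n setT.
Proof.
rewrite -setC0; apply: sigma_algebraC; exact: sigma_algebra0.
Qed.

Lemma law_mean_next n f M : bounded_test f M ->
  law_mean f n.+1 = law_mean (mean_step K f) n.
Proof.
move=> bf; rewrite /law_mean.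
exact: (integral_next (@past_setT n) bf).
Qed.

Lemma measurable_law f n : measurable_fun [set: R] f ->
  measurable_fun [set: T] (fun w => (f (X n w))%:E).
Proof. by move=> mf; apply/measurable_EFinP/measurableT_comp. Qed.

Lemma le_law_mean f e n : measurable_fun [set: R] f -> measurable_fun [set: R] e ->
  (forall y, 0 <= f y) -> (forall y, S y -> f y <= e y) ->
  (law_mean f n <= law_mean e n)%E.
Proof.
move=> mf me f0 fe; apply: ge0_le_integral => //.
- by move=> w _; rewrite lee_fin.
- exact: measurable_law.
- exact: measurable_law.
- by move=> w _; rewrite lee_fin; apply: fe; exact: (markov_state HX).
Qed.

Lemma law_mean_ge0 f n : (forall y, 0 <= f y) -> (0 <= law_mean f n)%E.
Proof. by move=> f0; apply: integral_ge0 => w _; rewrite lee_fin. Qed.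

Lemma law_meanD f e n : measurable_fun [set: R] f -> measurable_fun [set: R] e ->
  (forall y, 0 <= f y) -> (forall y, 0 <= e y) ->
  law_mean (fun y => f y + e y) n = (law_mean f n + law_mean e n)%E.
Proof.
move=> mf me f0 e0; rewrite /law_mean -ge0_integralD//.
- by move=> w _; rewrite lee_fin.
- exact: measurable_law.
- by move=> w _; rewrite lee_fin.
- exact: measurable_law.
Qed.

Lemma law_meanZ c f n : measurable_fun [set: R] f ->
  (forall y, 0 <= f y) -> 0 <= c ->
  law_mean (fun y => c * f y) n = (c%:E * law_mean f n)%E.
Proof.
move=> mf f0 c0; rewrite /law_mean -ge0_integralZl//.
- exact: measurable_law.
- by move=> w _; rewrite lee_fin.
Qed.

Lemma law_mean_le_cst f M n : bounded_test f M -> (law_mean f n <= M%:E)%E.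
Proof.
move=> [mf fM]; apply: (@le_trans _ _ (law_mean (fun=> M) n)).
  apply: le_law_mean => // y; first by have /andP[] := fM y.
  by have /andP[] := fM y.
rewrite /law_mean integral_cst//.
rewrite muleC -[leRHS]mul1e; apply: lee_wpmul2r; last exact: probability_le1.
by rewrite lee_fin; have /andP[h1] := fM 0; exact: le_trans.
Qed.

Lemma green_ge0 e : (forall y, 0 <= e y) -> (0 <= green e)%E.
Proof. by move=> e0; apply: nneseries_ge0 => n _ _; exact: law_mean_ge0. Qed.

Lemma le_green f e : measurable_fun [set: R] f -> measurable_fun [set: R] e ->
  (forall y, 0 <= f y) -> (forall y, S y -> f y <= e y) -> (green f <= green e)%E.
Proof.
move=> mf me f0 fe; apply: lee_nneseries => [n _ _|n _].
  exact: law_mean_ge0.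
exact: le_law_mean.
Qed.

Lemma greenD f e : measurable_fun [set: R] f -> measurable_fun [set: R] e ->
  (forall y, 0 <= f y) -> (forall y, 0 <= e y) ->
  green (fun y => f y + e y) = (green f + green e)%E.
Proof.
move=> mf me f0 e0; rewrite /green -nneseriesD//.
- by apply: eq_eseriesr => n _; exact: law_meanD.
- by move=> n _ _; exact: law_mean_ge0.
- by move=> n _ _; exact: law_mean_ge0.
Qed.

Lemma greenZ c f : measurable_fun [set: R] f ->
  (forall y, 0 <= f y) -> 0 <= c ->
  green (fun y => c * f y) = (c%:E * green f)%E.
Proof.
move=> mf f0 c0; rewrite /green -nneseriesZl//.
  by apply: eq_eseriesr => n _; exact: law_meanZ.
by move=> n _; exact: law_mean_ge0.
Qed.

Lemma green_indic B : measurable B -> green \1_B = renewal_measure X B.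
Proof.
move=> mB; apply: eq_eseriesr => n _; rewrite /law_mean.
have mXB : measurable (X n @^-1` B) by rewrite -[_ @^-1` _]setTI; exact: mX.
by rewrite -(setIT (X n @^-1` B)) -integral_indic.
Qed.

Lemma green_sum (I : Type) (r : seq I) (F : I -> R -> R) :
  (forall i, measurable_fun [set: R] (F i)) -> (forall i y, 0 <= F i y) ->
  green (fun y => \sum_(i <- r) F i y) = (\sum_(i <- r) green (F i))%E.
Proof.
move=> mF F0; elim: r => [|i r IH].
  rewrite big_nil (_ : (fun _ => _) = fun=> 0); last first.
    by apply/funext => y; rewrite big_nil.
  rewrite /green eseries0// => n _ _; rewrite /law_mean.
  by rewrite integral0.
rewrite big_cons -IH -greenD//.
- by congr green; apply/funext => y; rewrite big_cons.
- exact: measurable_sum.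
- by move=> y; apply: sumr_ge0.
Qed.

(** Telescoping of mean increments. The error terms are nonnegative and placed on both sides, so
    that extended reals are never subtracted. *)
Lemma law_mean_drift f e1 e2 M N : bounded_test f M ->
  measurable_fun [set: R] e1 -> measurable_fun [set: R] e2 ->
  (forall y, 0 <= e1 y) -> (forall y, 0 <= e2 y) ->
  (forall y, S y -> mean_step K f y + e1 y <= f y + e2 y) ->
  (law_mean f N + \sum_(0 <= n < N) law_mean e1 n <=
   law_mean f 0 + \sum_(0 <= n < N) law_mean e2 n)%E.
Proof.
move=> bf m1 m2 p1 p2 h; have [mf fM] := bf.
have [mg gM] := mean_step_bounded bf.
have f0 y : 0 <= f y by have /andP[] := fM y.
have g0 y : 0 <= mean_step K f y by have /andP[] := gM y.
elim: N => [|N IH]; first by rewrite !big_geq.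
rewrite !big_nat_recr//= (law_mean_next N bf).
have step : (law_mean (mean_step K f) N + law_mean e1 N <=
    law_mean f N + law_mean e2 N)%E.
  rewrite -!law_meanD//; apply: le_law_mean => //.
  - exact: measurable_funD.
  - exact: measurable_funD.
  - by move=> y; rewrite addr_ge0.
rewrite (addeC (\sum_(0 <= n < N) law_mean e1 n)%E) addeA.
apply: (@le_trans _ _ (law_mean f N + law_mean e2 N + \sum_(0 <= n < N) law_mean e1 n)%E).
  exact: leeD.
rewrite addeAC [leRHS]addeA; by apply: leeD.
Qed.

Lemma law_mean_drift_ge f e M N : bounded_test f M ->
  measurable_fun [set: R] e -> (forall y, 0 <= e y) ->
  (forall y, S y -> f y <= mean_step K f y + e y) ->
  (law_mean f 0 <= law_mean f N + \sum_(0 <= n < N) law_mean e n)%E.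
Proof.
move=> bf m2 p2 h; have [mf fM] := bf.
have [mg gM] := mean_step_bounded bf.
have f0 y : 0 <= f y by have /andP[] := fM y.
have g0 y : 0 <= mean_step K f y by have /andP[] := gM y.
elim: N => [|N IH]; first by rewrite !big_geq// adde0.
rewrite !big_nat_recr//= (law_mean_next N bf); apply: (le_trans IH).
rewrite addeCA addeC; apply: leeD => //; rewrite -law_meanD//.
apply: le_law_mean => //; exact: measurable_funD.
Qed.

(** The final mean is dropped by positivity and the initial one is at most M. *)
Lemma green_drift f e1 e2 M : bounded_test f M ->
  measurable_fun [set: R] e1 -> measurable_fun [set: R] e2 ->
  (forall y, 0 <= e1 y) -> (forall y, 0 <= e2 y) ->
  (forall y, S y -> mean_step K f y + e1 y <= f y + e2 y) ->
  (green e1 <= M%:E + green e2)%E.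
Proof.
move=> bf m1 m2 p1 p2 h; have [mf fM] := bf; apply: lime_le.
  by apply: is_cvg_nneseries => n _ _; exact: law_mean_ge0.
near=> N; have := law_mean_drift N bf m1 m2 p1 p2 h.
have h0 : (\sum_(0 <= n < N) law_mean e1 n <=
    law_mean f N + \sum_(0 <= n < N) law_mean e1 n)%E.
  by rewrite leeDr// law_mean_ge0// => y; have /andP[] := fM y.
move=> /(le_trans h0) /le_trans; apply; apply: leeD.
  exact: law_mean_le_cst.
by apply: nneseries_lim_ge => n _ _; exact: law_mean_ge0.
Unshelve. all: by end_near. Qed.

(** In this direction the final mean cannot be dropped, but it is enough that it be small at one
    time for each eta. *)
Lemma green_drift_ge f e M : bounded_test f M ->
  measurable_fun [set: R] e -> (forall y, 0 <= e y) ->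
  (forall y, S y -> f y <= mean_step K f y + e y) ->
  (forall eta, 0 < eta -> exists N, (law_mean f N <= eta%:E)%E) ->
  (law_mean f 0 <= green e)%E.
Proof.
move=> bf m2 p2 h lim0; apply/lee_addgt0Pr => eta eta0.
have [N hN] := lim0 _ eta0; apply: (le_trans (law_mean_drift_ge N bf m2 p2 h)).
rewrite addeC; apply: leeD => //.
by apply: nneseries_lim_ge => n _ _; exact: law_mean_ge0.
Qed.

(** The event that the hitting time of [a, +oo[ is at most n. It belongs to the past at time n,
    which lets these events stand in for stopping times. *)
Definition reached (a : R) n : set T :=
  \bigcup_(j in [set j | (j <= n)%N]) (X j @^-1` `[a, +oo[).

Lemma past_reached a n : past n (reached a n).
Proof.
rewrite /reached bigcup_mkcond; apply: sigma_algebra_bigcup => j.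
case: ifPn => [/[!inE] jn|_]; last exact: sigma_algebra0.
apply: sub_sigma_algebra; exists j => //; exists (`[a, +oo[)%classic => //.
by rewrite setTI.
Qed.

Lemma reachedS a n : reached a n.+1 = reached a n `|` (X n.+1 @^-1` `[a, +oo[).
Proof.
apply/seteqP; split=> [w [j /= jn Xj]|w [[j /= jn Xj]|Xn]].
- by move: jn; rewrite leq_eqVlt => /predU1P[jE|jn]; [right; rewrite -jE|left; exists j].
- by exists j => //=; exact: leqW.
- by exists n.+1 => /=.
Qed.

(** Optional stopping in disguise: at the moment of entry f is at most delta, and afterwards the
    mean over the event does not increase. *)
Lemma reached_mean f M a delta n : bounded_test f M -> 0 <= delta ->
  (forall y, S y -> mean_step K f y <= f y) -> (forall y, a <= y -> f y <= delta) ->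
  (\int[P]_(w in reached a n) (f (X n w))%:E <= delta%:E * P (reached a n))%E.
Proof.
move=> bf d0 hf fd; have [mf fM] := bf.
have [mg gM] := mean_step_bounded bf.
have f0 y : 0 <= f y by have /andP[] := fM y.
have small B m : measurable B -> (forall w, B w -> a <= X m w) ->
    (\int[P]_(w in B) (f (X m w))%:E <= delta%:E * P B)%E.
  move=> mB hB; rewrite -integral_cst//; apply: ge0_le_integral => //.
  - by move=> w _; rewrite lee_fin.
  - by apply: measurable_funTS; exact: measurable_law.
  - by move=> w Bw; rewrite lee_fin; exact/fd/hB.
have mr m := past_measurable (@past_reached a m).
elim: n => [|n IH].
  apply: small => [|w [j /=]]; first exact: mr.
  rewrite leqn0 => /eqP -> /=.
  by rewrite in_itv/= andbT.
have mZ : measurable (X n.+1 @^-1` `[a, +oo[).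
  by rewrite -[_ @^-1` _]setTI; exact: mX.
(* The event that [a, +oo[ is entered for the first time at time n + 1. *)
pose D := (X n.+1 @^-1` `[a, +oo[) `\` reached a n.
have mD : measurable D by exact: measurableD.
have dD : [disjoint reached a n & D].
  by rewrite disj_set2E /D setDE setICA setICr setI0.
have -> : reached a n.+1 = reached a n `|` D by rewrite reachedS /D setUDr setDv setD0.
rewrite ge0_integral_setU//; last 2 first.
- by apply: measurable_funTS; exact: measurable_law.
- by move=> w _; rewrite lee_fin.
rewrite measureU//; last by apply/eqP; rewrite -disj_set2E.
rewrite ge0_muleDr//; apply: leeD.
  rewrite (integral_next (@past_reached a n) bf); apply: le_trans IH.
  apply: ge0_le_integral => //.
  - by move=> w _; rewrite lee_fin; have /andP[] := gM (X n w).
  - by apply: measurable_funTS; exact: measurable_law.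
  - by apply: measurable_funTS; exact: measurable_law.
  - by move=> w _; rewrite lee_fin; apply: hf; exact: (markov_state HX).
by apply: small => // w [] /=; rewrite in_itv/= andbT.
Qed.

Hypothesis Xlimsup : {ae P, forall w, limn_esup (fun n => (X n w)%:E) = +oo%E}.

Lemma ae_reached a : {ae P, forall w, (\bigcup_n reached a n) w}.
Proof.
move: Xlimsup; apply: filterS => w hw; apply: contrapT => hn.
have Xa n : X n w <= a.
  rewrite leNgt; apply/negP => an; apply: hn; exists n => //.
  by exists n => //=; rewrite in_itv/= andbT ltW.
have : (limn_esup (fun n => (X n w)%:E) <= a%:E)%E.
  rewrite limn_esup_lim; apply: lime_le; first exact: is_cvg_esups.
  by apply: nearW => n; apply: ge_ereal_sup => _ [m _ <-]; rewrite lee_fin.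
by rewrite hw.
Qed.

Lemma cvg_reached a : P (reached a n) @[n --> \oo] --> 1%E.
Proof.
have mr m := past_measurable (@past_reached a m).
have mU : measurable (\bigcup_n reached a n) by apply: bigcup_measurable => n _; exact: mr.
have h0 : P (~` \bigcup_n reached a n) = 0%E.
  have h : P.-negligible (~` \bigcup_n reached a n).
    by apply: negligibleS (ae_reached a).
  by move/negligibleP : h; apply; exact: measurableC.
have -> : 1%E = P (\bigcup_n reached a n) :> \bar R.
  transitivity (P (~` \bigcup_n reached a n) + P (\bigcup_n reached a n))%E.
    rewrite -measureU//; [|exact: measurableC|by rewrite setICl].
    by rewrite setvU; exact/esym/probability_setT.
  by rewrite h0 add0e.
apply: nondecreasing_cvg_mu => // m n mn; apply/subsetPset => w [j /= jm Xj].
by exists j => //=; exact: leq_trans mn.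
Qed.

(** Once [a, +oo[ has been visited the mean of f stays below eta / 2, and since limsup X_n = oo the
    chance of not having visited it tends to 0. *)
Lemma superharmonic_vanish f M : bounded_test f M -> f x @[x --> +oo] --> 0 ->
  (forall y, S y -> mean_step K f y <= f y) ->
  forall eta, 0 < eta -> exists N, (law_mean f N <= eta%:E)%E.
Proof.
move=> bf f0 hf eta eta0; have [mf fM] := bf.
have fge0 y : 0 <= f y by have /andP[] := fM y.
have M0 : 0 <= M by have /andP[h1] := fM 0; exact: le_trans.
have e2 : 0 < eta / 2 by rewrite divr_gt0.
have [a ha] : exists a, forall y, a <= y -> f y <= eta / 2.
  have /cvgrPdist_le/(_ _ e2)[a [_ ha]] := f0; exists (a + 1) => y ay.
  have := ha y; rewrite sub0r normrN ger0_norm//; apply; lra.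
have mr m := past_measurable (@past_reached a m).
(* The tolerated probability of not having reached [a, +oo[; with M + 1 instead of M the case M = 0
   is included. *)
have d0 : 0 < eta / (2 * (M + 1)) by rewrite divr_gt0// mulr_gt0//; lra.
have [N hN] : exists N, (1 - (eta / (2 * (M + 1)))%:E <= P (reached a N))%E.
  have /fine_cvgP[_ h] := cvg_reached a.
  have h1 : 1 - eta / (2 * (M + 1)) < 1 by lra.
  have [n _ hn] := cvgr_gt _ h _ h1; exists n; rewrite -EFinB.
  by rewrite -(fineK (fin_num_measure P _ (mr n))) lee_fin ltW//; exact: hn (leqnn n).
exists N; have mA := mr N; have mC : measurable (~` reached a N) by exact: measurableC.
rewrite /law_mean -(setvU (reached a N)) ge0_integral_setU//; last 3 first.
- by rewrite setvU; exact: measurable_law.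
- by move=> w _; rewrite lee_fin.
- by rewrite disj_set2E setICl.
have h1 := reached_mean N bf (ltW e2) hf ha.
have h2 : (\int[P]_(w in ~` reached a N) (f (X N w))%:E <= M%:E * P (~` reached a N))%E.
  rewrite -integral_cst//; apply: ge0_le_integral => //.
  - by move=> w _; rewrite lee_fin.
  - by apply: measurable_funTS; exact: measurable_law.
  - by move=> w _; rewrite lee_fin; have /andP[] := fM (X N w).
have h3 : (P (~` reached a N) <= (eta / (2 * (M + 1)))%:E)%E.
  rewrite probability_setC// leeBlDr ?fin_num_measure//.
  by rewrite -leeBlDl.
have h4 : ((eta / 2)%:E * P (reached a N) <= (eta / 2)%:E)%E.
  by rewrite -[leRHS]mule1 lee_wpmul2l ?probability_le1// lee_fin ltW.
have h5 : (M%:E * P (~` reached a N) <= (M * (eta / (2 * (M + 1))))%:E)%E.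
  by rewrite EFinM lee_wpmul2l// lee_fin.
apply: (le_trans (leeD (le_trans h2 h5) (le_trans h1 h4))).
rewrite -EFinD lee_fin.
have -> : M * (eta / (2 * (M + 1))) = (eta / 2) * (M / (M + 1)) by field; lra.
have h6 : M / (M + 1) <= 1 by rewrite ler_pdivrMr; lra.
by nra.
Qed.

End markov_drift.

(** * Stochastic domination and tail moments of the dominating variable *)

Section stochastic_domination.
Context {R : realType}.
Implicit Types c h z r : R.

Lemma ge0_integral_ccdf d (T : measurableType d) (P : probability T R)
    (f : T -> R) : measurable_fun [set: T] f -> (forall w, 0 <= f w) ->
  (\int[P]_w (f w)%:E =
   \int[@lebesgue_measure R]_(r in `[0%R, +oo[) P [set w | (r < f w)%R])%E.
Proof.
move=> mf f0; have @Z : {RV P >-> R} := HB.pack f (isMeasurableFun.Build _ _ _ _ f mf).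
have := @ge0_expectation_ccdf _ _ _ P Z f0; rewrite expectation_def => ->.
apply: eq_integral => r _; rewrite /ccdf /distribution /pushforward.
by congr (P _); apply/seteqP; split => w /=; rewrite in_itv/= andbT.
Qed.

(** By the layer cake formula only the superlevel sets of psi matter, and [ray] makes them open
    half-lines, which are the sets compared in [st_le]. *)
Lemma st_le_integral d1 d2 (T1 : measurableType d1) (T2 : measurableType d2)
    (P : probability T1 R) (Q : probability T2 R) (X : T1 -> R) (Y : T2 -> R)
    (psi : R -> R) : measurable_fun [set: T1] X -> measurable_fun [set: T2] Y ->
  measurable_fun [set: R] psi -> (forall z, 0 <= psi z) ->
  (forall r, 0 <= r -> exists t, forall z, (r < psi z) = (t < z)) ->
  st_le P Q X Y ->
  (\int[P]_w (psi (X w))%:E <= \int[Q]_w (psi (Y w))%:E)%E.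
Proof.
move=> mX mY mpsi psi0 ray XY.
have mpX : measurable_fun [set: T1] (psi \o X) by exact: measurableT_comp.
have mpY : measurable_fun [set: T2] (psi \o Y) by exact: measurableT_comp.
rewrite [leLHS](ge0_integral_ccdf P mpX) 1?[leRHS](ge0_integral_ccdf Q mpY); try by move=> w; exact: psi0.
have mccdf d (T : measurableType d) (p : probability T R) (f : T -> R) :
    measurable_fun [set: T] f ->
    measurable_fun (`[0%R, +oo[ : set R) (fun r => p [set w | r < f w]).
  move=> mf; have @Z : {RV p >-> R} := HB.pack f (isMeasurableFun.Build _ _ _ _ f mf).
  apply: measurable_funTS; rewrite (_ : (fun _ => _) = ccdf Z).
    exact: ccdf_measurable.
  apply/funext => r; rewrite /ccdf /distribution /pushforward.
  by congr (p _); apply/seteqP; split => w /=; rewrite in_itv/= andbT.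
apply: ge0_le_integral => //; [exact: mccdf|exact: mccdf|].
move=> r /=; rewrite in_itv/= andbT => r0; have [t ht] := ray r r0.
have := XY t; congr (_ <= _)%E.
  by congr (P _); apply/seteqP; split => w /=; rewrite ht.
by congr (Q _); apply/seteqP; split => w /=; rewrite ht.
Qed.

(* Comparable to the square for arguments up to [h] and to a linear function
   beyond, so that it sums well over a partition into intervals of length [h]. *)
Definition tail_moment c h z : R :=
  if c < z then Num.min (z ^+ 2) (h * z) else 0.

Lemma tail_moment_ge0 c h z : 0 <= c -> 0 <= h -> 0 <= tail_moment c h z.
Proof.
move=> c0 h0; rewrite /tail_moment; case: ifPn => // cz.
by rewrite le_min sqr_ge0 mulr_ge0// ltW// (le_lt_trans c0).
Qed.

Lemma tail_moment_le c h z : tail_moment c h z <= if c < z then z ^+ 2 else 0.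
Proof. by rewrite /tail_moment; case: ifPn => // cz; rewrite ge_min lexx. Qed.

Lemma measurable_tail_moment c h : measurable_fun [set: R] (tail_moment c h).
Proof.
apply: measurable_fun_ifT => //; first exact: measurable_fun_ltr.
apply: measurable_minr => //; exact: measurable_funM.
Qed.

Lemma tail_moment_ray c h r : 0 <= c -> 0 < h -> 0 <= r ->
  exists t, forall z, (r < tail_moment c h z) = (t < z).
Proof.
move=> c0 h0 r0; exists (Num.max c (Num.max (Num.sqrt r) (r / h))) => z.
rewrite /tail_moment !gt_max; case: (ltP c z) => cz /=; last first.
  by rewrite ltNge r0.
have z0 : 0 < z by exact: le_lt_trans cz.
rewrite lt_min ltr_pdivrMr// [h * z]mulrC; congr (_ && _).
by rewrite -[in RHS](@ger0_norm _ z) ?(ltW z0)// -sqrtr_sqr ltr_sqrt// exprn_gt0.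
Qed.

(** Fewer than z / h of the thresholds with index k >= 1 lie below z, and each contributes at most h
    z, so together at most z ^ 2; the index 0 accounts for the other z ^ 2. *)
Lemma sum_tail_moment c h z n : 0 <= c -> 0 < h ->
  \sum_(0 <= k < n) tail_moment (c + k%:R * h) h z <=
  2 * (if c < z then z ^+ 2 else 0).
Proof.
move=> c0 h0; case: ltP => cz; last first.
  rewrite big_nat big1 ?mulr0// => k _; rewrite /tail_moment ltNge.
  by rewrite (le_trans cz)// lerDl mulr_ge0// ltW.
have z0 : 0 < z by exact: le_lt_trans cz.
have z2 : 0 <= z ^+ 2 by exact: sqr_ge0.
(* The bound k h is carried along for the induction: when (k + 1) h < z, the new term keeps the sum
   below z. *)
have count k : \sum_(1 <= i < k.+1) (if i%:R * h < z then h else 0) <=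
    Num.min (k%:R * h) z.
  elim: k => [|k IH]; first by rewrite big_geq// mul0r le_min lexx ltW.
  rewrite big_nat_recr//=; move: IH; rewrite !le_min => /andP[i1 i2].
  rewrite -natr1 mulrDl mul1r; case: ltP => hk; last first.
    by rewrite addr0 i2 andbT; lra.
  by apply/andP; split; lra.
case: n => [|n]; first by rewrite big_geq// mulr_ge0.
rewrite big_ltn// mul0r addr0 mulr2n mulrDl mul1r; apply: lerD.
  by have := tail_moment_le c h z; rewrite cz.
apply: (@le_trans _ _ (z * \sum_(1 <= i < n.+1) (if i%:R * h < z then h else 0))).
  rewrite mulr_sumr; apply: ler_sum => k _; rewrite /tail_moment.
  case: ltP => hk; last first.
    by case: ifPn => _; rewrite ?mulr0// mulr_ge0// ltW.
  by rewrite ifT ?ge_min; [rewrite mulrC lexx orbT|lra].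
rewrite expr2 ler_wpM2l ?(ltW z0)//; have := count n; rewrite le_min.
by case/andP.
Qed.

Section dominating_variable.
Context d {T : measurableType d} (Q : probability T R) (xi : {RV Q >-> R}).
Hypothesis xi_L2 : ('E_Q[fun w => (xi w ^+ 2)%R] < +oo)%E.

Definition dominating_tail c h : R := \int[Q]_w tail_moment c h (xi w).

Definition sqr_tail c : R := \int[Q]_w (if c < xi w then xi w ^+ 2 else 0).

Let measurable_xi : measurable_fun [set: T] xi. Proof. by []. Qed.

Let measurable_sqr_above c :
  measurable_fun [set: T] (fun w => if c < xi w then xi w ^+ 2 else 0).
Proof.
apply: measurable_fun_ifT => //.
  exact: measurable_fun_ltr.
exact: measurable_funX.
Qed.

Let sqr_integrable : Q.-integrable setT (EFin \o (fun w => xi w ^+ 2)).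
Proof.
apply/integrableP; split; first by apply/measurable_EFinP; exact: measurable_funX.
move: xi_L2; rewrite unlock; congr (_ < _)%E.
by apply: eq_integral => w _ /=; rewrite ger0_norm// sqr_ge0.
Qed.

Let sqr_tail_integrable c :
  Q.-integrable setT (EFin \o (fun w => if c < xi w then xi w ^+ 2 else 0)).
Proof.
apply: le_integrable sqr_integrable => //; first exact/measurable_EFinP.
move=> w _ /=; rewrite lee_fin; case: ifPn => // _.
by rewrite normr0.
Qed.

Let tail_integrable c h : 0 <= c -> 0 <= h ->
  Q.-integrable setT (EFin \o (fun w => tail_moment c h (xi w))).
Proof.
move=> c0 h0; apply: le_integrable (sqr_tail_integrable c) => //.
  by apply/measurable_EFinP; apply: measurableT_comp; [exact: measurable_tail_moment|].
move=> w _ /=; rewrite lee_fin ger0_norm ?tail_moment_ge0//.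
by rewrite (le_trans (tail_moment_le _ _ _))// ler_norm.
Qed.

Lemma dominating_tailE c h : 0 <= c -> 0 <= h ->
  (dominating_tail c h)%:E = (\int[Q]_w (tail_moment c h (xi w))%:E)%E.
Proof.
by move=> c0 h0; rewrite fineK//; exact: integrable_fin_num (tail_integrable c0 h0).
Qed.

Lemma dominating_tail_ge0 c h : 0 <= c -> 0 <= h -> 0 <= dominating_tail c h.
Proof. by move=> c0 h0; apply: Rintegral_ge0 => w _; exact: tail_moment_ge0. Qed.

Lemma dominating_tail_le c h : 0 <= c -> 0 <= h -> dominating_tail c h <= sqr_tail c.
Proof.
move=> c0 h0; apply: le_Rintegral => //; first exact: tail_integrable.
by move=> w _; exact: tail_moment_le.
Qed.

Lemma sum_dominating_tail c h n : 0 <= c -> 0 < h ->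
  \sum_(0 <= k < n) dominating_tail (c + k%:R * h) h <= 2 * sqr_tail c.
Proof.
move=> c0 h0; have h0' := ltW h0.
have ck k : 0 <= c + k%:R * h by rewrite addr_ge0// mulr_ge0.
rewrite -lee_fin -sumEFin /sqr_tail -RintegralZl//.
under eq_bigr do rewrite dominating_tailE//.
rewrite -ge0_integral_sum//; last 2 first.
- move=> k; apply/measurable_EFinP; apply: measurableT_comp => //.
  exact: measurable_tail_moment.
- by move=> k w _; rewrite lee_fin tail_moment_ge0.
rewrite fineK; last first.
  apply: integrable_fin_num => //.
  have := integrableZl measurableT 2 (sqr_tail_integrable c).
  by apply: eq_integrable => // w _ /=; rewrite EFinM.
apply: ge0_le_integral => //.
- by move=> w _; apply: sume_ge0 => k _; rewrite lee_fin tail_moment_ge0.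
- apply: emeasurable_sum => k; apply/measurable_EFinP; apply: measurableT_comp => //.
  exact: measurable_tail_moment.
- by apply/measurable_EFinP; apply: measurable_funM.
- by move=> w _; rewrite sumEFin lee_fin; exact: sum_tail_moment.
Qed.

Lemma sqr_tail_small eta : 0 < eta ->
  exists2 A, 0 <= A & forall c, A <= c -> sqr_tail c <= eta.
Proof.
move=> eta0; pose F n w := (if n%:R < xi w then xi w ^+ 2 else 0)%:E : \bar R.
have [_ _ lim0] : [/\ Q.-integrable setT (cst 0%E),
    [sequence \int[Q]_w `|F n w - cst 0 w|]_n%E @ \oo --> 0%E &
    [sequence \int[Q]_w (F n w)]_n%E @ \oo --> (\int[Q]_w (cst 0 w))%E].
  apply: (@dominated_convergence _ _ _ _ _ _ F _ (EFin \o (fun w => xi w ^+ 2))) => //.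
  - by move=> n; apply/measurable_EFinP.
  - apply: aeW => w _; apply: cvg_near_cst.
    exists (Num.trunc (xi w)).+1 => // n /= hn; rewrite /F ltNge.
    rewrite (le_trans (ltW (truncnS_gt (xi w))))//.
    by rewrite ler_nat.
  - apply: aeW => w n _ /=; rewrite /F lee_fin; case: ifPn => _.
      by rewrite ger0_norm// sqr_ge0.
    by rewrite normr0 sqr_ge0.
move: lim0; rewrite integral0 => /fine_cvgP[_] /cvgrPdist_le/(_ _ eta0)[n _ hn].
exists n%:R => // c nc; have := hn n (leqnn n).
rewrite sub0r normrN => /(le_trans (ler_norm _)); apply: le_trans.
apply: le_Rintegral => // w _.
case: ifPn => cx; first by rewrite (le_lt_trans nc cx).
by case: ifPn => // _; exact: sqr_ge0.
Qed.

End dominating_variable.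

End stochastic_domination.

(** * Landau hypotheses as inequalities beyond a threshold *)

Lemma near_within_pinfty (R : realType) (S : set R) (p : R -> Prop) :
  (\forall x \near within S (pinfty_nbhs R), p x) ->
  exists x0 : R, forall y, x0 <= y -> S y -> p y.
Proof.
rewrite near_withinE => -[x0 [_ h]]; exists (x0 + 1) => y xy Sy.
by apply: h => //=; lra.
Qed.

Lemma near_pinfty (R : realType) (p : R -> Prop) :
  (\forall x \near (+oo : set_system R), p x) -> exists x0 : R, forall y, x0 <= y -> p y.
Proof. by move=> -[x0 [_ h]]; exists (x0 + 1) => y xy; apply: h; lra. Qed.

Lemma littleo_within_bound (R : realType) (S : set R) (f g : R -> R) (eta : R) :
  f =o_ (within S (pinfty_nbhs R)) g -> 0 < eta ->
  exists x0 : R, forall y, x0 <= y -> S y -> `|f y| <= eta * `|g y|.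
Proof. by move=> /eqoP h eta0; apply: near_within_pinfty; exact: h. Qed.

Lemma littleo_pinfty_bound (R : realType) (f g : R -> R) (eta : R) :
  f =o_ (pinfty_nbhs R) g -> 0 < eta ->
  exists x0 : R, forall y, x0 <= y -> `|f y| <= eta * `|g y|.
Proof. by move=> /eqoP h eta0; apply: near_pinfty; exact: h. Qed.

(** * Splitting a step into its truncated part and the big jumps *)

Section jump_split.
Context {R : realType}.
Variable K : R.-pker R ~> R.
Implicit Types (y c M : R) (f : R -> R).

Definition window c : set R := [set v | `|v| <= c].

Lemma measurable_window c : measurable (window c).
Proof.
rewrite (_ : window c = `[- c, c]%classic); first exact: measurable_itv.
by apply/seteqP; split => v /=; rewrite /window/= in_itv/= ler_norml.
Qed.

Lemma window_integrable c y f M : measurable_fun [set: R] f ->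
  (forall v, window c v -> `|f v| <= M) ->
  (jump_law K y).-integrable (window c) (EFin \o f).
Proof.
move=> mf fM; apply: (@bounded_integrable _ _ _ _ _ _ M) => //.
exact: measurable_window.
Qed.

Lemma measurable_shift y f : measurable_fun [set: R] f ->
  measurable_fun [set: R] (fun v => f (y + v)).
Proof. by move=> mf; apply: (measurableT_comp mf); exact: measurable_funD. Qed.

Lemma shift_integrable y A f M : bounded_test f M -> measurable A ->
  (jump_law K y).-integrable A (EFin \o (fun v => f (y + v))).
Proof.
move=> [mf fM] mA; apply: (@bounded_integrable _ _ _ _ _ _ M) => //.
  exact: measurable_shift.
by move=> v _; have /andP[h1 h2] := fM (y + v); rewrite ger0_norm.
Qed.

Lemma mean_step_split y c f M : bounded_test f M ->
  mean_step K f y = \int[jump_law K y]_(v in window c) f (y + v) +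
    \int[jump_law K y]_(v in ~` window c) f (y + v).
Proof.
move=> bf; have [mf fM] := bf; have mw := measurable_window c.
rewrite -Rintegral_setU//.
- rewrite setUv /mean_step /Rintegral.
  congr fine; have md := measurable_displacement y.
  have ms : measurable_fun [set: R] (fun v => (f (y + v))%:E).
    by apply/measurable_EFinP; exact: measurable_shift.
  have s0 : {in [set: R], forall v, (0 <= (f (y + v))%:E)%E}.
    by move=> v _; rewrite lee_fin; have /andP[] := fM (y + v).
  rewrite [RHS](ge0_integral_pushforward md (K y) measurableT ms s0) preimage_setT.
  by apply: eq_integral => z _ /=; rewrite /displacement addrC subrK.
- exact: measurableC.
- by rewrite setUv; exact: shift_integrable bf _.
- by rewrite disj_set2E setICr.
Qed.

Lemma jump_tailE y c : jump_tail K c y = fine (jump_law K y (~` window c)).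
Proof.
rewrite /jump_tail; congr (fine (jump_law K y _)).
apply/seteqP; split => v /=; rewrite /window/=.
  by move=> h; apply/negP; rewrite -ltNge.
by move/negP; rewrite -ltNge.
Qed.

Lemma jump_tail_ge0 y c : 0 <= jump_tail K c y.
Proof. by rewrite fine_ge0. Qed.

Lemma window_tail y c (a : R) :
  \int[jump_law K y]_(v in window c) a + a * jump_tail K c y = a.
Proof.
have mw := measurable_window c.
have mw' := measurableC mw.
rewrite Rintegral_cst// jump_tailE -mulrDr -fineD ?fin_num_measure//.
by rewrite probability_setC// addeC subeK ?fin_num_measure// mulr1.
Qed.

(** Outside the window only 0 <= f <= M is used: putting 0 there gives this bound, putting M there
    gives [mean_step_upper]. *)
Lemma mean_step_lower y c f M : bounded_test f M ->
  f y <= mean_step K f y +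
    \int[jump_law K y]_(v in window c) (f y - f (y + v)) + f y * jump_tail K c y.
Proof.
move=> bf; have [mf fM] := bf; have mw := measurable_window c.
have ic : (jump_law K y).-integrable (window c) (EFin \o (fun=> f y)).
  by apply: (@window_integrable _ _ _ `|f y|).
rewrite RintegralB//; last exact: shift_integrable bf _.
rewrite (mean_step_split y c bf).
have h : 0 <= \int[jump_law K y]_(v in ~` window c) f (y + v).
  by apply: Rintegral_ge0 => v _; have /andP[] := fM (y + v).
move: h (window_tail y c (f y)).
move: (\int[jump_law K y]_(v in window c) f (y + v)) (\int[jump_law K y]_(v in window c) f y).
by move: (\int[jump_law K y]_(v in ~` window c) f (y + v)) => x1 x2 x3; lra.
Qed.

Lemma mean_step_upper y c f M : bounded_test f M ->
  mean_step K f y + \int[jump_law K y]_(v in window c) (f y - f (y + v)) <=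
    f y + M * jump_tail K c y.
Proof.
move=> bf; have [mf fM] := bf; have mw := measurable_window c.
have mw' := measurableC mw.
have ic : (jump_law K y).-integrable (window c) (EFin \o (fun=> f y)).
  by apply: (@window_integrable _ _ _ `|f y|).
rewrite RintegralB//; last exact: shift_integrable bf _.
rewrite (mean_step_split y c bf).
have h : \int[jump_law K y]_(v in ~` window c) f (y + v) <= M * jump_tail K c y.
  rewrite jump_tailE -Rintegral_cst//; apply: le_Rintegral => //.
  - exact: shift_integrable bf _.
  - by apply: (@bounded_integrable _ _ _ _ _ _ `|M|).
  - by move=> v _; have /andP[] := fM (y + v).
have h2 : 0 <= f y * jump_tail K c y.
  by rewrite mulr_ge0 ?jump_tail_ge0//; have /andP[] := fM y.
move: h h2 (window_tail y c (f y)).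
move: (\int[jump_law K y]_(v in window c) f (y + v)) (\int[jump_law K y]_(v in window c) f y).
by move: (\int[jump_law K y]_(v in ~` window c) f (y + v)) => x1 x2 x3; lra.
Qed.

Lemma power_window_integrable c y k :
  (jump_law K y).-integrable (window c) (EFin \o (fun v => v ^+ k)).
Proof.
apply: (@window_integrable _ _ _ (c ^+ k)) => [|v]; first exact: measurable_funX.
by rewrite /window/= normrX => h; rewrite lerXn2r ?nnegrE// (le_trans _ h).
Qed.

Lemma abs_power_window_integrable c y k :
  (jump_law K y).-integrable (window c) (EFin \o (fun v => `|v| ^+ k)).
Proof.
apply: (@window_integrable _ _ _ (c ^+ k)) => [|v].
  by apply: measurable_funX.
by rewrite /window/= normrX normr_id => h; rewrite lerXn2r ?nnegrE// (le_trans _ h).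
Qed.

Lemma increment_estimate y c f a0 a1 a2 C M : measurable_fun [set: R] f ->
  (forall v, window c v -> `|f (y + v)| <= M) ->
  (forall v, window c v ->
    `|f (y + v) - a0 + a1 * v - a2 * v ^+ 2| <= C * `|v| ^+ 3) ->
  `|\int[jump_law K y]_(v in window c) (f (y + v) - a0)
    + a1 * trunc_moment K 1 c y - a2 * trunc_moment K 2 c y|
    <= C * trunc_abs_moment K 3 c y.
Proof.
move=> mf fM h; have mw := measurable_window c.
have i0 : (jump_law K y).-integrable (window c) (EFin \o (fun v => f (y + v) - a0)).
  apply: (@window_integrable _ _ _ (M + `|a0|)).
    by apply: measurable_funB => //; exact: measurable_shift.
  by move=> v wv; rewrite (le_trans (ler_normB _ _))// lerD2r fM.
have i1 : (jump_law K y).-integrable (window c) (EFin \o (fun v => a1 * v)).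
  have := integrableZl mw a1 (power_window_integrable c y 1).
  by apply: eq_integrable => // v _ /=; rewrite expr1.
have i2 : (jump_law K y).-integrable (window c) (EFin \o (fun v => a2 * v ^+ 2)).
  exact: (integrableZl mw a2 (power_window_integrable c y 2)).
have i01 : (jump_law K y).-integrable (window c)
    (EFin \o (fun v => f (y + v) - a0 + a1 * v)).
  exact: (integrableD mw i0 i1).
have i3 := abs_power_window_integrable c y 3.
rewrite [X in `|X|](_ : _ = \int[jump_law K y]_(v in window c)
    (f (y + v) - a0 + a1 * v - a2 * v ^+ 2)); last first.
  rewrite (RintegralB mw i01 i2) (RintegralD mw i0 i1).
  rewrite /trunc_moment -!RintegralZl//; last 2 first.
  - exact: power_window_integrable.
  - exact: power_window_integrable.
have i012 : (jump_law K y).-integrable (window c)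
    (EFin \o (fun v => f (y + v) - a0 + a1 * v - a2 * v ^+ 2)).
  exact: (integrableB mw i01 i2).
apply: (le_trans (le_normr_Rintegral mw i012)).
rewrite /trunc_abs_moment -RintegralZl//; apply: le_Rintegral => //.
- exact: (integrable_norm i012).
- exact: (integrableZl mw C i3).
Qed.

End jump_split.

Section measurable_scale.
Context {R : realType}.

Lemma measurable_iterlog j : measurable_fun [set: R] (iterlog j).
Proof.
elim: j => [|j IH]; first exact: measurable_id.
exact: (measurableT_comp (@measurable_ln R) IH).
Qed.

Lemma measurable_logprod j : measurable_fun [set: R] (logprod j).
Proof.
apply: measurable_funM => //; apply: measurable_prod => i _.
exact: measurable_iterlog.
Qed.

Lemma measurable_scale m g : measurable_fun [set: R] (scale m g).
Proof.
apply: (measurableT_comp (@measurable_expR R)); apply: measurableT_comp => //.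
by apply: measurable_funM => //; exact: measurable_iterlog.
Qed.

End measurable_scale.

(** Read P as U_g / L ^ 2, so that g P L is the slope, and l as ln y to the power 1 + eps. The bound
    on m3 leaves L / (y l), which the bound on L cancels. *)
Lemma third_moment_error_le (R : realType) (C C3 g P L y l m3 delta : R) :
  0 <= C -> 0 < C3 -> 0 < g -> 0 < P -> 0 < L -> 0 < y -> 0 < l -> 0 < delta ->
  L <= C3 * (y * l) -> m3 <= delta / (2 * (C + 1) * g * C3) * (y / l) ->
  C * (g * P * L / y ^+ 2) * m3 <= delta / 2 * P.
Proof.
move=> C0 C30 g0 P0 L0 y0 l0 d0 hL m3le.
have c0 : 0 <= C * (g * P * L / y ^+ 2).
  by rewrite mulr_ge0// divr_ge0 ?sqr_ge0// !mulr_ge0// ltW.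
have C1 : 0 < C + 1 by lra.
apply: (le_trans (ler_wpM2l c0 m3le)).
have q0 : 0 <= C / (2 * (C + 1) * C3) * delta * P * (y * l)^-1.
  by rewrite !mulr_ge0 ?invr_ge0 ?mulr_ge0// ltW.
rewrite [leLHS](_ : _ = C / (2 * (C + 1) * C3) * delta * P * (y * l)^-1 * L);
  last by field; rewrite !gt_eqF.
apply: (le_trans (ler_wpM2l q0 hL)).
rewrite [leLHS](_ : _ = delta / 2 * P * (C / (C + 1))); last by field; rewrite !gt_eqF.
rewrite -[leRHS]mulr1 ler_wpM2l//.
  by rewrite mulr_ge0// ltW// divr_gt0.
by rewrite ler_pdivrMr// mul1r lerDl.
Qed.

Lemma drift_error_le (R : realType) (g P d1 delta b gamma m2 r : R) :
  0 < g -> 0 < P -> 0 < m2 -> 0 < b -> b - d1 <= m2 <= b + d1 -> `|r| <= d1 -> d1 <= 1 ->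
  d1 * (g * (`|g - gamma| + (b + 1))) <= delta ->
  `|g / 2 * P * ((m2 - b) * (g - gamma) - m2 * r)| <= delta / 2 * P.
Proof.
move=> g0 P0 m20 b0 /andP[v2 v3] r1 d11 d1D.
have gP : 0 <= g / 2 * P by rewrite mulr_ge0// ltW// divr_gt0.
rewrite normrM (ger0_norm gP).
have q1 : `|(m2 - b) * (g - gamma) - m2 * r| <= d1 * (`|g - gamma| + (b + 1)).
  rewrite (le_trans (ler_normB _ _))// !normrM (ger0_norm (ltW m20)) mulrDr.
  apply: lerD; first by rewrite ler_wpM2r// ler_norml; lra.
  by rewrite [leRHS]mulrC; apply: ler_pM => //; [exact: ltW|lra].
have q2 : g * `|(m2 - b) * (g - gamma) - m2 * r| <= delta.
  apply: le_trans d1D; rewrite mulrCA.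
  by rewrite ler_wpM2l// ltW.
rewrite [leLHS](_ : _ = P / 2 * (g * `|(m2 - b) * (g - gamma) - m2 * r|)).
  rewrite [leRHS](_ : _ = P / 2 * delta); last by field.
  by rewrite ler_wpM2l// ltW// divr_gt0.
by field.
Qed.

(** * Asymptotic form of the assumptions on the jumps *)

Section near_infinity.
Context {R : realType}.
Variables (S : set R) (K : R.-pker R ~> R) (s : R -> R) (m : nat).
Variables gamma b eps : R.
Hypotheses (m_ge1 : (1 <= m)%N) (b_gt0 : 0 < b) (eps_gt0 : 0 < eps).
Hypothesis s_gt0 : forall x : R, 0 <= x -> 0 < s x.
Hypothesis s_small : s =o_ (pinfty_nbhs R) (fun x => x).
Hypothesis drift : exists r : R -> R,
  r x @[x --> within S (pinfty_nbhs R)] --> 0 /\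
  \forall x \near within S (pinfty_nbhs R),
    2 * trunc_moment K 1 (s x) x / trunc_moment K 2 (s x) x =
    \sum_(0 <= j < m) (logprod j x)^-1 + (gamma + 1 + r x) / logprod m x.
Hypothesis variance :
  trunc_moment K 2 (s x) x @[x --> within S (pinfty_nbhs R)] --> b.
Hypothesis big_jumps : (fun x => jump_tail K (s x) x)
  =o_ (within S (pinfty_nbhs R)) (fun x => (x ^+ 2 * ln x `^ (2 + eps))^-1).
Hypothesis third_moment : (fun x => trunc_abs_moment K 3 (s x) x)
  =o_ (within S (pinfty_nbhs R)) (fun x => x / ln x `^ (1 + eps)).
Implicit Types (y g delta : R).

Definition rate g y : R := scale m g y / logprod m y ^+ 2.

Lemma logs_ge1_ex : exists x0 : R, 1 <= x0 /\ logs_ge1 m x0.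
Proof.
have [x0 h] := near_pinfty (@logs_ge1_near R m); exists x0.
by have h0 := h x0 (lexx _); split => //; exact: logs_ge1_ge1 h0.
Qed.

Lemma rate_gt0 g y : logs_ge1 m y -> 0 < rate g y.
Proof. by move=> hy; rewrite divr_gt0 ?scale_gt0 ?exprn_gt0 ?(logprod_gt0 hy). Qed.

Lemma cutoff_near delta : 0 < delta ->
  exists x0, forall y, x0 <= y -> s y <= delta * y.
Proof.
move=> d0; have [x0 h] := littleo_pinfty_bound s_small d0.
exists (Num.max x0 0) => y; rewrite ge_max => /andP[xy y0].
have := h y xy; rewrite (ger0_norm y0); apply: le_trans; exact: ler_norm.
Qed.

Lemma variance_near delta : 0 < delta -> exists x0, forall y, x0 <= y -> S y ->
  b - delta <= trunc_moment K 2 (s y) y <= b + delta.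
Proof.
move=> d0; have /cvgrPdist_le/(_ _ d0) := variance.
move=> /near_within_pinfty[x0 h]; exists x0 => y xy Sy.
by have := h y xy Sy; rewrite ler_norml; lra.
Qed.

(** The margin eps - g pays for the iterated logarithms beyond the first in L_m ^ 2. *)
Lemma jump_tail_near g delta : 0 < g < eps -> 0 < delta ->
  exists x0, forall y, x0 <= y -> S y -> jump_tail K (s y) y <= delta * rate g y.
Proof.
move=> ge d0; have [C C0 hC] := @sqr_logprod_le R _ _ _ m_ge1 ge.
have dC : 0 < delta / C by rewrite divr_gt0.
have [x0 h] := littleo_within_bound big_jumps dC.
have [x1 [x11 hx1]] := logs_ge1_ex.
exists (Num.max x0 x1) => y; rewrite ge_max => /andP[xy xy1] Sy.
have hy := logs_ge1_le hx1 xy1; have y1 := logs_ge1_ge1 hy.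
have L0 := logprod_gt0 hy (leqnn m); have y0 : 0 < y by lra.
have l0 : 0 < ln y `^ (2 + eps).
  by apply: powR_gt0; have := hy 1%N m_ge1; rewrite /iterlog/=; lra.
have D0 : 0 < y ^+ 2 * ln y `^ (2 + eps) by rewrite mulr_gt0// exprn_gt0//; lra.
have := h y xy Sy; rewrite ger0_norm ?jump_tail_ge0// => /le_trans; apply.
rewrite ger0_norm ?invr_ge0 ?(ltW D0)// -mulrA ler_pM2l//.
rewrite /rate ler_pdivlMr ?exprn_gt0// -invfM mulrC ler_pdivrMr ?mulr_gt0//.
by rewrite mulrC; exact: hC.
Qed.

Lemma increment_near g delta : 0 < g -> 0 < delta ->
  exists x0, forall y, x0 <= y -> S y ->
  `|\int[jump_law K y]_(v in window (s y)) (scale m g (y + v) - scale m g y)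
    - b * g * (g - gamma) / 2 * rate g y| <= delta * rate g y.
Proof.
move=> g0 d0; have [C C0 hC] := @taylor_scale R m g g0.
have [C3 C30 hC3] := @logprod_le R _ _ m_ge1 eps_gt0.
(* The tolerance d1 serves for both the variance and the remainder of the drift; as d1 <= 1, the
   variance is at most b + 1. *)
pose D := g * (`|g - gamma| + (b + 1)).
have D0 : 0 < D by rewrite mulr_gt0// ltr_wpDl// addr_gt0.
pose d1 := Num.min 1 (delta / D).
have d10 : 0 < d1 by rewrite lt_min ltr01 divr_gt0.
have d1D : d1 * D <= delta by rewrite -ler_pdivlMr// ge_min lexx orbT.
have d11 : d1 <= 1 by rewrite ge_min lexx.
pose E := 2 * (C + 1) * g * C3.
have E0 : 0 < E by rewrite !mulr_gt0//; lra.
pose d2 := delta / E; have d20 : 0 < d2 by rewrite divr_gt0.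
have [r [r0 /near_within_pinfty[x1 hr]]] := drift.
have /cvgrPdist_le/(_ _ d10)/near_within_pinfty[x2 hr2] := r0.
have [x3 hvar] := variance_near d10.
have bb : 0 < b / 2 by rewrite divr_gt0.
have [x4 hvar2] := variance_near bb.
have [x5 h3] := littleo_within_bound third_moment d20.
have [x6 hcut] := @cutoff_near (1 / 2) ltac:(lra).
have [x7 [x71 hx7]] := logs_ge1_ex.
(* Twice x7, so that y + v stays beyond x7 when |v| <= y / 2. *)
exists (\big[Num.max/0]_(x <- [:: x1; x2; x3; x4; x5; x6; 2 * x7]) x) => y.
rewrite !big_cons big_nil !ge_max.
move=> /and5P[y1 y2 y3 y4 /and4P[y5 y6 y7 _]] Sy.
have hy : logs_ge1 m y by apply: (logs_ge1_le hx7); lra.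
have yge1 := logs_ge1_ge1 hy.
have sy : s y <= y / 2 by have := hcut y y6; lra.
have L0 := logprod_gt0 hy (leqnn m).
have U0 := scale_gt0 m g y.
have win v : window (s y) v -> logs_ge1 m (y + v) /\ `|v| <= y / 2.
  rewrite /window/= => vs; have vy := le_trans vs sy; split => //.
  by apply: (logs_ge1_le hx7); move: vy; rewrite ler_norml; lra.
have := @increment_estimate R K y (s y) (scale m g) (scale m g y) (slope m g y)
  (curvature m g y / 2) (C * (slope m g y / y ^+ 2)) 1 (measurable_scale m g).
move: (\int[jump_law K y]_(v in window (s y)) (scale m g (y + v) - scale m g y)).
move=> I hI.
have {}hI : `|I + slope m g y * trunc_moment K 1 (s y) y -
    curvature m g y / 2 * trunc_moment K 2 (s y) y| <=
    C * (slope m g y / y ^+ 2) * trunc_abs_moment K 3 (s y) y.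
  apply: hI => v /win[hv vy].
    by rewrite ger0_norm ?(ltW (scale_gt0 _ _ _))// scale_le1.
  by rewrite (mulrAC (curvature m g y)); exact: hC.
have := h3 y y5 Sy; have := hr y y1 Sy; have := hr2 y y2 Sy.
have := hvar y y3 Sy; have := hvar2 y y4 Sy.
move: hI; set m1 := trunc_moment K 1 (s y) y; set m2 := trunc_moment K 2 (s y) y.
set m3 := trunc_abs_moment K 3 (s y) y.
rewrite /curvature; set sg := \sum_(0 <= j < m) _; set L := logprod m y in L0 *.
move=> hI /andP[v1 _] /andP[v2 v3]; rewrite sub0r normrN => r1 dr m3le.
have m20 : 0 < m2 by apply: lt_le_trans v1; rewrite subr_gt0 ltr_pdivrMr// ltr_pMr// ltr1n.
have m1E : m1 = m2 / 2 * (sg + (gamma + 1 + r y) / L).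
  by rewrite -dr; field; rewrite gt_eqF.
set P := rate g y.
have P0 : 0 < P by exact: rate_gt0.
have slopeL : slope m g y / L = g * P.
  by rewrite /slope /P /rate -/L; field; rewrite gt_eqF.
(* The first bracket is the Taylor remainder; the second term gathers the deviations of m2 from b
   and of the drift from its limit form. *)
have decomp : I - b * g * (g - gamma) / 2 * P =
   (I + slope m g y * m1 - slope m g y * (sg + (g + 1) / L) / 2 * m2)
   + g / 2 * P * ((m2 - b) * (g - gamma) - m2 * r y).
  rewrite m1E [in RHS](_ : slope m g y = g * P * L); last first.
    by rewrite -slopeL divfK// gt_eqF.
  by field; rewrite gt_eqF.
rewrite decomp (le_trans (ler_normD _ _))//.
have part1 : `|I + slope m g y * m1 - slope m g y * (sg + (g + 1) / L) / 2 * m2|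
    <= delta / 2 * P.
  apply: (le_trans hI); rewrite [slope m g y](_ : _ = g * P * L); last first.
    by rewrite -slopeL divfK// gt_eqF.
  have y_gt0 := lt_le_trans ltr01 yge1.
  have l0 : 0 < ln y `^ (1 + eps).
    by apply: powR_gt0; exact: lt_le_trans ltr01 (hy 1%N m_ge1).
  have yl0 : 0 < y / ln y `^ (1 + eps) by rewrite divr_gt0.
  rewrite (ger0_norm (ltW yl0)) in m3le.
  exact: (third_moment_error_le C0 C30 g0 P0 L0 y_gt0 l0 d0 (hC3 y hy)
    (le_trans (ler_norm _) m3le)).
have part2 : `|g / 2 * P * ((m2 - b) * (g - gamma) - m2 * r y)| <= delta / 2 * P.
  by apply: (drift_error_le g0 P0 m20 b_gt0 _ r1 d11 d1D); rewrite v2.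
by apply: (le_trans (lerD part1 part2)); rewrite -mulrDl -splitr.
Qed.

End near_infinity.

(** * Scale functions frozen below a level *)

Section capped_scale.
Context {R : realType}.
Variable m : nat.
Implicit Types (x y z g a : R).

(** Below a the function is frozen at its largest value, so no step from there can raise it,
    whatever the law of the jump. *)
Definition cap a g z : R := scale m g (Num.max z a).

Definition from a (f : R -> R) z : R := if a <= z then f z else 0.

Lemma measurable_from a f : measurable_fun [set: R] f ->
  measurable_fun [set: R] (from a f).
Proof. by move=> mf; apply: measurable_fun_ifT => //; exact: measurable_fun_ler. Qed.

Lemma from_ge0 a f : (forall z, a <= z -> 0 <= f z) -> forall z, 0 <= from a f z.
Proof. by move=> f0 z; rewrite /from; case: ifPn => // /f0. Qed.

Lemma measurable_rate g : measurable_fun [set: R] (rate m g).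
Proof.
apply: measurable_funM; first exact: measurable_scale.
rewrite (_ : (fun _ => _) = (@powR R ^~ (-1)) \o (fun y => logprod m y ^+ 2)).
  apply: measurableT_comp; first exact: measurable_powR.
  by apply: measurable_funX; exact: measurable_logprod.
by apply/funext => y /=; rewrite powR_inv1// sqr_ge0.
Qed.

Lemma measurable_cap a g : measurable_fun [set: R] (cap a g).
Proof.
by apply: (measurableT_comp (measurable_scale m g)); exact: measurable_maxr.
Qed.

Lemma le_scale g x y : 0 < g -> logs_ge1 m x -> x <= y -> scale m g y <= scale m g x.
Proof.
move=> g0 hx xy; rewrite /scale ler_expR lerN2 ler_wpM2l ?(ltW g0)//.
exact: le_iterlogS hx xy (leqnn _).
Qed.

Lemma le_scale_exponent g g' x : logs_ge1 m x -> g <= g' -> scale m g' x <= scale m g x.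
Proof.
by move=> hx gg; rewrite /scale ler_expR lerN2 ler_wpM2r// iterlogS_ge0.
Qed.

Lemma cap_ge a g z : a <= z -> cap a g z = scale m g z.
Proof. by move=> az; rewrite /cap (max_idPl az). Qed.

Lemma cap_le a g z : z <= a -> cap a g z = scale m g a.
Proof. by move=> az; rewrite /cap (max_idPr az). Qed.

Lemma cap_gt0 a g z : 0 < cap a g z. Proof. exact: scale_gt0. Qed.

Lemma cap_le_scale a g z : 0 < g -> logs_ge1 m a -> cap a g z <= scale m g a.
Proof. by move=> g0 ha; apply: le_scale => //; rewrite le_max lexx orbT. Qed.

Lemma cap_le_uncapped a g z : 0 < g -> logs_ge1 m z -> cap a g z <= scale m g z.
Proof. by move=> g0 hz; apply: le_scale => //; rewrite le_max lexx. Qed.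

Lemma bounded_cap a g : 0 < g -> logs_ge1 m a -> bounded_test (cap a g) (scale m g a).
Proof.
move=> g0 ha; split; first exact: measurable_cap.
by move=> z; rewrite (ltW (cap_gt0 _ _ _)) cap_le_scale.
Qed.

Lemma cvg_cap0 a g : 0 < g -> cap a g x @[x --> +oo] --> (0 : R).
Proof.
move=> g0; apply: cvg_trans (@cvg_scale0 R m g g0); apply: near_eq_cvg.
by near=> x; rewrite cap_ge//; near: x; exact: nbhs_pinfty_ge.
Unshelve. all: by end_near. Qed.

End capped_scale.

(** * The Lyapunov function and the Green functional of the gap *)

Section lyapunov.
Context {R : realType} d {T : measurableType d} {P : probability T R}.
Context {S : set R} {K : R.-pker R ~> R} {X : nat -> {RV P >-> R}}.
Hypothesis HX : markov_chain S K X.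
Hypothesis Xlimsup : {ae P, forall w, limn_esup (fun n => (X n w)%:E) = +oo%E}.
Variables (s : R -> R) (m : nat) (gamma b eps : R).
Hypotheses (gamma_gt0 : 0 < gamma) (b_gt0 : 0 < b) (eps_gt0 : 0 < eps).
Hypothesis cutoff : forall delta, 0 < delta ->
  exists x0, forall y, x0 <= y -> s y <= delta * y.
Hypothesis tail : forall g delta, 0 < g < eps -> 0 < delta ->
  exists x0, forall y, x0 <= y -> S y -> jump_tail K (s y) y <= delta * rate m g y.
Hypothesis increment : forall g delta, 0 < g -> 0 < delta ->
  exists x0, forall y, x0 <= y -> S y ->
  `|\int[jump_law K y]_(v in window (s y)) (scale m g (y + v) - scale m g y)
    - b * g * (g - gamma) / 2 * rate m g y| <= delta * rate m g y.
Implicit Types (x y z g a : R).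

(** Below gamma, to have strictly negative drift, and below eps, to dominate the big jumps. *)
Let g0 := Num.min gamma eps / 2.

Let g0_gt0 : 0 < g0.
Proof. by rewrite divr_gt0// lt_min gamma_gt0 eps_gt0. Qed.

Let g0_lt_gamma : g0 < gamma.
Proof.
have h1 := gamma_gt0; have h2 : Num.min gamma eps <= gamma by rewrite ge_min lexx.
by rewrite /g0; lra.
Qed.

Let g0_lt_eps : 0 < g0 < eps.
Proof.
have h1 := eps_gt0; have h2 : Num.min gamma eps <= eps by rewrite ge_min lexx orbT.
by rewrite g0_gt0 /g0; lra.
Qed.

Local Notation "'V'" := (scale m g0).

Definition near_window x0 := [/\ 1 <= x0, logs_ge1 m x0 &
  forall y v, 2 * x0 <= y -> window (s y) v -> x0 <= y + v].

Lemma near_window_ex a : exists2 x0, a <= x0 & near_window x0.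
Proof.
have [x1 h1] := near_pinfty (@logs_ge1_near R m).
have [x2 h2] := @cutoff (1 / 2) ltac:(lra).
exists (Num.max a (Num.max x1 (Num.max x2 1))); first by rewrite le_max lexx.
have : Num.max x1 (Num.max x2 1) <= Num.max a (Num.max x1 (Num.max x2 1)).
  by rewrite le_max lexx orbT.
move: (Num.max a _) => x0; rewrite !ge_max => /andP[h10 /andP[h20 h30]].
split => //; first exact: h1.
move=> y v yx; rewrite /window/= ler_norml => /andP[v1 v2].
by have := h2 y; lra.
Qed.

Lemma lyapunov_drift : exists x0, exists2 c, 0 < c & near_window x0 /\
  forall x1, 2 * x0 <= x1 -> forall y, S y ->
    mean_step K (cap m x1 g0) y + c * from x1 (rate m g0) y <= cap m x1 g0 y.
Proof.
have hb := b_gt0; have hg := g0_gt0; have hg' := g0_lt_gamma.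
(* The mean increment is close to -4 c times the rate: c is spent on the Taylor and drift errors, c
   on the big jumps, and 2 c remain. *)
pose c := b * g0 * (gamma - g0) / 8.
have c0 : 0 < c by rewrite divr_gt0// mulr_gt0 ?subr_gt0// mulr_gt0.
have [x1 h1] := tail g0_lt_eps c0.
have [x2 h2] := increment g0_gt0 c0.
have [x0 hx0 nw] := near_window_ex (Num.max x1 x2).
move: hx0; rewrite ge_max => /andP[x10 x20].
have [x01 hx0 win] := nw.
exists x0, (2 * c); [lra|split => // a xa y Sy].
have ha : logs_ge1 m a by apply: (logs_ge1_le hx0); lra.
have bf := bounded_cap g0_gt0 ha; have [mf fM] := bf.
rewrite /from; case: (leP a y) => ay; last first.
  have [_ /(_ y)/andP[_ h]] := mean_step_bounded (K := K) bf.
  by rewrite mulr0 addr0 (cap_le _ _ (ltW ay)).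
have hy : logs_ge1 m y by exact: logs_ge1_le ha ay.
have r0 := rate_gt0 g0 hy.
have t := h1 y ltac:(lra) Sy; have i := h2 y ltac:(lra) Sy.
have := mean_step_upper K y (s y) bf.
have mw := measurable_window (s y).
have hw v : window (s y) v -> logs_ge1 m (y + v).
  by move=> wv; apply: (logs_ge1_le hx0); apply: win wv; lra.
have i1 : (jump_law K y).-integrable (window (s y))
    (EFin \o (fun v => scale m g0 (y + v) - scale m g0 y)).
  apply: (@window_integrable _ _ _ _ _ (1 + scale m g0 y)).
    apply: measurable_funB => //; apply: measurable_shift.
    exact: measurable_scale.
  move=> v /hw hv; rewrite (le_trans (ler_normB _ _))//.
  rewrite !ger0_norm ?(ltW (scale_gt0 _ _ _))// lerD2r.
  exact: scale_le1.
have i2 : (jump_law K y).-integrable (window (s y))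
    (EFin \o (fun v => cap m a g0 y - cap m a g0 (y + v))).
  have i3 : (jump_law K y).-integrable (window (s y)) (EFin \o (fun=> cap m a g0 y)).
    by apply: (@window_integrable _ _ _ _ _ `|cap m a g0 y|).
  have i4 := @shift_integrable _ K y (window (s y)) _ _ bf mw.
  have i5 := integrableB mw i3 i4.
  exact: i5.
pose D := \int[jump_law K y]_(v in window (s y)) (scale m g0 (y + v) - scale m g0 y).
(* Freezing only lowers the function, hence does not spoil the decrease. *)
have cmp : - D <= \int[jump_law K y]_(v in window (s y)) (cap m a g0 y - cap m a g0 (y + v)).
  have -> : - D = \int[jump_law K y]_(v in window (s y))
      (-1 * (scale m g0 (y + v) - scale m g0 y)).
    by rewrite (RintegralZl (-1) mw i1) mulN1r.
  apply: le_Rintegral => //.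
    by have := integrableZl mw (-1) i1; apply: eq_integrable => // v _ /=.
  move=> v /hw hv; rewrite mulN1r opprB (cap_ge _ _ ay) lerD2l lerN2.
  exact: cap_le_uncapped.
rewrite -/D in i.
move: cmp i; rewrite (cap_ge _ _ ay).
move: D => I1.
move: (\int[jump_law K y]_(v in window (s y)) _) => I2 I12.
rewrite ler_norml => /andP[_ i] up.
have V1 : scale m g0 a <= 1 by exact: scale_le1.
have t2 : scale m g0 a * jump_tail K (s y) y <= jump_tail K (s y) y.
  by rewrite -[leRHS]mul1r ler_wpM2r// jump_tail_ge0.
have e : b * g0 * (g0 - gamma) / 2 * rate m g0 y = - (4 * (c * rate m g0 y)).
  by rewrite /c; field.
rewrite e in i; rewrite -mulrA; move: t t2 i up I12.
by move: (c * rate m g0 y) (jump_tail K (s y) y) (scale m g0 a * _) => r1 r2 r3; lra.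
Qed.

Definition lyapunov_point x0 c := near_window x0 /\
  forall x1, 2 * x0 <= x1 -> forall y, S y ->
    mean_step K (cap m x1 g0) y + c * from x1 (rate m g0) y <= cap m x1 g0 y.

Section lyapunov_consequences.
Local Notation G e := (@green _ _ _ P X e%R).
Local Notation EX f n := (@law_mean _ _ _ P X f%R n).
Variables x0 c : R.
Hypotheses (c_gt0 : 0 < c) (lp : lyapunov_point x0 c).

Lemma logs_ge1_lyapunov a : 2 * x0 <= a -> logs_ge1 m a.
Proof. by have [[h1 h2 _] _] := lp => h; apply: (logs_ge1_le h2); lra. Qed.

Let rate_from_ge0 g a : 2 * x0 <= a -> forall z, 0 <= from a (rate m g) z.
Proof.
move=> ha; apply: from_ge0 => z az; apply/ltW/rate_gt0.
exact: logs_ge1_le (logs_ge1_lyapunov ha) az.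
Qed.

Lemma green_rate_le a : 2 * x0 <= a ->
  (G (from a (rate m g0)) <= (V a / c)%:E)%E.
Proof.
move=> xa; have ha := logs_ge1_lyapunov xa; have [_ drift] := lp.
have bf := bounded_cap g0_gt0 ha; have c0 := ltW c_gt0.
have mr : measurable_fun [set: R] (from a (rate m g0)).
  by apply: measurable_from; exact: measurable_rate.
have r0 := rate_from_ge0 g0 xa.
have : (G (fun y => c * from a (rate m g0) y) <=
    (V a)%:E + G (fun=> 0%R))%E.
  apply: (green_drift HX bf) => //.
  - exact: measurable_funM.
  - by move=> y; rewrite mulr_ge0.
  - by move=> y Sy; rewrite addr0; exact: drift.
rewrite greenZ// {2}/green eseries0 ?adde0; last first.
  by move=> n _ _; rewrite /law_mean integral0.
by rewrite EFinM lee_pdivlMr// muleC.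
Qed.

(** At the exponent gamma the drift degenerates, but the ratio of U_gamma to U_g0 is decreasing:
    beyond a it is at most its value at a, and the bound for g0 transfers with that factor. *)
Lemma green_critical_rate_le a : 2 * x0 <= a ->
  (G (from a (rate m gamma)) <= (scale m gamma a / c)%:E)%E.
Proof.
move=> xa; have ha := logs_ge1_lyapunov xa.
have mr g : measurable_fun [set: R] (from a (rate m g)).
  by apply: measurable_from; exact: measurable_rate.
have V0 := scale_gt0 m g0 a; have U0 := scale_gt0 m gamma a.
have q0 : 0 <= scale m gamma a / V a by rewrite divr_ge0// ltW.
apply: (@le_trans _ _ (G
    (fun y => scale m gamma a / V a * from a (rate m g0) y))).
  apply: (le_green HX) => //.
  - exact: measurable_funM.
  - exact: rate_from_ge0.
  move=> y _; rewrite /from; case: ifPn => ay; last by rewrite mulr0.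
  have hy := logs_ge1_le ha ay.
  rewrite /rate mulrA ler_wpM2r ?invr_ge0 ?sqr_ge0//.
  rewrite mulrAC ler_pdivlMr// /scale -!expRD ler_expR.
  have h1 := le_iterlogS ha ay (leqnn m.+1).
  have h2 : 0 <= (gamma - g0) * (iterlog m.+1 y - iterlog m.+1 a).
    by apply: mulr_ge0; rewrite subr_ge0// ltW.
  by move: h2; move: (iterlog _ _) (iterlog _ _) => l1 l2; lra.
rewrite greenZ//; last exact: rate_from_ge0.
have q0' : (0 <= (scale m gamma a / V a)%:E)%E by rewrite lee_fin.
apply: (le_trans (lee_wpmul2l q0' (green_rate_le xa))).
rewrite -EFinM lee_fin le_eqVlt; apply/orP; left; apply/eqP.
by field; rewrite !gt_eqF.
Qed.

Lemma cap_superharmonic a y : 2 * x0 <= a -> S y ->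
  mean_step K (cap m a g0) y <= cap m a g0 y.
Proof.
move=> xa Sy; have [_ /(_ a xa y Sy)] := lp; apply: le_trans.
by rewrite lerDl mulr_ge0 ?(ltW c_gt0)// rate_from_ge0.
Qed.

Lemma law_mean_cap_vanish a eta : 2 * x0 <= a -> 0 < eta ->
  exists N, (EX (cap m a g0) N <= eta%:E)%E.
Proof.
move=> xa; have ha := logs_ge1_lyapunov xa.
apply: (superharmonic_vanish HX Xlimsup (bounded_cap g0_gt0 ha)).
  exact: cvg_cap0.
by move=> y; exact: cap_superharmonic.
Qed.

(** The price of having no control below x1: the only steps from there that lower the test function
    are those landing above a. *)
Definition crossing x1 a y : R := if y < x1 then fine (K y `]a, +oo[%classic) else 0.

Lemma crossing_ge0 x1 a y : 0 <= crossing x1 a y.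
Proof. by rewrite /crossing; case: ifPn => // _; rewrite fine_ge0. Qed.

Lemma measurable_crossing x1 a : measurable_fun [set: R] (crossing x1 a).
Proof.
apply: measurable_fun_ifT => //; first exact: measurable_fun_ltr.
apply: measurableT_comp => //; exact: (measurable_kernel K).
Qed.

Lemma green_crossing_fin x1 : 2 * x0 <= x1 ->
  exists a, (G (crossing x1 a) < +oo)%E.
Proof.
move=> xx1; have h1 := logs_ge1_lyapunov xx1.
have V0 := scale_gt0 m g0 x1; have v2 : 0 < V x1 / 2 by rewrite divr_gt0.
have /cvgrPdist_le/(_ _ v2)/near_pinfty[a1 ha1] := @cvg_scale0 R m g0 g0_gt0.
pose a := Num.max a1 x1; exists a.
have ax1 : x1 <= a by rewrite le_max lexx orbT.
have bf := bounded_cap g0_gt0 h1; have [mf fM] := bf.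
have Va y : a < y -> cap m x1 g0 y <= V x1 / 2.
  move=> ay; rewrite cap_ge; last by lra.
  have := ha1 y; rewrite sub0r normrN ger0_norm ?(ltW (scale_gt0 _ _ _))//; apply.
  by apply: le_trans (ltW ay); rewrite le_max lexx.
have mB : measurable (`]a, +oo[%classic : set R) by exact: measurable_itv.
have bi : bounded_test (fun z => V x1 / 2 * \1_(`]a, +oo[%classic) z) (V x1 / 2).
  split; first by apply: measurable_funM => //; exact: measurable_indic.
  move=> z; rewrite indicE; case: (z \in _) => /=.
    by rewrite mulr1 lexx ltW.
  by rewrite mulr0 lexx ltW.
have bs : bounded_test
    (fun z => cap m x1 g0 z + V x1 / 2 * \1_(`]a, +oo[%classic) z) (V x1).
  have [mi iM] := bi; split; first exact: measurable_funD.
  move=> z; have /andP[f0 f1] := fM z; have /andP[i0 _] := iM z.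
  rewrite addr_ge0//= indicE; case: (boolP (z \in _)) => [/set_mem/= |_].
    by rewrite in_itv/= andbT mulr1 => /Va; lra.
  by rewrite mulr0 addr0.
have mc := measurable_crossing x1 a.
have : (G (fun y => (V x1 / 2) * crossing x1 a y) <= (V x1)%:E + G (fun=> 0%R))%E.
  apply: (green_drift HX bf) => //.
  - exact: measurable_funM.
  - by move=> y; rewrite mulr_ge0 ?crossing_ge0// ltW.
  move=> y Sy; rewrite addr0 /crossing; case: ifPn => yx; last first.
    by rewrite mulr0 addr0; exact: cap_superharmonic.
  rewrite (cap_le _ _ (ltW yx)) -mean_step_indic// -(mean_stepD (M := V x1) (N := V x1 / 2))//.
  by have [_ /(_ y)/andP[]] := mean_step_bounded (K := K) bs.
rewrite greenZ ?(ltW v2)//; last exact: crossing_ge0.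
rewrite {2}/green eseries0 ?adde0; last first.
  by move=> n _ _; rewrite /law_mean integral0.
have := green_ge0 (P := P) (X := X) (crossing_ge0 x1 a).
case: (G (crossing x1 a)) => [r _ _|_|//]; first exact: ltry.
by rewrite gt0_muley ?lte_fin.
Qed.

Let below x1 n : set T := X n @^-1` `]-oo, x1[.

Let measurable_below x1 n : measurable (below x1 n).
Proof.
rewrite /below -[_ @^-1` _]setTI.
by apply: (@measurable_funPT _ _ _ _ (X n)) => //; exact: measurable_itv.
Qed.

Let kernel_state n (w : T) : {measure set R -> \bar R} := K (X n w).

Let measurable_kernel_state n U : measurable U ->
  measurable_fun [set: T] ((kernel_state n) ^~ U).
Proof. by move=> mU; exact: (measurableT_comp (measurable_kernel K U mU)). Qed.

(** The expected number of steps from below x1 into a given set. As a measure in the landing set it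
    is continuous from above on the half-lines ]a, +oo[, once [green_crossing_fin] makes one of them
    finite. *)
Let nu x1 := mseries (fun n => mixture_measure P (measurable_below x1 n)
  (@measurable_kernel_state n)) 0.

Lemma green_crossing_small x1 eta : 2 * x0 <= x1 -> 0 < eta ->
  exists a0, forall a, a0 <= a -> (G (crossing x1 a) <= eta%:E)%E.
Proof.
move=> xx1 eta0.
have nuE a : nu x1 `]a, +oo[%classic = G (crossing x1 a).
  apply: eq_eseriesr => n _; rewrite [LHS]mixtureE /law_mean integral_mkcond.
  apply: eq_integral => w _; rewrite patchE /crossing; case: ifPn.
    rewrite inE /below/= in_itv/= => ->; rewrite fineK//.
    exact: (finite_kernel_measure K (X n w)).
  by rewrite notin_setE /below/= in_itv/= => /negP/negbTE ->.
have [a1 fin1] := green_crossing_fin xx1.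
pose F n : set R := `]a1 + n%:R, +oo[%classic.
have mF n : measurable (F n) by exact: measurable_itv.
have F0 : \bigcap_n F n = set0.
  apply/seteqP; split => // z /(_ (Num.trunc (z - a1)).+1 I).
  rewrite /F/= in_itv/= andbT => h.
  by have := truncnS_gt (z - a1); lra.
have lim0 : nu x1 (F n) @[n --> \oo] --> 0%E.
  rewrite -(measure0 (nu x1)) -F0; apply: nonincreasing_cvg_mu => //.
  - by move: fin1; rewrite -nuE /F addr0.
  - by rewrite F0.
  - apply/nonincreasing_seqP => n; apply/subsetPset => z.
    by rewrite /F/= !in_itv/= !andbT -natr1; lra.
have /fine_cvgP[[n1 _ fn] /cvgrPdist_le/(_ _ eta0)[n2 _ hn]] := lim0.
pose N := maxn n1 n2; exists (a1 + N%:R) => a aN.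
apply: (@le_trans _ _ (G (crossing x1 (a1 + N%:R)))).
  apply: (le_green HX) => //.
  - exact: measurable_crossing.
  - exact: measurable_crossing.
  - exact: crossing_ge0.
  - move=> y _; rewrite /crossing; case: ifPn => // _; rewrite fine_le//.
    + exact: (finite_kernel_measure K y).
    + exact: (finite_kernel_measure K y).
    + apply: le_measure; rewrite ?inE//.
      by move=> z /=; rewrite !in_itv/= !andbT; lra.
rewrite -nuE -(fineK (fn N (leq_maxl _ _))) lee_fin.
have := hn N (leq_maxr _ _); rewrite sub0r normrN; apply: le_trans.
exact: ler_norm.
Qed.

(** The initial law is arbitrary, but its mass above a is small for large a. *)
Lemma law_mean_start eta : 0 < eta -> exists a0, forall a f M, a0 <= a ->
  bounded_test f M -> (forall z, z <= a -> M <= f z) ->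
  (M%:E <= EX f 0 + (M * eta)%:E)%E.
Proof.
move=> eta0; have /fine_cvgP[_] := cvg_ccdfy0 (X 0).
move=> /cvgrPdist_le/(_ _ eta0)/near_pinfty[a0 ha0].
exists a0 => a f M aa bf fa; have [mf fM] := bf.
have M0 : 0 <= M by have /andP[h1] := fM 0; exact: le_trans.
have f0 y : 0 <= f y by have /andP[] := fM y.
have mB : measurable (`]a, +oo[%classic : set R) by exact: measurable_itv.
have mi : measurable_fun [set: R] (fun y => M * \1_(`]a, +oo[%classic) y).
  by apply: measurable_funM => //; exact: measurable_indic.
have i0 y : 0 <= M * \1_(`]a, +oo[%classic) y by rewrite mulr_ge0.
have h1 : (M%:E <= EX (fun y => f y + M * \1_(`]a, +oo[%classic) y) 0)%E.
  apply: (@le_trans _ _ (EX (fun=> M) 0)).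
    rewrite /law_mean integral_cst// -[leLHS]mule1 -(probability_setT P).
    exact: lexx.
  apply: (le_law_mean HX) => //; first exact: measurable_funD.
  move=> y _; rewrite indicE; case: (boolP (y \in _)) => [_|].
    by rewrite mulr1 lerDr.
  rewrite notin_setE/= in_itv/= andbT => /negP; rewrite -leNgt => ya.
  by rewrite mulr0 addr0 fa.
apply: (le_trans h1); rewrite law_meanD//; apply: leeD => //.
have mi1 : measurable_fun [set: R] (\1_(`]a, +oo[%classic) : R -> R).
  exact: measurable_indic.
rewrite law_meanZ//.
rewrite EFinM lee_wpmul2l ?lee_fin//.
have -> : EX (\1_(`]a, +oo[%classic)) 0 = ccdf (X 0) a.
  rewrite /law_mean /ccdf /distribution /pushforward -(setIT (X 0%N @^-1` `]a, +oo[%classic)) -integral_indic//.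
  by rewrite -[_ @^-1` _]setTI; apply: (@measurable_funPT _ _ _ _ (X 0)).
have cfin : ccdf (X 0) a \is a fin_num by exact: fin_num_measure.
rewrite -(fineK cfin) lee_fin; have := ha0 a aa.
by rewrite sub0r normrN; apply: le_trans; exact: ler_norm.
Qed.

Local Notation "'U'" := (scale m gamma).

Definition gap_mean p q y : R :=
  \int[jump_law K y]_(v in window (s y)) band_gap p q (U y) (U (y + v)).

Definition band_test p q y : R := band p q (cap m x0 gamma y).

Let bounded_band_test p q : 0 <= p -> p <= q ->
  bounded_test (band_test p q) ((q ^+ 2 - p ^+ 2) / 2).
Proof.
move=> p0 pq; split.
  by apply: (measurableT_comp (measurable_band p q)); exact: measurable_cap.
move=> y; rewrite band_ge0 ?band_le_max//; exact/ltW/cap_gt0.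
Qed.

Let hx0 : logs_ge1 m x0. Proof. by have [[]] := lp. Qed.

Let x0_ge1 : 1 <= x0. Proof. by have [[]] := lp. Qed.

Let win_x0 y v : 2 * x0 <= y -> window (s y) v -> x0 <= y + v.
Proof. by have [[_ _ +] _] := lp; exact. Qed.

Let band_test_low p q z a : 0 <= p -> p <= q -> x0 <= a -> z <= a -> q <= U a ->
  band_test p q z = (q ^+ 2 - p ^+ 2) / 2.
Proof.
move=> p0 pq xa za qa; apply: band_ge => //; apply: (le_trans qa).
apply: le_scale => //; first by apply: (logs_ge1_le hx0); rewrite le_max lexx orbT.
by rewrite ge_max za xa.
Qed.

(** Integrates phi u - phi w = gap - phi' u (w - u). The last term is small because U_gamma is
    almost harmonic and phi' <= q - p. *)
Lemma band_test_increment p q y : 0 <= p -> p <= q -> 2 * x0 <= y ->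
  \int[jump_law K y]_(v in window (s y)) (band_test p q y - band_test p q (y + v))
  = gap_mean p q y - dband p q (U y) *
    \int[jump_law K y]_(v in window (s y)) (U (y + v) - U y).
Proof.
move=> p0 pq xy; have mw := measurable_window (s y).
have bf := bounded_band_test p0 pq.
have hy : logs_ge1 m y by exact: logs_ge1_lyapunov.
have hw v : window (s y) v -> logs_ge1 m (y + v).
  by move=> wv; apply: (logs_ge1_le hx0); exact: win_x0.
have iU : (jump_law K y).-integrable (window (s y)) (EFin \o (fun v => U (y + v) - U y)).
  apply: (@window_integrable _ _ _ _ _ (1 + U y)).
    by apply: measurable_funB => //; apply: measurable_shift; exact: measurable_scale.
  move=> v /hw hv; rewrite (le_trans (ler_normB _ _))//.
  rewrite !ger0_norm ?(ltW (scale_gt0 _ _ _))// lerD2r.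
  exact: scale_le1.
have iD : (jump_law K y).-integrable (window (s y))
    (EFin \o (fun v => dband p q (U y) * (U (y + v) - U y))).
  exact: (integrableZl mw (dband p q (U y)) iU).
have iB : (jump_law K y).-integrable (window (s y))
    (EFin \o (fun v => band_test p q y - band_test p q (y + v))).
  have i3 : (jump_law K y).-integrable (window (s y)) (EFin \o (fun=> band_test p q y)).
    by apply: (@window_integrable _ _ _ _ _ `|band_test p q y|).
  have i4 := @shift_integrable _ K y (window (s y)) _ _ bf mw.
  exact: (integrableB mw i3 i4).
rewrite -(RintegralZl _ mw iU); apply/eqP; rewrite -subr_eq opprK; apply/eqP.
rewrite -(RintegralD mw iB iD) /gap_mean; apply: eq_Rintegral => v.
rewrite inE => wv; rewrite /band_test !cap_ge; [|exact: win_x0|by have := x0_ge1; lra].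
by rewrite /band_gap; ring.
Qed.

(** The drift of [band_test] is summed along the chain. A measurable minorant e replaces the gap,
    which depends on y also through the window s y and is not known here to be measurable. *)
Lemma green_gap_le_aux delta : 0 < delta -> exists a0, forall a beta (e : R -> R),
  a0 <= a -> a <= beta -> measurable_fun [set: R] e -> (forall y, 0 <= e y) ->
  (forall y, S y -> e y <= from a (gap_mean (U beta) (U a)) y) ->
  (G e <= ((1 + delta) * U a * (U a - U beta))%:E)%E.
Proof.
(* Each of the two errors, nonharmonicity and big jumps, then costs at most delta / 2 times q (q -
   p) after division by c. *)
move=> d0; pose d1 := delta * c / 2.
have d10 : 0 < d1 by rewrite divr_gt0// mulr_gt0.
have [x1 h1] := tail g0_lt_eps d10; have [x2 h2] := increment gamma_gt0 d10.
exists (Num.max (2 * x0) (Num.max x1 x2)) => a beta e.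
rewrite !ge_max => /and3P[xa ax1 ax2] ab me e0 he.
have ha := logs_ge1_lyapunov xa; have hb := logs_ge1_le ha ab.
set p := U beta; set q := U a.
have p0 : 0 <= p by exact/ltW/scale_gt0.
have q0 : 0 <= q by exact/ltW/scale_gt0.
have pq : p <= q by exact: le_scale.
have bf := bounded_band_test p0 pq; set M := (q ^+ 2 - p ^+ 2) / 2 in bf.
have M0 : 0 <= M by rewrite /M; nra.
have Mq : M <= (q - p) * q by rewrite /M; nra.
have mr g : measurable_fun [set: R] (from a (rate m g)).
  by apply: measurable_from; exact: measurable_rate.
have r0 g := rate_from_ge0 g xa.
have qp0 : 0 <= (q - p) * d1 by rewrite mulr_ge0 ?subr_ge0// ltW.
have Md0 : 0 <= M * d1 by rewrite mulr_ge0// ltW.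
pose e2 y := (q - p) * d1 * from a (rate m gamma) y + M * d1 * from a (rate m g0) y.
have me1 : measurable_fun [set: R] (fun y => (q - p) * d1 * from a (rate m gamma) y).
  exact: measurable_funM.
have me2 : measurable_fun [set: R] (fun y => M * d1 * from a (rate m g0) y).
  exact: measurable_funM.
have : (G e <= M%:E + G e2)%E.
  apply: (green_drift HX bf) => //.
  - exact: measurable_funD.
  - by move=> y; rewrite addr_ge0// mulr_ge0.
  move=> y Sy; have := he y Sy; rewrite /e2 /from; case: (leP a y) => ay; last first.
    move=> ey; rewrite !mulr0 !addr0 (@band_test_low _ _ _ a)//; [|by have := x0_ge1; lra|exact: ltW].
    have [_ /(_ y)/andP[_ h]] := mean_step_bounded (K := K) bf.
    by rewrite -/M; lra.
  have hy := logs_ge1_le ha ay.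
  have := mean_step_upper K y (s y) bf.
  rewrite band_test_increment//; last by lra.
  have := h2 y ltac:(lra) Sy; rewrite subrr mulr0 mul0r mul0r subr0.
  have t := h1 y ltac:(lra) Sy.
  have dle := dband_le p0 pq (U y); have dge := dband_ge0 p0 pq (U y).
  move: (\int[jump_law K y]_(v in window (s y)) (U (y + v) - U y)) => I.
  move=> hI up egap.
  have w1 : dband p q (U y) * I <= (q - p) * d1 * rate m gamma y.
    apply: (@le_trans _ _ (dband p q (U y) * `|I|)).
      by rewrite ler_wpM2l// ler_norm.
    by rewrite -mulrA; apply: ler_pM.
  have w2 : M * jump_tail K (s y) y <= M * d1 * rate m g0 y.
    by rewrite -mulrA ler_wpM2l.
  by move: w1 w2 up egap; move: (_ * I) (_ * jump_tail _ _ _) (_ * rate _ _ _)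
    (_ * rate _ _ _) (gap_mean _ _ _) (mean_step _ _ _) => *; lra.
move=> /le_trans; apply; rewrite greenD//; last 2 first.
- by move=> y; rewrite mulr_ge0.
- by move=> y; rewrite mulr_ge0.
rewrite !greenZ//.
have g1 : (((q - p) * d1)%:E * G (from a (rate m gamma)) <= ((q - p) * d1 * (q / c))%:E)%E.
  by rewrite [leRHS]EFinM lee_wpmul2l ?lee_fin//; exact: green_critical_rate_le.
have g2 : ((M * d1)%:E * G (from a (rate m g0)) <= (M * d1 * (1 / c))%:E)%E.
  rewrite [leRHS]EFinM lee_wpmul2l ?lee_fin//; apply: (le_trans (green_rate_le xa)).
  by rewrite lee_fin ler_wpM2r ?invr_ge0 ?(ltW c_gt0)// scale_le1.
apply: (le_trans (leeD (lexx _) (leeD g1 g2))).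
rewrite -!EFinD lee_fin.
have -> : (q - p) * d1 * (q / c) = (q - p) * q * (delta / 2).
  by rewrite /d1; field; rewrite gt_eqF.
have -> : M * d1 * (1 / c) = M * (delta / 2).
  by rewrite /d1; field; rewrite gt_eqF.
have : M * (delta / 2) <= (q - p) * q * (delta / 2) by rewrite ler_wpM2r//; lra.
by lra.
Qed.

(** The level x1 is fixed first, since crossings from below it become rare only for a far above it;
    e majorises the gap beyond x1 only. *)
Lemma green_gap_ge_aux delta : 0 < delta -> exists y0, forall x1, y0 <= x1 ->
  exists a0, forall a beta (e : R -> R),
  a0 <= a -> a <= beta -> measurable_fun [set: R] e -> (forall y, 0 <= e y) ->
  (forall y, S y -> x1 <= y -> gap_mean (U beta) (U a) y <= e y) ->
  (((U a - U beta) * (U beta - delta * U a))%:E <= G e)%E.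
Proof.
(* Four errors of relative size delta / 4: the initial mass above a, the crossings, the
   nonharmonicity and the big jumps. *)
move=> d0; pose d1 := delta * c / 4.
have d10 : 0 < d1 by rewrite divr_gt0// mulr_gt0.
have d4 : 0 < delta / 4 by rewrite divr_gt0.
have [y1 h1] := tail g0_lt_eps d10; have [y2 h2] := increment gamma_gt0 d10.
exists (Num.max (2 * x0) (Num.max y1 y2)) => x1.
rewrite !ge_max => /and3P[xx1 yx1 yx2].
have [a1 hcross] := green_crossing_small xx1 d4.
have [a2 hstart] := law_mean_start d4.
exists (Num.max x1 (Num.max a1 a2)) => a beta e.
rewrite !ge_max => /and3P[xa aa1 aa2] ab me e0 he.
have hx1 := logs_ge1_lyapunov xx1.
have xxa : 2 * x0 <= a by exact: le_trans xa.
have ha := logs_ge1_lyapunov xxa; have hb := logs_ge1_le ha ab.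
set p := U beta; set q := U a.
have p0 : 0 <= p by exact/ltW/scale_gt0.
have q0 : 0 <= q by exact/ltW/scale_gt0.
have pq : p <= q by exact: le_scale.
have bf := bounded_band_test p0 pq; set M := (q ^+ 2 - p ^+ 2) / 2 in bf.
have M0 : 0 <= M by rewrite /M; nra.
have Mq : M <= (q - p) * q by rewrite /M; nra.
have Mp : (q - p) * p <= M by rewrite /M; nra.
have mr x g : measurable_fun [set: R] (from x (rate m g)).
  by apply: measurable_from; exact: measurable_rate.
have qp0 : 0 <= (q - p) * d1 by rewrite mulr_ge0 ?subr_ge0// ltW.
have Md0 : 0 <= M * d1 by rewrite mulr_ge0// ltW.
(* Loss by crossings from below x1, by nonharmonicity of U (absent below a, where the derivative of
   phi vanishes), and by big jumps from beyond x1. *)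
pose t1 y := M * crossing x1 a y.
pose t2 y := (q - p) * d1 * from a (rate m gamma) y.
pose t3 y := M * d1 * from x1 (rate m g0) y.
have mt1 : measurable_fun [set: R] t1.
  by apply: measurable_funM => //; exact: measurable_crossing.
have mt2 : measurable_fun [set: R] t2 by exact: measurable_funM.
have mt3 : measurable_fun [set: R] t3 by exact: measurable_funM.
have t10 y : 0 <= t1 y by rewrite mulr_ge0// crossing_ge0.
have t20 y : 0 <= t2 y by rewrite mulr_ge0// rate_from_ge0.
have t30 y : 0 <= t3 y by rewrite mulr_ge0// rate_from_ge0.
have low z : z <= a -> band_test p q z = M.
  by move=> za; apply: (@band_test_low _ _ _ a) => //; have := x0_ge1; lra.
have [mf fM] := bf.
have start : (M%:E <= EX (band_test p q) 0 + (M * (delta / 4))%:E)%E.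
  by apply: hstart aa2 bf _ => z za; rewrite low.
have f1 y : 0 <= band_test p q y by have /andP[] := fM y.
have mB : measurable (`]a, +oo[%classic : set R) by exact: measurable_itv.
have bi : bounded_test (fun z => M * \1_(`]a, +oo[%classic) z) M.
  split; first by apply: measurable_funM => //; exact: measurable_indic.
  move=> z; rewrite indicE; case: (z \in _) => /=; first by rewrite mulr1 M0 lexx.
  by rewrite mulr0 lexx.
have key y : S y -> band_test p q y <= mean_step K (band_test p q) y +
    (e y + (t1 y + (t2 y + t3 y))).
  move=> Sy; case: (ltP y x1) => yx.
    rewrite (low y); last by lra.
    have h : M <= mean_step K (fun z => band_test p q z + M * \1_(`]a, +oo[%classic) z) y.
      have {1}-> : M = \int[K y]_z M by rewrite Rintegral_cst// prob_kernel mulr1.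
      have [mi iM] := bi.
      apply: le_Rintegral => //.
      - by apply: (@kernel_integrable _ _ (fun=> M) M); split => // z; rewrite M0 lexx.
      - apply: (@kernel_integrable _ _ _ (M + M)); split; first exact: measurable_funD.
        move=> z; have /andP[q1 q2] := fM z; have /andP[q3 q4] := iM z.
        by rewrite addr_ge0// lerD.
      - move=> z _; rewrite indicE; case: (boolP (z \in _)) => [_|].
          by rewrite mulr1 lerDr.
        rewrite notin_setE/= in_itv/= andbT => /negP; rewrite -leNgt => za.
        by rewrite mulr0 addr0 low.
    rewrite (mean_stepD (M := M) (N := M))// mean_step_indic// in h.
    have e1 : t1 y = M * fine (K y `]a, +oo[%classic) by rewrite /t1 /crossing yx.
    rewrite -e1 in h; have := t20 y; have := t30 y; have := e0 y.
    move: h; move: (mean_step _ _ _) (t1 y) (t2 y) (t3 y) (e y) => *; lra.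
  have hy := logs_ge1_le hx1 yx.
  have := mean_step_lower K y (s y) bf.
  rewrite band_test_increment//; last by lra.
  have := h2 y ltac:(lra) Sy; rewrite subrr mulr0 mul0r mul0r subr0.
  have t := h1 y ltac:(lra) Sy; have ey := he y Sy yx.
  have dle := dband_le p0 pq (U y); have dge := dband_ge0 p0 pq (U y).
  move: (\int[jump_law K y]_(v in window (s y)) (U (y + v) - U y)) => I hI lo.
  have w1 : - (dband p q (U y) * I) <= t2 y.
    rewrite /t2 /from; case: (leP a y) => ay.
      apply: (@le_trans _ _ (dband p q (U y) * `|I|)).
        by rewrite -mulrN ler_wpM2l// -normrN ler_norm.
      by rewrite -mulrA; apply: ler_pM.
    rewrite dband_ge//; first by rewrite mul0r oppr0 mulr0.
    exact: le_scale gamma_gt0 hy (ltW ay).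
  have w2 : band_test p q y * jump_tail K (s y) y <= t3 y.
    rewrite /t3 /from yx -mulrA; apply: ler_pM => //; first exact: jump_tail_ge0.
    by have /andP[] := fM y.
  have := t10 y; move: lo w1 w2 ey.
  by move: (_ * I) (_ * jump_tail _ _ _) (gap_mean _ _ _) (mean_step _ _ _)
    (t1 y) (t2 y) (t3 y) (e y) => *; lra.
have vanish eta : 0 < eta -> exists N, (EX (band_test p q) N <= eta%:E)%E.
  move=> eta0; have V1 := scale_gt0 m g0 x1.
  pose k := (q - p + 1) / V x1.
  have k0 : 0 < k by rewrite divr_gt0//; lra.
  have ek : 0 < eta / k by rewrite divr_gt0.
  have [N hN] := law_mean_cap_vanish xx1 ek; exists N.
  have [mc cM] := bounded_cap g0_gt0 hx1.
  apply: (@le_trans _ _ (EX (fun y => k * cap m x1 g0 y) N)).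
    apply: (le_law_mean HX) => //; first exact: measurable_funM.
    move=> y _; have c0' := ltW (cap_gt0 m x0 gamma y).
    have b1 := band_le p0 pq c0'.
    have b2 : cap m x0 gamma y <= cap m x1 g0 y / V x1.
      have hm : logs_ge1 m (Num.max y x0).
        by apply: (logs_ge1_le hx0); rewrite le_max lexx orbT.
      rewrite ler_pdivlMr//; case: (leP y x1) => yx.
        rewrite (cap_le _ _ yx) -[leRHS]mul1r ler_wpM2r ?(ltW V1)//.
        exact: scale_le1.
      rewrite !cap_ge; [|lra|by have := x0_ge1; lra].
      have hy := logs_ge1_le hx1 (ltW yx).
      rewrite -[leRHS]mulr1; apply: ler_pM; rewrite ?(ltW (scale_gt0 _ _ _))//.
        exact: le_scale_exponent (ltW g0_lt_gamma).
      exact: scale_le1.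
    have b3 : 0 <= cap m x1 g0 y / V x1 by rewrite divr_ge0 ?(ltW V1)// ltW ?cap_gt0.
    have -> : k * cap m x1 g0 y = (q - p + 1) * (cap m x1 g0 y / V x1).
      by rewrite /k mulrAC -mulrA.
    rewrite /band_test; apply: (le_trans b1); apply: ler_pM => //; [lra|lra].
  rewrite law_meanZ ?(ltW k0)//; last by move=> y; exact/ltW/cap_gt0.
  have k0' : (0 <= k%:E)%E by rewrite lee_fin ltW.
  apply: (le_trans (lee_wpmul2l k0' hN)).
  by rewrite -EFinM lee_fin mulrC divfK// gt_eqF.
have := green_drift_ge HX bf _ _ key vanish.
have m23 : measurable_fun [set: R] (fun y => t2 y + t3 y) by exact: measurable_funD.
have m123 : measurable_fun [set: R] (fun y => t1 y + (t2 y + t3 y)).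
  exact: measurable_funD.
have p23 y : 0 <= t2 y + t3 y by rewrite addr_ge0.
have p123 y : 0 <= t1 y + (t2 y + t3 y) by rewrite addr_ge0.
move=> hgr; have := hgr (measurable_funD me m123) (fun y => addr_ge0 (e0 y) (p123 y)).
rewrite !greenD// => Hgreen.
have g1 : (G t1 <= (M * (delta / 4))%:E)%E.
  rewrite greenZ//; [|exact: measurable_crossing|exact: crossing_ge0].
  by rewrite [leRHS]EFinM lee_wpmul2l ?lee_fin//; exact: hcross.
have g2 : (G t2 <= ((q - p) * d1 * (q / c))%:E)%E.
  rewrite greenZ//; last exact: rate_from_ge0.
  by rewrite [leRHS]EFinM lee_wpmul2l ?lee_fin//; exact: green_critical_rate_le.
have g3 : (G t3 <= (M * d1 * (1 / c))%:E)%E.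
  rewrite greenZ//; last exact: rate_from_ge0.
  rewrite [leRHS]EFinM lee_wpmul2l ?lee_fin//; apply: (le_trans (green_rate_le xx1)).
  by rewrite lee_fin ler_wpM2r ?invr_ge0 ?(ltW c_gt0)// scale_le1.
have total : (M%:E <= G e + (M * (delta / 4) + ((q - p) * d1 * (q / c) +
    M * d1 * (1 / c)) + M * (delta / 4))%:E)%E.
  apply: (le_trans start); rewrite EFinD addeA; apply: leeD => //.
  apply: (le_trans Hgreen); apply: leeD => //.
  by rewrite !EFinD; apply: leeD => //; exact: leeD.
move: total; rewrite -leeBlDr// -EFinB; apply: le_trans; rewrite lee_fin.
have -> : (q - p) * d1 * (q / c) = (q - p) * q * (delta / 4).
  by rewrite /d1; field; rewrite gt_eqF.
have -> : M * d1 * (1 / c) = M * (delta / 4).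
  by rewrite /d1; field; rewrite gt_eqF.
have : M * (delta / 4) <= (q - p) * q * (delta / 4) by rewrite ler_wpM2r//; lra.
by rewrite -!/p -!/q; lra.
Qed.

End lyapunov_consequences.

Lemma green_gap_le delta : 0 < delta -> exists a0, forall a beta (e : R -> R),
  a0 <= a -> a <= beta -> measurable_fun [set: R] e -> (forall y, 0 <= e y) ->
  (forall y, S y ->
     e y <= from a (gap_mean (scale m gamma beta) (scale m gamma a)) y) ->
  (@green _ _ _ P X e <= ((1 + delta) * scale m gamma a *
    (scale m gamma a - scale m gamma beta))%:E)%E.
Proof.
have [x0 [c c0 lp]] := lyapunov_drift.
exact: green_gap_le_aux c0 lp delta.
Qed.

Lemma green_gap_ge delta : 0 < delta -> exists y0, forall x1, y0 <= x1 ->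
  exists a0, forall a beta (e : R -> R),
  a0 <= a -> a <= beta -> measurable_fun [set: R] e -> (forall y, 0 <= e y) ->
  (forall y, S y -> x1 <= y ->
     gap_mean (scale m gamma beta) (scale m gamma a) y <= e y) ->
  (((scale m gamma a - scale m gamma beta) *
    (scale m gamma beta - delta * scale m gamma a))%:E <= @green _ _ _ P X e)%E.
Proof.
have [x0 [c c0 lp]] := lyapunov_drift.
exact: green_gap_ge_aux c0 lp delta.
Qed.

End lyapunov.

(** * Increments of U_g between two points *)

Section scale_increments.
Context {R : realType}.
Variables (m : nat) (g : R).
Hypothesis g_gt0 : 0 < g.

Lemma decays_near N (f : R -> R) (r x z : R) : decays m N f -> logs_ge1 m x ->
  x <= z <= r * x -> f z <= f x <= r ^+ N * f z.
Proof.
move=> df hx /andP[xz zr]; have x1 := logs_ge1_ge1 hx.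
have c1 : 1 <= z / x by rewrite ler_pdivlMr; lra.
have [h1 h2 h3] := df x (z / x) hx c1; rewrite divfK in h1 h2 h3; [|by rewrite gt_eqF; lra..].
rewrite h2; apply: (le_trans h3); rewrite ler_wpM2r// lerXn2r ?nnegrE//; [lra| |].
  by nra.
by rewrite ler_pdivrMr; lra.
Qed.

Lemma slope_le x z : logs_ge1 m x -> x <= z -> slope m g z <= slope m g x.
Proof.
move=> hx xz; have [N [_ ds _]] := @scale_functions_decay R m g g_gt0.
have x1 := logs_ge1_ge1 hx; have x0 : x != 0 by rewrite gt_eqF//; lra.
have c1 : 1 <= z / x by rewrite ler_pdivlMr; lra.
by have [_ + _] := ds x (z / x) hx c1; rewrite divfK.
Qed.

Lemma scale_increment x z : logs_ge1 m x -> x <= z ->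
  slope m g z * (z - x) <= scale m g x - scale m g z <= slope m g x * (z - x).
Proof.
move=> hx xz.
have [c cxz ->] : exists2 c, c \in `[x, z]%R & scale m g x - scale m g z = slope m g c * (z - x).
  have [c cxz E] : exists2 c, c \in `[x, z]%R & scale m g z - scale m g x = - slope m g c * (z - x).
    apply: (@MVT_segment _ (scale m g) (fun c => - slope m g c)) => //.
      move=> t /[!in_itv]/= /andP[xt _]; apply: is_derive_scale.
      exact: logs_ge1_le hx (ltW xt).
    apply: continuous_in_subspaceT => t; rewrite inE/= in_itv/= => /andP[xt _].
    apply: differentiable_continuous; apply/derivable1_diffP.
    exact: (@ex_derive _ _ _ _ _ _ _ (is_derive_scale g (logs_ge1_le hx xt))).
  by exists c => //; move: E; lra.
move: cxz; rewrite in_itv/= => /andP[xc cz].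
have zx : 0 <= z - x by rewrite subr_ge0.
rewrite !ler_wpM2r//; [exact: slope_le hx xc|apply: slope_le cz; exact: logs_ge1_le hx xc].
Qed.

Lemma norm_scale_increment_le a y z : logs_ge1 m a -> a <= y -> a <= z ->
  `|scale m g z - scale m g y| <= slope m g a * `|z - y|.
Proof.
move=> ha; have a1 := logs_ge1_ge1 ha.
wlog yz : y z / y <= z => [hw ay az|ay az].
  have /orP[yz|zy] := le_total y z; first exact: hw.
  by rewrite distrC [`|z - y|]distrC; exact: hw.
have hy := logs_ge1_le ha ay; have /andP[_ h] := scale_increment hy yz.
have sz := le_scale g_gt0 hy yz.
rewrite distrC ger0_norm ?subr_ge0// ger0_norm ?subr_ge0//.
by apply: (le_trans h); rewrite ler_wpM2r ?subr_ge0// slope_le.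
Qed.

Lemma norm_scale_increment_ge c y z : logs_ge1 m y -> logs_ge1 m z -> y <= c -> z <= c ->
  slope m g c * `|z - y| <= `|scale m g z - scale m g y|.
Proof.
wlog yz : y z / y <= z => [hw hy hz yc zc|hy hz yc zc].
  have /orP[yz|zy] := le_total y z; first exact: hw.
  by rewrite distrC [leRHS]distrC; exact: hw.
have /andP[h _] := scale_increment hy yz.
have sz := le_scale g_gt0 hy yz.
rewrite ger0_norm ?subr_ge0// distrC ger0_norm ?subr_ge0//.
by apply: le_trans h; rewrite ler_wpM2r ?subr_ge0// slope_le.
Qed.

End scale_increments.

(** * Truncated jumps against the dominating variable *)

Section window_domination.
Context {R : realType}.
Variables (S : set R) (K : R.-pker R ~> R) (s : R -> R).
Context d {T : measurableType d} (Q : probability T R) (xi : {RV Q >-> R}).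
Hypothesis xi_L2 : ('E_Q[fun w => (xi w ^+ 2)%R] < +oo)%E.
Hypothesis dominated : forall y : R, S y -> 0 <= y ->
  st_le (jump_law K y) Q (fun u => `|u| * \1_[set v : R | `|v| <= s y] u) xi.

Lemma tail_moment_integrable c h y : 0 <= c -> 0 <= h ->
  (jump_law K y).-integrable (window (s y)) (EFin \o (fun v => tail_moment c h `|v|)).
Proof.
move=> c0 h0; apply: (@window_integrable _ _ _ _ _ (s y ^+ 2)).
  exact: measurableT_comp (measurable_tail_moment c h) _.
move=> v; rewrite /window/= => vs; rewrite ger0_norm ?tail_moment_ge0//.
apply: (le_trans (tail_moment_le _ _ _)); case: ifPn => _.
  by rewrite lerXn2r ?nnegrE// (le_trans _ vs).
exact: sqr_ge0.
Qed.

(** As [tail_moment c h] vanishes at 0, the integral over the window is the full integral for the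
    truncated jump size, the variable that is dominated. *)
Lemma window_tail_le c h y : S y -> 0 <= y -> 0 <= c -> 0 < h ->
  \int[jump_law K y]_(v in window (s y)) tail_moment c h `|v| <=
  dominating_tail xi c h.
Proof.
move=> Sy y0 c0 h0; have mw := measurable_window (s y).
pose Y u : R := `|u| * \1_(window (s y)) u.
have mY : measurable_fun [set: R] Y.
  by apply: measurable_funM => //; exact: measurable_indic.
have e1 u : (tail_moment c h (Y u))%:E =
    ((fun v => (tail_moment c h `|v|)%:E) \_ (window (s y))) u.
  rewrite patchE /Y indicE; case: (u \in _) => /=; first by rewrite mulr1.
  by rewrite mulr0 /tail_moment ltNge c0.
rewrite -lee_fin (dominating_tailE xi_L2)//; last exact: ltW.
rewrite fineK; last first.
  by apply: integrable_fin_num => //; apply: tail_moment_integrable => //; exact: ltW.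
rewrite integral_mkcond; under eq_integral do rewrite -e1.
apply: st_le_integral => //.
- exact: measurable_tail_moment.
- by move=> z; apply: tail_moment_ge0 => //; exact: ltW.
- by move=> r r0; exact: tail_moment_ray.
- exact: dominated.
Qed.

(** With h = s y the minimum in [tail_moment] is v ^ 2 throughout the window, so the integrand is v
    ^ 2 restricted to |v| <= A. *)
Lemma window_square_ge A y : S y -> 0 <= y -> 0 <= A -> 0 < s y ->
  trunc_moment K 2 (s y) y - sqr_tail xi A <=
  \int[jump_law K y]_(v in window (s y)) (v ^+ 2 - tail_moment A (s y) `|v|).
Proof.
move=> Sy y0 A0 s0; have mw := measurable_window (s y).
rewrite (RintegralB mw (power_window_integrable K (s y) y 2)); last first.
  by apply: tail_moment_integrable => //; exact: ltW.
rewrite lerD2l lerN2; apply: (le_trans (window_tail_le Sy y0 A0 s0)).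
by apply: dominating_tail_le => //; exact: ltW.
Qed.

End window_domination.

(** * Inequalities between band ends and constants *)

Section upper_arithmetic.
Context {R : realFieldType}.
Implicit Types x l A delta : R.

Lemma upper_band_arith x l A delta : 0 < delta -> delta <= 1 / 4 -> 1 <= A ->
  A <= delta * x -> 0 <= l -> l <= delta * x ->
  [/\ x / 2 <= x - A, x - A <= x <= (1 + 4 * delta) * (x - A) &
    x <= x + l + A <= (1 + 4 * delta) * x].
Proof.
move=> d0 d4 A1 hA l0 hl; have x0 : 0 <= x by rewrite -(pmulr_rge0 _ d0); lra.
have h1 : delta * x <= 1 / 4 * x by rewrite ler_wpM2r.
have : 0 <= delta * (x - 2 * A) by rewrite mulr_ge0//; lra.
by move=> h2; split; lra.
Qed.

Lemma upper_band_mem x l A y v : 0 <= A -> x < y <= x + l -> `|v| <= A ->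
  [/\ x - A <= y <= x + l + A & x - A <= y + v <= x + l + A].
Proof. by rewrite ler_norml => A0 hy hv; split; lra. Qed.

(** Here v is the slope at x, q and t are U a and U a - U beta, and r is the ratio lost across the
    band. The power r ^ 4 comes once from q, once from t and twice from (v / r) ^ 2. *)
Lemma upper_const_arith (delta b g r v L q t len : R) : 0 < delta -> 0 < b - 2 * delta ->
  0 < g -> 0 < r -> 0 < v -> 0 <= q -> 0 <= t -> q <= r * (v * (L / g)) ->
  t <= r * v * len ->
  (1 + delta) * q * t / ((v / r) ^+ 2 / 2 * (b - 2 * delta)) <=
  2 * (1 + delta) * r ^+ 4 / ((b - 2 * delta) * g) * (len * L).
Proof.
move=> d0 bd g0 r0 v0 q0 t0 hq ht.
have k0 : 0 < (v / r) ^+ 2 / 2 * (b - 2 * delta).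
  by rewrite mulr_gt0// divr_gt0// exprn_gt0// divr_gt0.
have d1 : 0 <= 1 + delta by lra.
rewrite ler_pdivrMr//.
apply: (@le_trans _ _ ((1 + delta) * (r * (v * (L / g))) * (r * v * len))).
  by apply: ler_pM => //; [exact: mulr_ge0|exact: ler_wpM2l].
rewrite le_eqVlt; apply/orP; left; apply/eqP.
by field; rewrite !gt_eqF.
Qed.

End upper_arithmetic.

Section lower_arithmetic.
Context {R : realType}.
Implicit Types (x y v h A delta : R) (k : nat).

Lemma window_low x h A delta y v : 0 < delta -> delta <= 1 / 8 -> 1 <= A -> 0 <= y ->
  y < (1 - 2 * delta) * x -> `|v| <= delta * y -> y <= x + A /\ y + v <= x + A.
Proof.
move=> d0 d8 A1 y0 yx; have x0 : 0 <= x.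
  have h1 : 0 < 1 - 2 * delta by lra.
  by rewrite -(pmulr_rge0 _ h1); lra.
have dx0 : 0 <= delta * x by rewrite mulr_ge0// ltW.
have dyx : delta * y <= delta * x by rewrite ler_wpM2l//; lra.
by rewrite ler_norml => hv; split; lra.
Qed.

Lemma window_high x h A delta y v : 0 < delta -> delta <= 1 / 8 -> 1 <= A -> 0 <= x ->
  h <= delta * x -> (1 + 4 * delta) * x < y -> `|v| <= delta * y ->
  x + h - A <= y /\ x + h - A <= y + v.
Proof.
move=> d0 d8 A1 x0 hd xy.
have dx0 : 0 <= delta * x by rewrite mulr_ge0// ltW.
have ddx : delta * (delta * x) <= 1 / 8 * (delta * x) by rewrite ler_wpM2r.
have k1 : (1 - delta) * ((1 + 4 * delta) * x) <= (1 - delta) * y.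
  by rewrite ler_wpM2l//; lra.
by rewrite ler_norml => hv; split; lra.
Qed.

Lemma window_mid x delta y v : 0 < delta -> delta <= 1 / 8 -> 0 <= x ->
  (1 - 2 * delta) * x <= y -> `|v| <= delta * y ->
  (1 - 3 * delta) * x <= y /\ (1 - 3 * delta) * x <= y + v.
Proof.
move=> d0 d8 x0 xy.
have dx0 : 0 <= delta * x by rewrite mulr_ge0// ltW.
have ddx0 : 0 <= delta * (delta * x) by rewrite mulr_ge0// ltW.
have k1 : (1 - delta) * ((1 - 2 * delta) * x) <= (1 - delta) * y.
  by rewrite ler_wpM2l//; lra.
by rewrite ler_norml => hv; split; lra.
Qed.

Definition cell_below x h k : set R := `]x - k.+1%:R * h, x - k%:R * h]%classic.

(* Twice as long as [cell_below], so that the point at distance [d >= 0] above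
   [x + h] lies in the cell of index [truncn (d / h)]. *)
Definition cell_above x h k : set R := `]x + k%:R * h, x + k.+2%:R * h]%classic.

Lemma cell_index (t h M : R) n : 0 < h -> 0 <= t -> t <= M -> M < n%:R * h ->
  exists k, [/\ (k < n)%N, k%:R * h <= t & t < k.+1%:R * h].
Proof.
move=> h0 t0 tM nh; have := @truncn_itv _ (t / h) (divr_ge0 t0 (ltW h0)).
set k := Num.trunc _; rewrite ler_pdivlMr// ltr_pdivrMr// => /andP[k1 k2].
exists k; split => //; rewrite -(ltr_nat R) -(ltr_pM2r h0).
exact: le_lt_trans (le_trans k1 tM) nh.
Qed.

(** A point of cell k is at distance at least k h from x, so only a jump longer than A + k h takes
    it past x + A, the end of the shrunk band. *)
Lemma cell_below_cover x y h A M n : 0 < h -> 0 <= A -> y <= x -> x - M <= y ->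
  M < n%:R * h -> exists k, [/\ (k < n)%N, cell_below x h k y &
    forall v, `|v| <= A + k%:R * h -> y <= x + A /\ y + v <= x + A].
Proof.
move=> h0 A0 yx xM nh.
have [||k [kn k1 k2]] := @cell_index (x - y) h M n h0 _ _ nh; [lra..|].
exists k; split => //.
  by rewrite /cell_below/= in_itv/=; apply/andP; split; lra.
by move=> v; rewrite ler_norml => /andP[_ v2]; split; lra.
Qed.

Lemma cell_above_cover x y h A M n : 0 < h -> 0 <= A -> x + h < y -> y <= x + M ->
  M < n%:R * h -> exists k, [/\ (k < n)%N, cell_above x h k y &
    forall v, `|v| <= A + k%:R * h -> x + h - A <= y /\ x + h - A <= y + v].
Proof.
move=> h0 A0 yx xM nh.
have [||k [kn k1 k2]] := @cell_index (y - x - h) h M n h0 _ _ nh; [lra..|].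
exists k; split => //.
  by rewrite /cell_above/= in_itv/= -[k.+2%:R]natr1; apply/andP; split; lra.
by move=> v; rewrite ler_norml => /andP[v1 _]; split; lra.
Qed.

(** The power r ^ 3 comes once from the lower bound v / r of the slope in the band and twice from
    the upper bound r v outside; r^-1 compares U beta with U x. *)
Lemma lower_const_arith (delta b g r v L h Hr : R) : 0 < delta -> 0 < b -> 0 < g ->
  0 < r -> 0 < v ->
  v / r * ((1 - delta) * h) * ((r^-1 - delta) * (v * (L / g))) <=
    (r * v) ^+ 2 * ((b + delta) / 2 * Hr + delta * (h * L)) ->
  2 / (b + delta) * ((1 - delta) * (r^-1 - delta) / (g * r ^+ 3) - delta) * (h * L) <= Hr.
Proof.
move=> d0 b0 g0 r0 v0 low; have bd : 0 < b + delta by rewrite addr_gt0.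
have c0 : 0 < (r * v) ^+ 2 * ((b + delta) / 2).
  by apply: mulr_gt0; [rewrite exprn_gt0// mulr_gt0|rewrite divr_gt0].
rewrite -(ler_pM2l c0); apply: (@le_trans _ _ (v / r * ((1 - delta) * h) *
    ((r^-1 - delta) * (v * (L / g))) - (r * v) ^+ 2 * (delta * (h * L)))).
  by rewrite le_eqVlt; apply/orP; left; apply/eqP; field; rewrite !gt_eqF.
by rewrite lerBlDr; apply: (le_trans low); rewrite mulrDr mulrA.
Qed.

End lower_arithmetic.

(** * Upper and lower bounds for the renewal measure of an interval *)

Section renewal_bounds.
Context {R : realType} d {T : measurableType d} {P : probability T R}.
Context {S : set R} {K : R.-pker R ~> R} {X : nat -> {RV P >-> R}}.
Variables (s : R -> R) (m : nat) (gamma b : R).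
Hypotheses (gamma_gt0 : 0 < gamma) (b_gt0 : 0 < b).
Hypothesis s_gt0 : forall x : R, 0 <= x -> 0 < s x.
Hypothesis cutoff : forall delta, 0 < delta ->
  exists x0, forall y, x0 <= y -> s y <= delta * y.
Hypothesis variance : forall delta, 0 < delta -> exists x0, forall y, x0 <= y -> S y ->
  b - delta <= trunc_moment K 2 (s y) y <= b + delta.
Context d' {T' : measurableType d'} (Q : probability T' R) (xi : {RV Q >-> R}).
Hypothesis xi_L2 : ('E_Q[fun w => (xi w ^+ 2)%R] < +oo)%E.
Hypothesis dominated : forall y : R, S y -> 0 <= y ->
  st_le (jump_law K y) Q (fun u => `|u| * \1_[set v : R | `|v| <= s y] u) xi.

Local Notation "'U'" := (scale m gamma).
Local Notation "'u'" := (slope m gamma).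
Local Notation "'L'" := (logprod m).
Local Notation G e := (@green _ _ _ P X e%R).
Local Notation H B := (@renewal_measure _ _ _ P X B).
Local Notation gap := (@gap_mean R K s m gamma).

Hypothesis gap_upper : forall delta, 0 < delta ->
  exists a0, forall a beta (e : R -> R), a0 <= a -> a <= beta ->
    measurable_fun [set: R] e -> (forall y, 0 <= e y) ->
    (forall y, S y -> e y <= from a (gap (U beta) (U a)) y) ->
    (G e <= ((1 + delta) * U a * (U a - U beta))%:E)%E.
Hypothesis gap_lower : forall delta, 0 < delta ->
  exists y0, forall x1, y0 <= x1 -> exists a0, forall a beta (e : R -> R),
    a0 <= a -> a <= beta -> measurable_fun [set: R] e -> (forall y, 0 <= e y) ->
    (forall y, S y -> x1 <= y -> gap (U beta) (U a) y <= e y) ->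
    (((U a - U beta) * (U beta - delta * U a))%:E <= G e)%E.
Variable N : nat.
Hypotheses (decU : decays m N U) (decu : decays m N u).
Implicit Types (x y z a l h A delta : R).

Lemma gap_integrable p q y : 0 <= p -> p <= q ->
  (forall v, window (s y) v -> logs_ge1 m (y + v)) -> logs_ge1 m y ->
  (jump_law K y).-integrable (window (s y))
    (EFin \o (fun v => band_gap p q (U y) (U (y + v)))).
Proof.
move=> p0 pq hv hy; apply: (@window_integrable _ _ _ _ _ ((q - p) * 2)).
  have mU : measurable_fun [set: R] (fun v => U (y + v)).
    by apply: measurable_shift; exact: measurable_scale.
  apply: measurable_funB; last exact: measurableT_comp (measurable_band p q) mU.
  apply: measurable_funD => //; apply: measurable_funM => //.
  exact: measurable_funB.
move=> v wv; rewrite ger0_norm ?band_gap_ge0//.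
apply: (le_trans (band_gap_le_norm pq _ _)); rewrite ler_wpM2l ?subr_ge0//.
rewrite (le_trans (ler_normB _ _))// !ger0_norm ?(ltW (scale_gt0 _ _ _))//.
have := scale_le1 gamma_gt0 (hv _ wv); have := scale_le1 gamma_gt0 hy; lra.
Qed.

Lemma scale_slope x : logs_ge1 m x -> U x = u x * (L x / gamma).
Proof.
move=> hx; have := logprod_gt0 hx (leqnn m); rewrite /slope.
by move: (U x) (L x) gamma_gt0 => U0 L0 h1 h2; field; rewrite !gt_eqF.
Qed.

(** Jumps with |v| <= A stay in the band, where the gap is exactly half a square; the other jumps
    only need a nonnegative gap. *)
Lemma gap_ge_window_square A w p q y : 0 <= A -> 0 <= w -> 0 <= p -> p <= q -> S y ->
  0 <= y -> logs_ge1 m y -> (forall v, window (s y) v -> logs_ge1 m (y + v)) ->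
  (forall v, window (s y) v -> `|v| <= A ->
    [/\ p <= U y <= q, p <= U (y + v) <= q & w * `|v| <= `|U (y + v) - U y|]) ->
  w ^+ 2 / 2 * (trunc_moment K 2 (s y) y - sqr_tail xi A) <= gap p q y.
Proof.
move=> A0 w0 p0 pq Sy y0 hy hv hw.
have mw := measurable_window (s y); have sy := s_gt0 y0.
have i0 := tail_moment_integrable K s y A0 (ltW sy).
have i1 : (jump_law K y).-integrable (window (s y))
    (EFin \o (fun v => v ^+ 2 - tail_moment A (s y) `|v|)).
  exact: (integrableB mw (power_window_integrable K (s y) y 2) i0).
have i2 : (jump_law K y).-integrable (window (s y))
    (EFin \o (fun v => w ^+ 2 / 2 * (v ^+ 2 - tail_moment A (s y) `|v|))).
  exact: (integrableZl mw (w ^+ 2 / 2) i1).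
apply: (le_trans (ler_wpM2l _ (window_square_ge xi_L2 dominated Sy y0 A0 sy))).
  by rewrite divr_ge0// sqr_ge0.
rewrite -(RintegralZl _ mw i1); apply: le_Rintegral => //.
  exact: gap_integrable.
move=> v wv; rewrite /tail_moment; case: (ltP A `|v|) => Av.
  have -> : Num.min (`|v| ^+ 2) (s y * `|v|) = v ^+ 2.
    rewrite (min_idPl _) ?real_normK ?num_real//.
    by rewrite -real_normK ?num_real// expr2 ler_wpM2r.
  by rewrite subrr mulr0 band_gap_ge0.
have [h1 h2 h3] := hw v wv Av.
rewrite subr0 (band_gap_mid pq)// [leLHS]mulrAC ler_pM2r ?invr_gt0// -exprMn.
rewrite -[leRHS]real_normK ?num_real// -[leLHS]real_normK ?num_real//.
by rewrite lerXn2r ?nnegrE// normrM (ger0_norm w0).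
Qed.

Lemma renewal_upper delta A : 0 < delta -> delta <= 1 / 4 -> 0 < b - 2 * delta ->
  1 <= A -> sqr_tail xi A <= delta ->
  exists x0, forall x l, x0 <= x -> 0 <= l -> l <= delta * x ->
  (H `]x, (x + l)%R] <= (2 * (1 + delta) * (1 + 4 * delta) ^+ (4 * N)
    / ((b - 2 * delta) * gamma) * ((l + 2 * A) * L x))%:E)%E.
Proof.
move=> d0 d4 bd A1 tA; have A0 : 0 <= A := le_trans ler01 A1.
have [a0 hgap] := gap_upper d0; have [y0 hvar] := variance d0.
have [x1 hx1] := near_pinfty (@logs_ge1_near R m).
have [z0 hcut] := @cutoff (1 / 4) ltac:(lra).
(* A / delta makes A <= delta x; the factors 2 transfer a0 and x1 to the left end x - A >= x / 2. *)
exists (\big[Num.max/0]_(x <- [:: 2 * a0; y0; 2 * x1; A / delta; z0]) x) => x l.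
rewrite !big_cons big_nil !ge_max.
move=> /and5P[xa0 xy0 xx1 xA /andP[xz0 x_ge0]] l0 lx.
rewrite ler_pdivrMr// [x * _]mulrC in xA.
have [a1 xra xrb] := upper_band_arith d0 d4 A1 xA l0 lx.
have /andP[ax _] := xra; have /andP[xb _] := xrb.
set a := x - A in a1 ax xra; set beta := x + l + A in xb xrb.
have aa0 : a0 <= a by lra.
have ha : logs_ge1 m a by apply: hx1; lra.
have hx := logs_ge1_le ha ax; have hb := logs_ge1_le hx xb.
have /andP[_ Ua] := decays_near decU ha xra.
have /andP[_ ua] := decays_near decu ha xra.
have /andP[_ ub] := decays_near decu hx xrb.
set rN := (1 + 4 * delta) ^+ N in Ua ua ub.
have rN0 : 0 < rN by rewrite exprn_gt0//; lra.
have ux := slope_gt0 gamma_gt0 hx.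
set p := U beta; set q := U a.
have p0 : 0 <= p by exact/ltW/scale_gt0.
have q0 : 0 <= q by exact/ltW/scale_gt0.
have pq : p <= q by apply: le_scale => //; exact: le_trans xb.
pose w := u x / rN; have w0 : 0 < w by rewrite divr_gt0.
have wb : w <= u beta by rewrite ler_pdivrMr// mulrC.
(* A lower bound of the gap on the interval: one delta is lost to the variance, the other to the
   jumps longer than A. *)
pose kap := w ^+ 2 / 2 * (b - 2 * delta).
have w2 : 0 <= w ^+ 2 / 2 by rewrite divr_ge0// sqr_ge0.
have kap0 : 0 < kap by rewrite mulr_gt0// divr_gt0// exprn_gt0.
have mI : measurable (`]x, (x + l)%R]%classic : set R) by exact: measurable_itv.
have mi : measurable_fun [set: R] (\1_(`]x, (x + l)%R]%classic) : R -> R).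
  exact: measurable_indic.
have key y : S y -> kap * \1_(`]x, (x + l)%R]%classic) y <= from a (gap p q) y.
  move=> Sy; have g0 z : 0 <= gap p q z.
    by apply: Rintegral_ge0 => v _; exact: band_gap_ge0.
  rewrite indicE; case: (boolP (y \in _)) => [|_]; last first.
    by rewrite mulr0; exact: from_ge0.
  rewrite inE/= in_itv/= mulr1 => yI; have /andP[/ltW xy _] := yI.
  have y_ge0 : 0 <= y := le_trans x_ge0 xy.
  have hy := logs_ge1_le hx xy.
  have /andP[v1 _] := hvar y (le_trans xy0 xy) Sy.
  have sy := hcut y (le_trans xz0 xy).
  have y2 := le_trans xx1 xy.
  have hyv v : window (s y) v -> logs_ge1 m (y + v).
    rewrite /window/= ler_norml => /andP[w1 _]; apply: hx1.
    by move: (s y) y2 w1 sy y_ge0 => *; lra.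
  rewrite /from (le_trans ax xy); apply: le_trans
    (gap_ge_window_square A0 (ltW w0) p0 pq Sy y_ge0 hy hyv _).
    rewrite /kap ler_wpM2l//; move: v1 tA.
    by move: (trunc_moment _ _ _ _) (sqr_tail _ _) => *; lra.
  move=> v wv vA; have [/andP[z1 z2] /andP[z3 z4]] := upper_band_mem A0 yI vA.
  have hyv' := hyv v wv; split.
  - by apply/andP; split; exact: le_scale.
  - by apply/andP; split; exact: le_scale.
  - apply: le_trans (norm_scale_increment_ge gamma_gt0 hy hyv' z2 z4).
    by rewrite [y + v - y]addrC addKr ler_wpM2r.
have e0 y : 0 <= kap * \1_(`]x, (x + l)%R]%classic) y.
  by rewrite mulr_ge0 ?(ltW kap0)// indicE.
have := hgap a beta (fun y => kap * \1_(`]x, (x + l)%R]%classic) y) aa0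
  (le_trans ax xb) (measurable_funM (measurable_cst kap) mi) e0 key.
rewrite greenZ ?(ltW kap0)// green_indic//.
rewrite muleC -lee_pdivlMr// => /le_trans; apply; rewrite -EFinM lee_fin.
rewrite mulnC exprM; apply: upper_const_arith => //; first by rewrite subr_ge0.
  by rewrite -(scale_slope hx).
have /andP[_ inc] := scale_increment gamma_gt0 ha (le_trans ax xb).
apply: (le_trans inc); rewrite (_ : beta - a = l + 2 * A); last first.
  by rewrite /beta /a; ring.
by apply: ler_wpM2r => //; rewrite addr_ge0// mulr_ge0.
Qed.

(** An a priori bound with an unspecified constant, meant for the cells of the lower bound; l >= A
    turns l + 2 A into 3 l. *)
Lemma renewal_crude : exists C A x1 eta, [/\ 0 < C, 1 <= A, 0 < eta &
  forall x l, x1 <= x -> A <= l -> l <= eta * x ->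
    (H `]x, (x + l)%R] <= (C * (l * L x))%:E)%E].
Proof.
pose delta := Num.min (1 / 4) (b / 4).
have b0 := b_gt0; have g0 := gamma_gt0.
have d0 : 0 < delta by rewrite lt_min !divr_gt0.
have d4 : delta <= 1 / 4 by rewrite ge_min lexx.
have db : delta <= b / 4 by rewrite ge_min lexx orbT.
have bd : 0 < b - 2 * delta by lra.
have [A0 A00 hA] := sqr_tail_small xi_L2 d0.
pose A := Num.max A0 1.
have A1 : 1 <= A by rewrite le_max lexx orbT.
have tA : sqr_tail xi A <= delta by apply: hA; rewrite le_max lexx.
have [x0 hx0] := renewal_upper d0 d4 bd A1 tA.
have [x1 hx1] := near_pinfty (@logs_ge1_near R m).
pose k := 2 * (1 + delta) * (1 + 4 * delta) ^+ (4 * N) / ((b - 2 * delta) * gamma).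
have k0 : 0 < k.
  rewrite divr_gt0 ?mulr_gt0// ?exprn_gt0//; lra.
exists (k * 3), A, (Num.max x0 x1), delta; split => //; first by rewrite mulr_gt0.
move=> x l; rewrite ge_max => /andP[xx0 xx1] Al lx.
apply: (le_trans (hx0 x l xx0 _ lx)); first by lra.
have L0 := logprod_gt0 (hx1 x xx1) (leqnn m).
have h3 : (l + 2 * A) * L x <= 3 * (l * L x).
  by rewrite mulrA; apply: ler_wpM2r; [exact: ltW|lra].
by rewrite lee_fin -/k -[leRHS]mulrA; apply: ler_wpM2l => //; exact: ltW.
Qed.

Lemma band_gap_mean_le_sqr p q y a : 0 <= p -> p <= q -> logs_ge1 m a -> a <= y ->
  (forall v, window (s y) v -> a <= y + v) ->
  gap p q y <= u a ^+ 2 / 2 * trunc_moment K 2 (s y) y.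
Proof.
move=> p0 pq ha ay av; have mw := measurable_window (s y).
have i2 := power_window_integrable K (s y) y 2.
rewrite -(RintegralZl _ mw i2); apply: le_Rintegral => //.
- apply: gap_integrable => // [v /av|]; last exact: logs_ge1_le ha ay.
  exact: logs_ge1_le.
- exact: (integrableZl mw (u a ^+ 2 / 2) i2).
move=> v wv; apply: (le_trans (band_gap_le_sqr pq _ _)).
have := norm_scale_increment_le gamma_gt0 ha ay (av v wv).
rewrite [y + v - y]addrC addKr => h.
rewrite [leRHS]mulrAC ler_wpM2r// -exprMn.
rewrite -[leLHS]real_normK ?num_real// -[leRHS]real_normK ?num_real//.
rewrite lerXn2r ?nnegrE// normrM (ger0_norm (ltW (slope_gt0 gamma_gt0 ha))).
exact: h.
Qed.

(** The quadratic and the linear bound of the gap, the latter with q - p <= u a * h, combine into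
    the minimum that defines [tail_moment]. *)
Lemma band_gap_mean_le_tail p q y a h c : 0 <= p -> p <= q -> logs_ge1 m a -> a <= y ->
  (forall v, window (s y) v -> a <= y + v) -> S y -> 0 < h -> 0 <= c ->
  q - p <= u a * h ->
  (forall v, window (s y) v -> `|v| <= c -> band_gap p q (U y) (U (y + v)) = 0) ->
  gap p q y <= u a ^+ 2 * dominating_tail xi c h.
Proof.
move=> p0 pq ha ay av Sy h0 c0 qp near0; have mw := measurable_window (s y).
have y0 : 0 <= y by have := logs_ge1_ge1 ha; lra.
have i2 : (jump_law K y).-integrable (window (s y))
    (EFin \o (fun v => tail_moment c h `|v|)).
  by apply: tail_moment_integrable => //; exact: ltW.
have dom := window_tail_le xi_L2 dominated Sy y0 c0 h0.
apply: (le_trans _ (ler_wpM2l (sqr_ge0 _) dom)).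
rewrite -(RintegralZl _ mw i2); apply: le_Rintegral => //.
- apply: gap_integrable => // [v /av|]; last exact: logs_ge1_le ha ay.
  exact: logs_ge1_le.
- exact: (integrableZl mw (u a ^+ 2) i2).
move=> v wv; rewrite /tail_moment; case: (ltP c `|v|) => vc; last first.
  by rewrite near0// mulr0.
have u0 := slope_gt0 gamma_gt0 ha.
have := norm_scale_increment_le gamma_gt0 ha ay (av v wv).
rewrite [y + v - y]addrC addKr => inc.
have [_|_] := leP (`|v| ^+ 2) (h * `|v|).
  apply: (le_trans (band_gap_le_sqr pq _ _)).
  rewrite -exprMn -real_normK ?num_real//.
  have : `|U (y + v) - U y| ^+ 2 <= (u a * `|v|) ^+ 2.
    by rewrite lerXn2r ?nnegrE// mulr_ge0// ltW.
  have : 0 <= `|U (y + v) - U y| ^+ 2 by exact: exprn_ge0.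
  by move: (`|_| ^+ 2) ((u a * _) ^+ 2) => z1 z2; lra.
apply: (le_trans (band_gap_le_norm pq _ _)).
rewrite [leRHS](_ : _ = u a * h * (u a * `|v|)); last by ring.
by apply: ler_pM => //; rewrite subr_ge0.
Qed.

Lemma band_gap_mean0 p q y :
  (forall v, window (s y) v -> band_gap p q (U y) (U (y + v)) = 0) -> gap p q y = 0.
Proof.
move=> h; rewrite /gap_mean (@eq_Rintegral _ _ _ _ _ (cst 0)).
  by rewrite Rintegral_cst ?mul0r//; exact: measurable_window.
by move=> v; rewrite inE => /h.
Qed.

(** A measurable majorant of the gap in units of the squared slope: half the variance on the
    interval, and on the k-th cells the moment of those jumps that are long enough to reach the
    shrunk band. *)
Definition cell_bound delta A x h n y : R :=
  (b + delta) / 2 * \1_(`]x, (x + h)%R]%classic) y +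
  \sum_(0 <= k < n) dominating_tail xi (A + k%:R * h) h *
    (\1_(cell_below x h k) y + \1_(cell_above x h k) y).

Lemma cell_bound_ge delta A x h n k y : 0 < delta -> 0 <= A -> 0 < h -> (k < n)%N ->
  cell_below x h k y \/ cell_above x h k y ->
  dominating_tail xi (A + k%:R * h) h <= cell_bound delta A x h n y.
Proof.
move=> d0 A0 h0 kn cy; have h0' := ltW h0; have b0 := b_gt0.
have t0 j : 0 <= dominating_tail xi (A + j%:R * h) h.
  by apply: dominating_tail_ge0 => //; rewrite addr_ge0// mulr_ge0.
have i0 j : (0 : R) <= \1_(cell_below x h j) y + \1_(cell_above x h j) y.
  by rewrite addr_ge0.
rewrite /cell_bound ler_wpDl//.
  by apply: mulr_ge0 => //; rewrite divr_ge0//; lra.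
rewrite big_mkord (bigD1 (Ordinal kn))//= ler_wpDr//.
  by apply: sumr_ge0 => j _; exact: mulr_ge0.
rewrite -[leLHS]mulr1 ler_wpM2l// !indicE.
by case: cy => h1; rewrite (mem_set h1) ?lerDl ?lerDr.
Qed.

Lemma cell_bound_ge0 delta A x h n y : 0 <= delta -> 0 <= A -> 0 < h ->
  0 <= cell_bound delta A x h n y.
Proof.
move=> d0 A0 h0; apply: addr_ge0.
  by rewrite mulr_ge0 ?indicE// divr_ge0// addr_ge0// ltW.
apply: sumr_ge0 => k _; apply: mulr_ge0; last by rewrite addr_ge0// indicE.
by apply: dominating_tail_ge0; rewrite ?addr_ge0 ?mulr_ge0// ltW.
Qed.

Lemma cell_bound_ge_main delta A x h n y : 0 <= A -> 0 < h ->
  `]x, (x + h)%R]%classic y -> (b + delta) / 2 <= cell_bound delta A x h n y.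
Proof.
move=> A0 h0 yI; rewrite /cell_bound indicE mem_set// mulr1 lerDl.
apply: sumr_ge0 => k _; apply: mulr_ge0; last by rewrite addr_ge0.
by apply: dominating_tail_ge0; rewrite ?addr_ge0 ?mulr_ge0// ltW.
Qed.

Lemma gap_le_cells delta A x h n y : 0 < delta -> delta <= 1 / 8 -> 1 <= A ->
  2 * A <= h -> h <= delta * x -> logs_ge1 m ((1 - 3 * delta) * x) ->
  4 * delta * x < n%:R * h -> S y -> logs_ge1 m (y / 2) -> s y <= delta * y ->
  trunc_moment K 2 (s y) y <= b + delta ->
  gap (U (x + h - A)) (U (x + A)) y <=
    u ((1 - 3 * delta) * x) ^+ 2 * cell_bound delta A x h n y.
Proof.
move=> d0 d8 A1 hA hd hz nh Sy hy2 sy var.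
have y0 : 0 <= y by have := logs_ge1_ge1 hy2; lra.
have h0 : 0 < h by lra.
have A0 : 0 <= A := le_trans ler01 A1.
have x0 : 0 <= x by rewrite -(pmulr_rge0 _ d0); lra.
have ab : x + A <= x + h - A by lra.
have za : (1 - 3 * delta) * x <= x + A by lra.
have len : x + h - A - (x + A) <= h by lra.
have hyle : y / 2 <= y by lra.
have dy : delta * y <= y / 8 by have := ler_wpM2r y0 d8; lra.
set z0 := (1 - 3 * delta) * x in hz za *; set a := x + A in ab za len *.
set beta := x + h - A in ab len *.
have ha := logs_ge1_le hz za; have hb := logs_ge1_le ha ab.
set p := U beta; set q := U a.
have p0 : 0 <= p by exact/ltW/scale_gt0.
have pq : p <= q by exact: le_scale.
have qp : q - p <= u z0 * h.
  have /andP[_] := scale_increment gamma_gt0 ha ab; move=> /le_trans; apply.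
  by apply: ler_pM; rewrite ?subr_ge0//; [exact/ltW/slope_gt0|exact: slope_le].
have usq : 0 <= u z0 ^+ 2 by exact: sqr_ge0.
have cb0 : 0 <= cell_bound delta A x h n y.
  exact: cell_bound_ge0 (ltW d0) A0 h0.
have win v : window (s y) v -> `|v| <= delta * y.
  by move=> wv; exact: le_trans sy.
have hy : logs_ge1 m y by exact: logs_ge1_le hyle.
have hyv v : window (s y) v -> logs_ge1 m (y + v).
  move=> /win; rewrite ler_norml => /andP[v1 _]; apply: (logs_ge1_le hy2).
  by move: dy v1 y0; move: (delta * y) => *; lra.
have high v : window (s y) v -> y <= a /\ y + v <= a -> band_gap p q (U y) (U (y + v)) = 0.
  move=> wv [z1 t1]; apply: band_gap_high => //; apply: le_scale => //; exact: hyv.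
have low v : beta <= y /\ beta <= y + v -> band_gap p q (U y) (U (y + v)) = 0.
  by move=> [z1 t1]; apply: band_gap_low => //; exact: le_scale.
(* As s y <= delta y, no truncated jump from outside [(1 - 2 delta) x, (1 + 4 delta) x] meets the
   band, and the gap vanishes there. *)
have [ysmall|ybig] := ltP y ((1 - 2 * delta) * x).
  rewrite band_gap_mean0; first exact: mulr_ge0.
  move=> v wv; apply: high => //.
  exact: window_low d0 d8 A1 y0 ysmall (win v wv).
have [yhuge|ylow] := ltP ((1 + 4 * delta) * x) y.
  rewrite band_gap_mean0; first exact: mulr_ge0.
  move=> v wv; apply: low.
  exact: window_high d0 d8 A1 x0 hd yhuge (win v wv).
have zyv v : window (s y) v -> z0 <= y + v.
  by move=> /win wv; have [] := window_mid d0 d8 x0 ybig wv.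
have zy : z0 <= y.
  have v0 : `|0 : R| <= delta * y by rewrite normr0 mulr_ge0// ltW.
  by have [] := window_mid d0 d8 x0 ybig v0.
have tail_case k : (k < n)%N -> cell_below x h k y \/ cell_above x h k y ->
    (forall v, window (s y) v -> `|v| <= A + k%:R * h ->
       band_gap p q (U y) (U (y + v)) = 0) ->
    gap p q y <= u z0 ^+ 2 * cell_bound delta A x h n y.
  move=> kn cy near0; have kh : 0 <= A + k%:R * h by rewrite addr_ge0// mulr_ge0// ltW.
  apply: (le_trans (band_gap_mean_le_tail p0 pq hz zy zyv Sy h0 kh qp near0)).
  by rewrite ler_wpM2l//; exact: cell_bound_ge.
have [yx|xy] := leP y x.
  have yM : x - 4 * delta * x <= y by apply: le_trans ybig; rewrite mulrBl mul1r; lra.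
  have [k [kn cy near0]] := cell_below_cover h0 A0 yx yM nh.
  by apply: (tail_case k) => //; [left|move=> v wv /near0; exact: high].
have [yxh|xhy] := leP y (x + h).
  apply: (le_trans (band_gap_mean_le_sqr p0 pq hz zy zyv)).
  rewrite -mulrA ler_wpM2l//.
  apply: (@le_trans _ _ ((b + delta) / 2)).
    by rewrite mulrC ler_wpM2r ?invr_ge0.
  by apply: cell_bound_ge_main => //; rewrite /= in_itv/= xy.
have yM : y <= x + 4 * delta * x by apply: (le_trans ylow); rewrite mulrDl mul1r.
have [k [kn cy near0]] := cell_above_cover h0 A0 xhy yM nh.
by apply: (tail_case k) => //; [right|move=> v wv /near0; exact: low].
Qed.

Let measurable_indic_fun (B : set R) : measurable B ->
  measurable_fun [set: R] (\1_B : R -> R).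
Proof. by move=> mB; exact: measurable_indic. Qed.

Let measurable_cell x h k : measurable (cell_below x h k) /\ measurable (cell_above x h k).
Proof. by split; exact: measurable_itv. Qed.

Let cell_term A x h k y := dominating_tail xi (A + k%:R * h) h *
    (\1_(cell_below x h k) y + \1_(cell_above x h k) y).

Let measurable_cell_term A x h k : measurable_fun [set: R] (cell_term A x h k).
Proof.
have [m1 m2] := measurable_cell x h k.
apply: measurable_funM => //; apply: measurable_funD; exact: measurable_indic_fun.
Qed.

Let cell_term_ge0 A x h k y : 0 <= A -> 0 < h -> 0 <= cell_term A x h k y.
Proof.
move=> A0 h0; apply: mulr_ge0; last by rewrite addr_ge0// indicE.
by apply: dominating_tail_ge0; rewrite ?addr_ge0 ?mulr_ge0// ltW.
Qed.

Lemma measurable_cell_bound delta A x h n :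
  measurable_fun [set: R] (cell_bound delta A x h n).
Proof.
apply: measurable_funD.
  apply: measurable_funM => //; apply: measurable_indic_fun; exact: measurable_itv.
by apply: measurable_sum => k; exact: measurable_cell_term.
Qed.

(** In the constant, 1 stands for the lower cell, where L is at most L x; the upper cell has length
    2 h and starts below 2 x, where L is at most 2 ^ (m + 1) times L x. *)
Lemma green_cell_term_le C A0 xc etac A x h k : 0 < C -> 0 < etac ->
  (forall x l, xc <= x -> A0 <= l -> l <= etac * x ->
    (H `]x, (x + l)%R] <= (C * (l * L x))%:E)%E) ->
  A0 <= h -> 0 <= A -> 0 < h -> h <= etac / 4 * x -> 4 * xc <= x ->
  logs_ge1 m (x / 4) -> k%:R * h <= x / 2 -> h <= x / 8 ->
  (G (cell_term A x h k) <= (dominating_tail xi (A + k%:R * h) h *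
     (C * (1 + 2 * 2 ^+ m.+1) * (h * L x)))%:E)%E.
Proof.
move=> C0 etac0 crude hA0 A00 h0 he xxc hx4 kh h8.
have x0 : 0 < x by have := logs_ge1_ge1 hx4; lra.
have hxl : logs_ge1 m x by apply: (logs_ge1_le hx4); lra.
have [mb ma] := measurable_cell x h k.
have t0 : 0 <= dominating_tail xi (A + k%:R * h) h.
  by apply: dominating_tail_ge0; rewrite ?addr_ge0 ?mulr_ge0// ltW.
have m12 : measurable_fun [set: R]
    (fun y => \1_(cell_below x h k) y + \1_(cell_above x h k) y : R).
  by apply: measurable_funD; exact: measurable_indic_fun.
have p12 y : 0 <= \1_(cell_below x h k) y + \1_(cell_above x h k) y :> R.
  by rewrite addr_ge0// indicE.
rewrite (greenZ m12 p12 t0).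
rewrite [leRHS]EFinM; apply: lee_wpmul2l; first by rewrite lee_fin.
rewrite (greenD (measurable_indic_fun mb) (measurable_indic_fun ma))//.
rewrite !green_indic//.
have kS : k.+1%:R * h = k%:R * h + h by rewrite -natr1 mulrDl mul1r.
have k0 : 0 <= k%:R * h by rewrite mulr_ge0// ltW.
have below : (H (cell_below x h k) <= (C * (h * L x))%:E)%E.
  have -> : cell_below x h k = `]x - k.+1%:R * h, (x - k.+1%:R * h + h)%R]%classic.
    by rewrite /cell_below kS opprD addrA subrK.
  have q1 : x / 4 <= x - k.+1%:R * h by rewrite kS; lra.
  apply: (le_trans (crude _ h _ hA0 _)); first by lra.
    apply: (le_trans he); rewrite -mulrA ler_wpM2l ?(ltW etac0)//; lra.
  rewrite lee_fin ler_wpM2l ?(ltW C0)// ler_wpM2l ?(ltW h0)//.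
  apply: (le_logprod _ _ (leqnn m)); first exact: logs_ge1_le hx4 q1.
  by rewrite kS; lra.
have above : (H (cell_above x h k) <= (C * (2 * h * (2 ^+ m.+1 * L x)))%:E)%E.
  have e2 : k.+2%:R = k%:R + 2 :> R by rewrite -addn2 natrD.
  have -> : cell_above x h k = `](x + k%:R * h), (x + k%:R * h + 2 * h)%R]%classic.
    by rewrite /cell_above e2 mulrDl addrA.
  apply: (le_trans (crude _ (2 * h) _ _ _)); [lra|lra| |].
    apply: (@le_trans _ _ (etac * x)); first by lra.
    by rewrite ler_wpM2l ?(ltW etac0)//; lra.
  rewrite lee_fin ler_wpM2l ?(ltW C0)// ler_wpM2l//; first by lra.
  apply: (le_trans _ (logprod_scale hxl _ (leqnn m))); last by lra.
  by apply: (le_logprod _ _ (leqnn m)); [apply: (logs_ge1_le hxl); lra|lra].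
apply: (le_trans (leeD below above)); rewrite -EFinD lee_fin le_eqVlt.
by apply/orP; left; apply/eqP; ring.
Qed.

(** The remainder does not depend on the number n of cells, because the tail moments over all cells
    sum to at most 2 [sqr_tail xi A]. *)
Lemma green_cell_bound_le C A0 xc etac delta A x h n : 0 < C -> 0 < etac ->
  (forall x l, xc <= x -> A0 <= l -> l <= etac * x ->
    (H `]x, (x + l)%R] <= (C * (l * L x))%:E)%E) ->
  A0 <= h -> 0 < delta -> 0 <= A -> 0 < h -> h <= etac / 4 * x -> 4 * xc <= x ->
  logs_ge1 m (x / 4) -> (forall k, (k < n)%N -> k%:R * h <= x / 2) -> h <= x / 8 ->
  (G (cell_bound delta A x h n) <= ((b + delta) / 2)%:E * H `]x, (x + h)%R] +
    (2 * sqr_tail xi A * (C * (1 + 2 * 2 ^+ m.+1) * (h * L x)))%:E)%E.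
Proof.
move=> C0 etac0 crude hA0 d0 A00 h0 he xxc hx4 kh h8.
have x0 : 0 < x by have := logs_ge1_ge1 hx4; lra.
have hxl : logs_ge1 m x by apply: (logs_ge1_le hx4); lra.
have L0 := logprod_gt0 hxl (leqnn m).
have mI : measurable (`]x, (x + h)%R]%classic : set R) by exact: measurable_itv.
have bd : 0 <= (b + delta) / 2 by have := b_gt0; lra.
have m1 := measurable_indic_fun mI.
have m2 : measurable_fun [set: R] (fun y => \sum_(0 <= k < n) cell_term A x h k y).
  by apply: measurable_sum => k; exact: measurable_cell_term.
rewrite /cell_bound (greenD (measurable_funM (measurable_cst _) m1) m2); last 2 first.
- by move=> y; rewrite mulr_ge0// indicE.
- by move=> y; apply: sumr_ge0 => k _; exact: cell_term_ge0.
rewrite (greenZ m1)// green_indic//; apply: leeD => //.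
rewrite (green_sum _ (measurable_cell_term A x h)); last first.
  by move=> k y; exact: cell_term_ge0.
apply: (@le_trans _ _ (\sum_(0 <= k < n) (dominating_tail xi (A + k%:R * h) h *
    (C * (1 + 2 * 2 ^+ m.+1) * (h * L x)))%:E)%E).
  rewrite !big_nat; apply: lee_sum => k /andP[_ kn].
  exact: (green_cell_term_le C0 etac0 crude hA0 A00 h0 he xxc hx4 (kh k kn) h8).
rewrite sumEFin lee_fin -mulr_suml.
apply: ler_wpM2r; last exact: sum_dominating_tail.
apply: mulr_ge0; last by apply: mulr_ge0; exact: ltW.
apply: mulr_ge0; first exact: ltW.
by apply: addr_ge0 => //; apply: mulr_ge0 => //; exact: exprn_ge0.
Qed.

Lemma lower_bound_arith delta A x h : 0 < delta -> delta <= 1 / 8 ->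
  delta * (1 + 8 * delta) ^+ N <= 1 -> 1 <= A ->
  2 * A <= delta * h -> h <= delta * x -> logs_ge1 m ((1 - 3 * delta) * x) ->
  0 < h -> forall Hr : R,
  (U (x + A) - U (x + h - A)) * (U (x + h - A) - delta * U (x + A)) <=
    u ((1 - 3 * delta) * x) ^+ 2 * ((b + delta) / 2 * Hr + delta * (h * L x)) ->
  0 <= (b + delta) / 2 * Hr + delta * (h * L x) ->
  2 / (b + delta) * ((1 - delta) * (((1 + 8 * delta) ^+ N)^-1 - delta) /
     (gamma * ((1 + 8 * delta) ^+ N) ^+ 3) - delta) * (h * L x) <= Hr.
Proof.
move=> d0 d8; set rN := (1 + 8 * delta) ^+ N => drN A1 hA hd.
set z0 := (1 - 3 * delta) * x => hz h0 Hr low rhs0.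
have rN0 : 0 < rN by rewrite exprn_gt0//; lra.
have b0 := b_gt0; have g0 := gamma_gt0.
have x0 : 0 < x.
  by rewrite -(pmulr_rgt0 _ d0); lra.
have dx8 : delta * x <= x / 8 by have := ler_wpM2r (ltW x0) d8; lra.
have dx0 : 0 <= delta * x by rewrite mulr_ge0 ?ltW.
have hxl : logs_ge1 m x by apply: (logs_ge1_le hz); rewrite /z0; lra.
have L0 := logprod_gt0 hxl (leqnn m).
have hA2 : 2 * A <= h.
  by apply: (le_trans hA); rewrite -[leRHS]mul1r ler_wpM2r ?(ltW h0)//; lra.
have ux := slope_gt0 gamma_gt0 hxl.
have uz0 := slope_gt0 gamma_gt0 hz.
have ab : x + A <= x + h - A by lra.
set a := x + A in low ab *; set beta := x + h - A in low ab *.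
have hal : logs_ge1 m a by apply: (logs_ge1_le hxl); rewrite /a; lra.
have hb : logs_ge1 m beta by exact: logs_ge1_le hal ab.
(* Since (1 + 8 delta) (1 - 3 delta) = 1 + 5 delta - 24 delta ^ 2 >= 1 for delta <= 1 / 8. *)
have r_z0 : z0 <= x <= (1 + 8 * delta) * z0.
  have : 0 <= delta * (x - 8 * (delta * x)) by rewrite mulr_ge0 ?(ltW d0)//; lra.
  by rewrite /z0; lra.
have r_beta : x <= beta <= (1 + 8 * delta) * x by rewrite /beta; lra.
have /andP[_ uz] := decays_near decu hz r_z0.
have /andP[_ ub] := decays_near decu hxl r_beta.
have /andP[_ Ub] := decays_near decU hxl r_beta.
rewrite -/rN in uz ub Ub.
have Ua : U a <= U x by apply: le_scale => //; rewrite /a; lra.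
have /andP[inc _] := scale_increment gamma_gt0 hal ab.
have Ux := scale_gt0 m gamma x.
(* The sign needed to multiply the two lower bounds in [key]. *)
have w0 : 0 <= rN^-1 - delta by rewrite subr_ge0 -[leRHS]mul1r ler_pdivlMr.
have d1 : 0 <= 1 - delta by lra.
have key : (u x / rN * ((1 - delta) * h)) * ((rN^-1 - delta) * U x) <=
    (U a - U beta) * (U beta - delta * U a).
  apply: ler_pM.
  - apply: mulr_ge0; first by apply: divr_ge0; exact: ltW.
    by apply: mulr_ge0 => //; exact: ltW.
  - by rewrite mulr_ge0// ltW.
  - apply: le_trans inc; apply: ler_pM.
    + by apply: divr_ge0; exact: ltW.
    + by apply: mulr_ge0 => //; exact: ltW.
    + by rewrite ler_pdivrMr// mulrC.
    + by rewrite /a /beta; lra.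
  - have q1 : rN^-1 * U x <= U beta by rewrite mulrC ler_pdivrMr// mulrC.
    have q2 : delta * U a <= delta * U x by rewrite ler_wpM2l// ltW.
    by rewrite mulrBl; lra.
have {}low : u x / rN * ((1 - delta) * h) * ((rN^-1 - delta) * U x) <=
    (rN * u x) ^+ 2 * ((b + delta) / 2 * Hr + delta * (h * L x)).
  apply: (le_trans key); apply: (le_trans low); apply: ler_wpM2r => //.
  rewrite lerXn2r ?nnegrE ?(ltW uz0)//; apply: mulr_ge0; exact: ltW.
rewrite (scale_slope hxl) in low; exact: lower_const_arith low.
Qed.

Lemma renewal_lower delta : 0 < delta -> delta <= 1 / 8 ->
  delta * (1 + 8 * delta) ^+ N <= 1 ->
  exists A x0 eta, 0 < eta /\ forall x h, x0 <= x -> A <= h -> h <= eta * x ->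
  ((2 / (b + delta) * ((1 - delta) * (((1 + 8 * delta) ^+ N)^-1 - delta) /
     (gamma * ((1 + 8 * delta) ^+ N) ^+ 3) - delta) * (h * L x))%:E
    <= H `]x, (x + h)%R])%E.
Proof.
move=> d0 d8 drN.
have b0 := b_gt0; have g0 := gamma_gt0.
have [C [A0 [xc [etac [C0 A01 etac0 crude]]]]] := renewal_crude.
pose C' := C * (1 + 2 * 2 ^+ m.+1).
have C'0 : 0 < C' by rewrite mulr_gt0// ltr_wpDr// mulr_ge0// exprn_ge0.
(* With this tail the contribution 2 [sqr_tail xi A] C' of all cells is at most delta. *)
have dC : 0 < delta / (2 * C') by rewrite divr_gt0// mulr_gt0.
have [A1 A10 hA1] := sqr_tail_small xi_L2 dC.
pose A := Num.max A1 1.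
have A_ge1 : 1 <= A by rewrite le_max lexx orbT.
have tA : sqr_tail xi A <= delta / (2 * C') by apply: hA1; rewrite le_max lexx.
have [y0 hgap] := gap_lower d0; have [y1 hvar] := variance d0.
have [y2 hcut] := cutoff d0.
have [y3 hlogs] := near_pinfty (@logs_ge1_near R m).
(* Beyond x1 the pointwise majorant of the gap is valid; the level a0 that the band must exceed
   depends on x1. *)
pose x1 := Num.max y0 (Num.max y1 (Num.max y2 (2 * y3))).
have [a0 {}hgap] := hgap x1 ltac:(by rewrite /x1 le_max lexx).
pose eta := Num.min delta (etac / 4).
have eta0 : 0 < eta by rewrite lt_min d0 divr_gt0.
exists (Num.max A0 (2 * A / delta)), (Num.max a0 (Num.max (4 * xc) (Num.max (4 * y3) 1))), eta.
split => // x h; rewrite !ge_max => /and4P[xa0 xxc xy3 x_ge1] /andP[hA0 hA] hx.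
have hd : h <= delta * x by apply: (le_trans hx); rewrite ler_wpM2r ?ge_min ?lexx//; lra.
have he : h <= etac / 4 * x.
  by apply: (le_trans hx); rewrite ler_wpM2r ?ge_min ?lexx ?orbT//; lra.
rewrite ler_pdivrMr// [h * _]mulrC in hA.
have h0 : 0 < h by lra.
have x_ge0 : 0 <= x by lra.
have dx8 : delta * x <= x / 8 by have := ler_wpM2r x_ge0 d8; lra.
have hA2 : 2 * A <= h.
  by apply: (le_trans hA); rewrite -[leRHS]mul1r ler_wpM2r ?(ltW h0)//; lra.
have hz : logs_ge1 m ((1 - 3 * delta) * x) by apply: hlogs; lra.
have hx4 : logs_ge1 m (x / 4) by apply: hlogs; lra.
have hxl : logs_ge1 m x by apply: hlogs; lra.
have L0 := logprod_gt0 hxl (leqnn m).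
(* Just enough cells to cover the distance 4 delta x on either side, so that k h <= 4 delta x <= x /
   2 for each of them. *)
pose n := (Num.trunc (4 * delta * x / h)).+1.
have nh : 4 * delta * x < n%:R * h by rewrite -ltr_pdivrMr// truncnS_gt.
have A0' : 0 <= A by lra.
have kle k : (k < n)%N -> k%:R * h <= x / 2.
  rewrite ltnS => kn; apply: (@le_trans _ _ (4 * delta * x)); last by lra.
  rewrite -ler_pdivlMr//.
  have t0 : 0 <= 4 * delta * x / h by apply: divr_ge0;
      [apply: mulr_ge0 => //; apply: mulr_ge0 => //|]; exact: ltW.
  have /andP[t1 _] := truncn_itv t0; apply: le_trans t1.
  by rewrite ler_nat.
have cell0 y : 0 <= cell_bound delta A x h n y by exact: cell_bound_ge0 (ltW d0) A0' h0.
have mcell := measurable_cell_bound delta A x h n.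
have usq : 0 <= u ((1 - 3 * delta) * x) ^+ 2 by exact: sqr_ge0.
have low : (((U (x + A) - U (x + h - A)) * (U (x + h - A) - delta * U (x + A)))%:E <=
    (u ((1 - 3 * delta) * x) ^+ 2)%:E * G (cell_bound delta A x h n))%E.
  rewrite -greenZ//; apply: hgap => //; [lra|lra| | |].
  - exact: measurable_funM.
  - by move=> y; exact: mulr_ge0.
  move=> y Sy; rewrite /x1 !ge_max => /and4P[yy0 yy1 yy2 yy3].
  apply: gap_le_cells => //; first by apply: hlogs; lra.
    exact: hcut.
  by have /andP[] := hvar y yy1 Sy.
have Gc := green_cell_bound_le (n := n) C0 etac0 crude hA0 d0 A0' h0 he xxc hx4 kle
  (le_trans hd dx8).
have hL : 0 <= C' * (h * L x) by rewrite mulr_ge0 ?(ltW C'0)// mulr_ge0// ltW.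
have rem : 2 * sqr_tail xi A * (C' * (h * L x)) <= delta * (h * L x).
  have -> : delta * (h * L x) = 2 * (delta / (2 * C')) * (C' * (h * L x)).
    by field; rewrite gt_eqF.
  by rewrite ler_wpM2r// ler_wpM2l.
have {}low : (((U (x + A) - U (x + h - A)) * (U (x + h - A) - delta * U (x + A)))%:E <=
    (u ((1 - 3 * delta) * x) ^+ 2)%:E * (((b + delta) / 2)%:E * H `]x, (x + h)%R] +
      (delta * (h * L x))%:E))%E.
  apply: (le_trans low); apply: lee_wpmul2l; first by rewrite lee_fin.
  by apply: (le_trans Gc); apply: leeD => //; rewrite lee_fin.
move: low; have : (0 <= H `]x, (x + h)%R])%E.
  by apply: nneseries_ge0.
(* An infinite renewal measure satisfies the lower bound trivially. *)
case: (H _) => [Hr Hr0|_ _|//]; last by rewrite leey.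
rewrite -EFinM !lee_fin => low.
apply: (lower_bound_arith d0 d8 drN A_ge1 hA hd hz h0 low).
rewrite lee_fin in Hr0.
apply: addr_ge0; first by apply: mulr_ge0 => //; lra.
by apply: mulr_ge0; [exact: ltW|apply: mulr_ge0; exact: ltW].
Qed.

End renewal_bounds.

(** * Limits of the constants and the conclusion *)

Lemma upper_constant_cvg (R : realType) (b gamma : R) N : 0 < b -> 0 < gamma ->
  2 * (1 + x) * (1 + 4 * x) ^+ (4 * N) / ((b - 2 * x) * gamma) * (1 + 2 * x)
    @[x --> 0^'+] --> 2 / (b * gamma).
Proof.
move=> b0 g0.
have aff (c a : R) : c + a * x @[x --> 0^'+] --> c.
  rewrite -[X in _ --> X]addr0 -[X in c + X](mulr0 a).
  apply: cvgD; first exact: cvg_cst.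
  apply: cvgM; first exact: cvg_cst.
  exact: cvg_at_right_filter cvg_id.
have pow n : (1 + 4 * x) ^+ n @[x --> 0^'+] --> (1 : R).
  elim: n => [|n IH]; first by under eq_fun do rewrite expr0; exact: cvg_cst.
  rewrite (_ : (fun x => (1 + 4 * x) ^+ n.+1) = (fun x => 1 + 4 * x) \* (fun x => (1 + 4 * x) ^+ n)).
    by rewrite -[X in _ --> X]mulr1; apply: cvgM; [exact: aff|exact: IH].
  by apply/funext => x; rewrite exprS.
have h1 : 1 + x @[x --> 0^'+] --> (1 : R).
  by have := aff 1 1; under eq_fun do rewrite mul1r.
have h2 : b - 2 * x @[x --> 0^'+] --> b.
  by have := aff b (-2); under eq_fun do rewrite mulNr.
rewrite [X in _ --> X](_ : _ = 2 * 1 * 1 / (b * gamma) * 1); last by rewrite !mulr1.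
apply: cvgM; last exact: aff.
apply: cvgM; first by apply: cvgM; [apply: cvgM; [exact: cvg_cst|]|].
apply: cvgV; first by rewrite gt_eqF// mulr_gt0.
by apply: cvgM => //; exact: cvg_cst.
Qed.

Lemma lower_constant_cvg (R : realType) (b gamma : R) N : 0 < b -> 0 < gamma ->
  2 / (b + x) * ((1 - x) * (((1 + 8 * x) ^+ N)^-1 - x) /
     (gamma * ((1 + 8 * x) ^+ N) ^+ 3) - x) @[x --> 0^'+] --> 2 / (b * gamma).
Proof.
move=> b0 g0.
have hx : x @[x --> 0^'+] --> (0 : R) by exact: cvg_at_right_filter cvg_id.
have aff (c a : R) : c + a * x @[x --> 0^'+] --> c.
  rewrite -[X in _ --> X]addr0 -[X in c + X](mulr0 a).
  apply: cvgD; first exact: cvg_cst.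
  by apply: cvgM => //; exact: cvg_cst.
have powr (f : R -> R) n : f x @[x --> 0^'+] --> (1 : R) ->
    f x ^+ n @[x --> 0^'+] --> (1 : R).
  move=> h; elim: n => [|n IH]; first by under eq_fun do rewrite expr0; exact: cvg_cst.
  rewrite (_ : (fun x => f x ^+ n.+1) = f \* (fun x => f x ^+ n)).
    by rewrite -[X in _ --> X]mulr1; exact: cvgM.
  by apply/funext => x; rewrite exprS.
have pow : (1 + 8 * x) ^+ N @[x --> 0^'+] --> (1 : R) by apply: powr; exact: aff.
have h1 : 1 - x @[x --> 0^'+] --> (1 : R).
  by have := aff 1 (-1); under eq_fun do rewrite mulN1r.
have h2 : b + x @[x --> 0^'+] --> b.
  by have := aff b 1; under eq_fun do rewrite mul1r.
rewrite [X in _ --> X](_ : _ = 2 / b * (1 * (1^-1 - 0) / (gamma * 1) - 0)); last first.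
  by field; rewrite !gt_eqF.
apply: cvgM.
  by apply: cvgM; [exact: cvg_cst|apply: cvgV => //; rewrite gt_eqF].
apply: cvgB => //; apply: cvgM.
  by apply: cvgM => //; apply: cvgB => //; apply: cvgV.
apply: cvgV; first by rewrite mulr1 gt_eqF.
by apply: cvgM; [exact: cvg_cst|exact: powr].
Qed.

Theorem theorem2 (R : realType)
    (d : measure_display) (T : measurableType d) (P : probability T R)
    (S : set R) (mS : measurable S)
    (K : R.-pker R ~> R) (X : nat -> {RV P >-> R})
    (HX : markov_chain S K X)
    (Xlimsup : {ae P, forall w, limn_esup (fun n => (X n w)%:E) = +oo%E})
    (m : nat) (m_ge1 : (1 <= m)%N)
    (gamma : R) (gamma_gt0 : 0 < gamma) (b : R) (b_gt0 : 0 < b)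
    (s : R -> R)
    (s_gt0 : forall x : R, 0 <= x -> 0 < s x)
    (s_incr : {in `[0, +oo[ &, {homo s : x y / x <= y}})
    (s_small : s =o_ (pinfty_nbhs R) (fun x => x))
    (drift : exists r : R -> R,
      r x @[x --> within S (pinfty_nbhs R)] --> 0 /\
      \forall x \near within S (pinfty_nbhs R),
        2 * trunc_moment K 1 (s x) x / trunc_moment K 2 (s x) x =
        \sum_(0 <= j < m) (logprod j x)^-1
        + (gamma + 1 + r x) / logprod m x)
    (variance :
      trunc_moment K 2 (s x) x @[x --> within S (pinfty_nbhs R)] --> b)
    (eps : R) (eps_gt0 : 0 < eps)
    (big_jumps : (fun x => jump_tail K (s x) x)
      =o_ (within S (pinfty_nbhs R))
        (fun x => (x ^+ 2 * ln x `^ (2 + eps))^-1))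
    (third_moment : (fun x => trunc_abs_moment K 3 (s x) x)
      =o_ (within S (pinfty_nbhs R)) (fun x => x / ln x `^ (1 + eps)))
    (d' : measure_display) (T' : measurableType d') (Q : probability T' R)
    (xihat : {RV Q >-> R})
    (xihat_L2 : ('E_Q[fun w => (xihat w ^+ 2)%R] < +oo)%E)
    (dominated : forall y : R, S y -> 0 <= y ->
      st_le (jump_law K y) Q
        (fun u => `|u| * \1_[set v : R | `|v| <= s y] u) xihat) :
  forall h : R -> R, increases_to_infty h ->
    h =o_ (pinfty_nbhs R) (fun x => x) ->
    (renewal_measure X `]x, (x + h x)%R]
       * ((2 * h x / (b * gamma) * logprod m x)^-1)%:E)%E
      @[x --> +oo] --> 1%E.
Proof.
have cut := cutoff_near s_small.
have var := variance_near variance.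
have tl := jump_tail_near m_ge1 big_jumps.
have inc := increment_near m_ge1 b_gt0 eps_gt0 s_small drift variance third_moment.
have gle := green_gap_le HX gamma_gt0 b_gt0 eps_gt0 cut tl inc.
have gge := green_gap_ge HX Xlimsup gamma_gt0 b_gt0 eps_gt0 cut tl inc.
have [N [dU du _]] := @scale_functions_decay R m gamma gamma_gt0.
have up := renewal_upper gamma_gt0 s_gt0 cut var xihat_L2 dominated gle dU du.
have lo := renewal_lower gamma_gt0 b_gt0 s_gt0 cut var xihat_L2 dominated gle gge dU du.
move=> h [_ h_infty] h_small; set k := 2 / (b * gamma).
have bg0 : 0 < b * gamma by rewrite mulr_gt0.
have k0 : 0 < k by rewrite divr_gt0.
suff ratio e : 0 < e -> \forall x \near +oo,
    [/\ 0 < h x * logprod m x,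
    ((k * (1 - e) * (h x * logprod m x))%:E <=
       renewal_measure X `]x, (x + h x)%R])%E &
    (renewal_measure X `]x, (x + h x)%R] <=
       (k * (1 + e) * (h x * logprod m x))%:E)%E].
  have scale_eq x : 2 * h x / (b * gamma) * logprod m x = k * (h x * logprod m x).
    by rewrite /k; field; rewrite !gt_eqF.
  have H0 x : (0 <= renewal_measure X `]x, (x + h x)%R])%E by apply: nneseries_ge0.
  apply/fine_cvgP; split.
    (* Any fixed e gives the finiteness required before passing to real values. *)
    have := ratio 1 ltr01; apply: filterS => x [hL _ xup].
    rewrite scale_eq fin_numM// ge0_fin_numE//.
    by rewrite (le_lt_trans xup)// ltry.
  apply/cvgrPdist_le => e e0; have := ratio e e0; apply: filterS => x [hL xlo xup] /=.
  have Hfin : renewal_measure X `]x, (x + h x)%R] \is a fin_num.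
    by rewrite ge0_fin_numE// (le_lt_trans xup)// ltry.
  move: xlo xup; rewrite -(fineK Hfin) scale_eq -EFinM !lee_fin /=.
  move: (fine _) => H1 xlo xup.
  have c0 : 0 < k * (h x * logprod m x) by rewrite mulr_gt0.
  have -> : 1 - H1 / (k * (h x * logprod m x)) =
      (k * (h x * logprod m x) - H1) / (k * (h x * logprod m x)).
    by rewrite mulrBl divff// gt_eqF.
  rewrite normrM [X in _ * X]gtr0_norm ?invr_gt0// ler_pdivrMr// ler_norml.
  by move: xlo xup; rewrite -![k * _ * _]mulrA; lra.
move=> e0.
have ke : 0 < k * e by rewrite mulr_gt0.
have [delta [d0 d8 db [dN cup clo]]] : exists delta, [/\ 0 < delta, delta <= 1 / 8,
    delta <= b / 4 & [/\ delta * (1 + 8 * delta) ^+ N <= 1,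
    2 * (1 + delta) * (1 + 4 * delta) ^+ (4 * N) / ((b - 2 * delta) * gamma)
      * (1 + 2 * delta) <= k * (1 + e) &
    k * (1 - e) <= 2 / (b + delta) * ((1 - delta) * (((1 + 8 * delta) ^+ N)^-1 - delta) /
     (gamma * ((1 + 8 * delta) ^+ N) ^+ 3) - delta)]].
  (* All requirements hold for small positive delta, the last two because both constants tend to
     k. *)
  near (0 : R)^'+ => delta; exists delta.
  have d0 : 0 < delta by near: delta; exact: nbhs_right_gt.
  have d8 : delta <= 1 / 8 by near: delta; apply: nbhs_right_le; lra.
  split => //.
    by near: delta; apply: nbhs_right_le; rewrite divr_gt0.
  split.
  (* As 1 + 8 delta <= 2, it suffices that delta <= 2 ^ (-N). *)
  - have dN : delta <= (2 ^+ N)^-1.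
      by near: delta; apply: nbhs_right_le; rewrite invr_gt0 exprn_gt0.
    apply: (@le_trans _ _ ((2 ^+ N)^-1 * 2 ^+ N)); last by rewrite mulVf// expf_neq0.
    apply: ler_pM; [exact: ltW|by apply: exprn_ge0; lra|exact: dN|].
    have q0 : 0 <= 1 + 8 * delta by lra.
    by rewrite lerXn2r ?nnegrE//; lra.
  - near: delta; have /cvgrPdist_le/(_ _ ke) := upper_constant_cvg N b_gt0 gamma_gt0.
    by apply: filterS => z; rewrite -/k ler_norml; lra.
  - near: delta; have /cvgrPdist_le/(_ _ ke) := lower_constant_cvg N b_gt0 gamma_gt0.
    by apply: filterS => z; rewrite -/k ler_norml; lra.
have d4 : delta <= 1 / 4 by lra.
have bd : 0 < b - 2 * delta by have := b_gt0; lra.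
have [A1 A10 hA1] := sqr_tail_small xihat_L2 d0.
pose A := Num.max A1 1; have A_ge1 : 1 <= A by rewrite le_max lexx orbT.
have tA : sqr_tail xihat A <= delta by apply: hA1; rewrite le_max lexx.
have [x1 hup] := up _ _ d0 d4 bd A_ge1 tA.
have [A2 [x2 [eta [eta0 hlo]]]] := lo _ d0 d8 dN.
have [x3 h3] := littleo_pinfty_bound h_small d0.
have [x4 h4] := littleo_pinfty_bound h_small eta0.
have [x5 hlogs] := near_pinfty (@logs_ge1_near R m).
(* A2 is the shortest length allowed in the lower bound; A / delta makes the widening 2 A at most 2
   delta h x, whence the factor 1 + 2 delta in the upper constant. *)
have /cvgryPge/(_ (Num.max 1 (Num.max A2 (A / delta)))) hbig := h_infty.
near=> x.
have : Num.max 1 (Num.max A2 (A / delta)) <= h x by near: x; exact: hbig.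
rewrite !ge_max => /and3P[h_ge1 hA2 hA].
have y1 : x1 <= x by near: x; apply: nbhs_pinfty_ge; exact: num_real.
have y2 : x2 <= x by near: x; apply: nbhs_pinfty_ge; exact: num_real.
have y3 : x3 <= x by near: x; apply: nbhs_pinfty_ge; exact: num_real.
have y4 : x4 <= x by near: x; apply: nbhs_pinfty_ge; exact: num_real.
have y5 : x5 <= x by near: x; apply: nbhs_pinfty_ge; exact: num_real.
have y6 : 0 <= x by near: x; apply: nbhs_pinfty_ge; exact: num_real.
have h0 : 0 < h x by exact: lt_le_trans ltr01 h_ge1.
have L0 := logprod_gt0 (hlogs x y5) (leqnn m).
have hL : 0 < h x * logprod m x by exact: mulr_gt0.
have hd : h x <= delta * x.
  by have := h3 x y3; rewrite (ger0_norm y6); apply: le_trans; exact: ler_norm.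
have he : h x <= eta * x.
  by have := h4 x y4; rewrite (ger0_norm y6); apply: le_trans; exact: ler_norm.
split => //.
  apply: le_trans (hlo x (h x) y2 hA2 he); rewrite lee_fin.
  by apply: ler_wpM2r => //; exact: ltW.
apply: (le_trans (hup x (h x) y1 (ltW h0) hd)); rewrite lee_fin.
apply: (le_trans _ (ler_wpM2r (ltW hL) cup)); rewrite -[leRHS]mulrA.
have c0 : 0 <= 2 * (1 + delta) * (1 + 4 * delta) ^+ (4 * N) / ((b - 2 * delta) * gamma).
  apply: divr_ge0; last by apply: mulr_ge0; exact: ltW.
  by apply: mulr_ge0; [|apply: exprn_ge0]; lra.
apply: ler_wpM2l => //; rewrite [leRHS]mulrA; apply: ler_wpM2r; first exact: ltW.
by rewrite ler_pdivrMr// in hA; lra.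
Unshelve. all: by end_near. Qed.
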